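(* Let $m\ge6$ and $s_c=\frac12-\frac1{m-1}$. (i) There is $C=C(m)$ such that for all $u_1,\dots,u_m\in\dot X^{s_c}$ and $\tilde u_i\in\{u_i,\bar u_i\}$, $\big\|\partial_x^3\prod_{i=1}^m\tilde u_i\big\|_{\dot Z^{s_c}}\le C\prod_{i=1}^m\|u_i\|_{\dot X^{s_c}}$. (ii) For every $s\ge s_c$ there is $C=C(m,s)$ such that for all $u_1,\dots,u_m\in X^s$ and $\tilde u_i\in\{u_i,\bar u_i\}$, $\big\|\partial_x^3\prod_{i=1}^m\tilde u_i\big\|_{Z^s}\le C\prod_{i=1}^m\|u_i\|_{X^s}$.
   Context: $\widehat f(\xi)=(2\pi)^{-1/2}\int e^{-ix\xi}f(x)dx$. Fix a nonnegative even $\varphi\in C_0^\infty((-2,2))$ with $\varphi=1$ on $[-1,1]$, $\varphi\le1$; for $N\in2^{\mathbb Z}$, $\psi_N(r)=\varphi(r/N)-\varphi(2r/N)$, $P_Nf=\mathcal F^{-1}[\psi_N(\xi)\widehat f]$ (acting in $x$). Mixed norms over $\mathbb R_t\times\mathbb R_x$: $\|u\|_{L^p_tL^q_x}=\|\|u(t)\|_{L^q_x}\|_{L^p_t}$, $\|u\|_{L^q_xL^p_t}=\|\|u(\cdot,x)\|_{L^p_t}\|_{L^q_x}$. For $N\in2^{\mathbb Z}$: $\|u\|_{X_N}=\|u\|_{L^\infty_tL^2_x}+N^{-1/4}\|u\|_{L^4_xL^\infty_t}+N^{3/2}\|u\|_{L^\infty_xL^2_t}$ and $\|F\|_{Z_N}=N^{-3/2}\|F\|_{L^1_xL^2_t}$.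 $\|u\|_{\dot X^s}=(\sum_{N\in2^{\mathbb Z}}N^{2s}\|P_Nu\|^2_{X_N})^{1/2}$, $\|u\|_{X^s}=\|u\|_{\dot X^0}+\|u\|_{\dot X^s}$, $\|F\|_{\dot Z^s}=(\sum_{N\in2^{\mathbb Z}}N^{2s}\|P_NF\|^2_{Z_N})^{1/2}$, $\|F\|_{Z^s}=\|F\|_{\dot Z^0}+\|F\|_{\dot Z^s}$. *)

(* Defs.v *)
From HB Require Import structures.
From mathcomp Require Import all_boot all_order all_algebra.
From mathcomp Require Import complex.
From mathcomp Require Import all_classical all_reals all_analysis.
From mathcomp Require Import ess_sup_inf.

Set Implicit Arguments.
Unset Strict Implicit.
Unset Printing Implicit Defensive.

Import Order.TTheory GRing.Theory Num.Theory.
Import numFieldNormedType.Exports.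

Local Open Scope classical_set_scope.
Local Open Scope ring_scope.

Section KdVdefs.
Variable R : realType.

Local Notation mu := (@lebesgue_measure R).
Local Notation C := R[i].

Definition cabs (z : C) : R := Num.sqrt (complex.Re z ^+ 2 + complex.Im z ^+ 2).

Definition cint (f : R -> C) : C :=
  Complex (Rintegral mu setT (fun y => complex.Re (f y))) (Rintegral mu setT (fun y => complex.Im (f y))).

Definition cexp (th : R) : C := Complex (cos th) (sin th).

Definition admissible_cutoff (phi : R -> R) : Prop :=
  (forall n x, derivable (derive1n n phi) x 1) /\
  (exists a : R, a < 2 /\ forall x, a <= `|x| -> phi x = 0) /\
  (forall x, 0 <= phi x) /\ (forall x, phi (- x) = phi x) /\
  (forall x, `|x| <= 1 -> phi x = 1) /\ (forall x, phi x <= 1).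

Definition dyad (k : int) : R := (2 : R) ^ k.

Definition psiN (phi : R -> R) (N : R) (r : R) : R := phi (r / N) - phi (2 * r / N).

(* Convolution kernel of the Fourier multiplier a(xi), for the convention
   \hat f(xi) = (2 pi)^{-1/2} \int e^{-ix xi} f(x) dx:
   F^{-1}[a \hat f](x) = \int K_a(x-y) f(y) dy, K_a(z) = (2 pi)^{-1} \int e^{i z xi} a(xi) dxi. *)
Definition mult_kernel (a : R -> C) (z : R) : C :=
  Complex ((2 * pi)^-1) 0 * cint (fun xi => cexp (z * xi) * a xi).

Definition mult_op (a : R -> C) (f : R -> C) (x : R) : C :=
  cint (fun y => mult_kernel a (x - y) * f y).

Definition PN_symbol (phi : R -> R) (k : int) (xi : R) : C := Complex (psiN phi (dyad k) xi) 0.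
Definition PND3_symbol (phi : R -> R) (k : int) (xi : R) : C :=
  (Complex 0 xi) ^+ 3 * Complex (psiN phi (dyad k) xi) 0.

Definition PN (phi : R -> R) (k : int) (u : R -> R -> C) : R -> R -> C :=
  fun t x => mult_op (PN_symbol phi k) (u t) x.
Definition PND3 (phi : R -> R) (k : int) (u : R -> R -> C) : R -> R -> C :=
  fun t x => mult_op (PND3_symbol phi k) (u t) x.

Local Open Scope ereal_scope.

Definition eLnorm (p : \bar R) (h : R -> \bar R) : \bar R :=
  match p with
  | r%:E => (\int[mu]_x (h x `^ r)) `^ (r^-1)
  | +oo => ess_sup mu h
  | -oo => 0
  end.

Definition LtLx (p q : \bar R) (u : R -> R -> C) : \bar R :=
  eLnorm p (fun t => eLnorm q (fun x => (cabs (u t x))%:E)).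
Definition LxLt (q p : \bar R) (u : R -> R -> C) : \bar R :=
  eLnorm q (fun x => eLnorm p (fun t => (cabs (u t x))%:E)).

Definition XN (N : R) (u : R -> R -> C) : \bar R :=
  LtLx +oo 2%:E u + (N `^ (- 4^-1))%:E * LxLt 4%:E +oo u
  + (N `^ (3 / 2))%:E * LxLt +oo 2%:E u.
Definition ZN (N : R) (F : R -> R -> C) : \bar R :=
  (N `^ (- (3 / 2)))%:E * LxLt 1%:E 2%:E F.

Definition Xdot (phi : R -> R) (s : R) (u : R -> R -> C) : \bar R :=
  (\esum_(k in [set: int]) ((dyad k `^ s) ^+ 2)%:E * (XN (dyad k) (PN phi k u) * XN (dyad k) (PN phi k u)))
    `^ (2^-1).
Definition Zdot_op (P : int -> (R -> R -> C) -> (R -> R -> C)) (s : R) (F : R -> R -> C) : \bar R :=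
  (\esum_(k in [set: int]) ((dyad k `^ s) ^+ 2)%:E * (ZN (dyad k) (P k F) * ZN (dyad k) (P k F)))
    `^ (2^-1).
Definition Zdot (phi : R -> R) (s : R) (F : R -> R -> C) : \bar R := Zdot_op (PN phi) s F.

Definition Xs (phi : R -> R) (s : R) (u : R -> R -> C) : \bar R := Xdot phi 0 u + Xdot phi s u.
Definition Zs_op (P : int -> (R -> R -> C) -> (R -> R -> C)) (s : R) (F : R -> R -> C) : \bar R :=
  Zdot_op P 0 F + Zdot_op P s F.

(* ||\partial_x^3 F||_{\dot Z^s} and ||\partial_x^3 F||_{Z^s}: P_N is applied to \partial_x^3 F,
   i.e. the multiplier (i xi)^3 psi_N(xi) is applied to F *)
Definition ZdotD3 (phi : R -> R) (s : R) (F : R -> R -> C) : \bar R := Zdot_op (PND3 phi) s F.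
Definition ZsD3 (phi : R -> R) (s : R) (F : R -> R -> C) : \bar R := Zs_op (PND3 phi) s F.

(* Standing regularity of a space-time function: jointly measurable and, for a.e. t,
   u(t) in L^{m-1}(R) (this realises the homogeneous spaces: it excludes polynomial parts,
   and \dot H^{s_c}(R) embeds in L^{m-1}) *)
Definition admissible_fun (m : nat) (u : R -> R -> C) : Prop :=
  measurable_fun setT (fun p : R * R => complex.Re (u p.1 p.2)) /\
  measurable_fun setT (fun p : R * R => complex.Im (u p.1 p.2)) /\
  {ae mu, forall t, eLnorm (m.-1%:R)%:E (fun x => (cabs (u t x))%:E) < +oo}.

Definition D3_well_defined (phi : R -> R) (F : R -> R -> C) : Prop :=
  {ae mu, forall t, forall (k : int) (x : R),
     mu.-integrable setT
       (fun y => (cabs (mult_kernel (PND3_symbol phi k) (x - y) * F t y))%:E)}.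

End KdVdefs.

Local Open Scope ring_scope.
Definition tilde_prod (R : realType) (m : nat) (u : 'I_m -> R -> R -> R[i]) (b : 'I_m -> bool)
  : R -> R -> R[i] :=
  fun t x => \prod_(i < m) (if b i then u i t x else conjc (u i t x)).

Definition s_crit (R : realType) (m : nat) : R := 2^-1 - (m.-1%:R)^-1.

(* Main.v *)
(* Put p = m - 1 and let X_i be the critical norm of u_i. Split every factor at frequency 2^(n-J),
   where 2^J >= 4 m: the product of the low parts has no frequency above 2^n / 2, so P_n d_x^3
   annihilates it, and telescoping the difference of the two products leaves
     |P_n d_x^3 F| <= C sum_j int |K_n(x - y)| |u_j - low u_j| prod_{i <> j} b_i(y) dy,
   where b_i bounds |u_i| and all its low parts, uniformly in t. Bernstein's inequality
   |P_k u_i| <= C 2^(k/2) |u_i|_{X, k} for small k, and the maximal function norm L^4_x L^infty_t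
   for large k, show that sum_k |P_k u_i| is at most b_i = C X_i Q^(1/p) with int Q <= m; the p
   factors b_i thus give the integrable weight Q. The high-frequency factor is put in L^2_t by the
   smoothing norm L^infty_x L^2_t, through Cauchy-Schwarz with respect to the weight |K_n(x - y)| Q(y),
   and the sum over the frequencies above 2^(n-J) converges because s >= 0.
   A complex conjugation changes neither the norms nor the argument, the kernels being real. *)

(* How the exponents fit: since 1/2 = 1/p + s_c, Bernstein bounds the piece of u_i at frequency 2^k
   by 2^(k/p) X_i, while the maximal norm bounds it by 2^(-k(1/4 - 1/p)) X_i Q^(1/4). The two bounds
   cross at 2^k = Q, where both equal X_i Q^(1/p), and the sum above the crossing converges because
   p >= 5, that is m >= 6. Cauchy-Schwarz leaves the factor W_n(x)^2, where W_n is the convolution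
   of |K_n| with Q. The L^1_x L^2_t norm thus costs the mass of W_n, of order 2^(3n). Squared, and
   with the factor 2^(-3n) of the squared Z norm, this is 2^(3n), to be compared with the 2^(-3k) of
   the smoothing norm for k > n - J. The obstacle is that the factors are only in L^p in x, so their
   Fourier transforms need not be functions. All spectral statements are therefore put on the kernel
   side: a kernel is a cosine integral of a C^2 symbol, hence dominated by a Lorentzian, and a
   low-pass factor is expanded into cosines by Fubini, each of which shifts a frequency by a
   controlled amount. *)
Require Import Defs.
From HB Require Import structures.
From mathcomp Require Import all_boot all_order all_algebra.
From mathcomp Require Import complex.
From mathcomp Require Import all_classical all_reals all_analysis.
From mathcomp Require Import measurable_realfun ess_sup_inf.
From mathcomp Require Import ring lra zify.

Set Implicit Arguments.
Unset Strict Implicit.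
Unset Printing Implicit Defensive.

Import Order.TTheory GRing.Theory Num.Theory.
Import numFieldNormedType.Exports.

Local Open Scope classical_set_scope.
Local Open Scope ring_scope.

(** * Integration on the line and the Lorentzian kernel *)

(* The common majorant of all the kernels at frequency [N]; its integral does not depend on [N]. *)
HB.lock Definition lor (R : realType) (N z : R) : R := N / (1 + (N * z) ^+ 2).

Section Integration.
Variable R : realType.
Local Notation mu := (@lebesgue_measure R).
Implicit Types f g h : R -> R.

Definition Rint f : R := Rintegral mu setT f.
Definition integrableR f : Prop := mu.-integrable setT (EFin \o f).

Lemma measurable_subl (c : R) : measurable_fun setT (fun y : R => c - y).
Proof. by apply: measurable_funB. Qed.

(** Reflection maps a half-open interval to one of the same length that is open at the other end;
    uniqueness of Lebesgue measure does the rest. *)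
Lemma pushforward_subl (c : R) (A : set R) : measurable A ->
  pushforward mu (fun y : measurableTypeR R => c - y : measurableTypeR R) A = mu A.
Proof.
move=> mA; apply/esym/lebesgue_measure_unique => //= [|mc _ [[a b]] _ <-].
  exact: measurable_subl.
rewrite /pushforward /=.
rewrite [X in _ = _ X](_ : _ = `[c - b, c - a[%classic).
  rewrite !lebesgue_measure_itv/= !lte_fin ltrD2l ltrN2.
  by case: ifP => // _; rewrite -!EFinD; congr EFin; ring.
by apply/seteqP; split => y /=; rewrite !in_itv /=; lra.
Qed.

Lemma ge0_integral_subl (c : R) (f : R -> \bar R) : measurable_fun setT f ->
  (forall x, 0 <= f x)%E -> (\int[mu]_y f (c - y)%R = \int[mu]_y f y)%E.
Proof.
move=> mf f0.
have mc : measurable_fun setT (fun y : measurableTypeR R => c - y : measurableTypeR R).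
  exact: measurable_subl.
rewrite -(ge0_integral_pushforward mc mu (D := setT))//=.
by apply: eq_measure_integral => A mA _; exact: pushforward_subl.
Qed.

Lemma integral_subl (c : R) (f : R -> \bar R) : measurable_fun setT f ->
  (\int[mu]_y f (c - y)%R = \int[mu]_y f y)%E.
Proof.
move=> mf; rewrite integralE [RHS]integralE; congr (_ - _)%E.
  rewrite -[RHS](ge0_integral_subl c)//; last exact: measurable_funepos.
  by apply: eq_integral => y _; rewrite !funeposE.
rewrite -[RHS](ge0_integral_subl c)//; last exact: measurable_funeneg.
by apply: eq_integral => y _; rewrite !funenegE.
Qed.

Lemma Rint_subl (c : R) f : measurable_fun setT f -> Rint (fun y => f (c - y)) = Rint f.
Proof.
move=> mf; rewrite /Rint /Rintegral (integral_subl c (f := EFin \o f))//.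
exact/measurable_EFinP.
Qed.

Lemma integrableR_dom f g : measurable_fun setT f -> integrableR g ->
  (forall x, `|f x| <= g x) -> integrableR f.
Proof.
move=> mf ig fg; apply: (le_integrable _ _ _ ig) => //; first exact/measurable_EFinP.
by move=> x _ /=; rewrite lee_fin (le_trans (fg x))// ler_norm.
Qed.

Lemma integrableR_measurable f : integrableR f -> measurable_fun setT f.
Proof. by move/measurable_int/measurable_EFinP. Qed.

Lemma EFin_Rint f : integrableR f -> (\int[mu]_x (f x)%:E = (Rint f)%:E)%E.
Proof. by move=> fi; rewrite fineK//; exact: integrable_fin_num. Qed.

Lemma Rint_le f g : integrableR f -> integrableR g -> (forall x, f x <= g x) ->
  Rint f <= Rint g.
Proof. by move=> fi gi fg; apply: le_Rintegral. Qed.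

Lemma Rint_ge0 f : (forall x, 0 <= f x) -> 0 <= Rint f.
Proof. by move=> f0; apply: Rintegral_ge0. Qed.

Lemma normr_Rint_dom f g : measurable_fun setT f -> integrableR g ->
  (forall x, `|f x| <= g x) -> `|Rint f| <= Rint g.
Proof.
move=> mf ig fg; have fi := integrableR_dom mf ig fg.
apply: le_trans (le_normr_Rintegral _ _) _ => //.
by apply: le_Rintegral => //; exact: integrable_norm.
Qed.

Lemma RintD f g : integrableR f -> integrableR g ->
  Rint (fun x => f x + g x) = Rint f + Rint g.
Proof. by move=> fi gi; apply: RintegralD. Qed.

Lemma RintB f g : integrableR f -> integrableR g ->
  Rint (fun x => f x - g x) = Rint f - Rint g.
Proof. by move=> fi gi; apply: RintegralB. Qed.

Lemma RintZl (r : R) f : integrableR f -> Rint (fun x => r * f x) = r * Rint f.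
Proof. by move=> fi; apply: RintegralZl. Qed.

Lemma eq_Rint f g : f =1 g -> Rint f = Rint g.
Proof. by move=> /funext ->. Qed.

Lemma integrableRD f g : integrableR f -> integrableR g ->
  integrableR (fun x => f x + g x).
Proof.
move=> fi gi; apply: eq_integrable (integrableD measurableT fi gi) => //.
Qed.

Lemma integrableRB f g : integrableR f -> integrableR g ->
  integrableR (fun x => f x - g x).
Proof.
move=> fi gi; apply: eq_integrable (integrableB measurableT fi gi) => //.
Qed.

Lemma integrableRZl (r : R) f : integrableR f -> integrableR (fun x => r * f x).
Proof.
move=> fi; apply: eq_integrable (integrableZl measurableT r fi) => //.
Qed.

Lemma integrableR_subl c f : integrableR f -> integrableR (fun y => f (c - y)).
Proof.
move=> fi; have mf := integrableR_measurable fi.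
apply/integrableP; split.
  by apply/measurable_EFinP; apply: measurableT_comp => //; exact: measurable_subl.
rewrite /= (integral_subl c (f := fun y => `|(f y)%:E|%E)).
  by move/integrableP : fi => [].
by apply: measurableT_comp => //; exact/measurable_EFinP.
Qed.

Lemma integrableR_norm f : integrableR f -> integrableR (fun x => `|f x|).
Proof. by move=> fi; exact: integrable_norm. Qed.

Lemma normr_Rint f : integrableR f -> `|Rint f| <= Rint (fun x => `|f x|).
Proof. by move=> fi; exact: le_normr_Rintegral. Qed.

Lemma measurable_pair1 d (T : measurableType d) (f : T -> R -> R) x :
  measurable_fun setT (fun p : T * R => f p.1 p.2) -> measurable_fun setT (f x).
Proof.
move=> mf; exact: (measurableT_comp mf (pair1_measurable x)).
Qed.

Lemma measurable_pair2 d (T : measurableType d) (f : T -> R -> R) y :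
  measurable_fun setT (fun p : T * R => f p.1 p.2) -> measurable_fun setT (f ^~ y).
Proof.
move=> mf; exact: (measurableT_comp mf (pair2_measurable y)).
Qed.

(** Tonelli gives the measurability of the integrals of the positive and negative parts. No
    integrability is required, [fine] being measurable on all extended reals. *)
Lemma measurable_Rint_param d (T : measurableType d) (f : T -> R -> R) :
  measurable_fun setT (fun p : T * R => f p.1 p.2) ->
  measurable_fun setT (fun x => Rint (f x)).
Proof.
move=> mf.
have mE : measurable_fun setT (fun p : T * R => (f p.1 p.2)%:E) by exact/measurable_EFinP.
apply: (measurableT_comp (@fine_measurable _ setT measurableT)).
rewrite [X in measurable_fun _ X](_ : _ = (fun x => \int[mu]_y
   (fun p : T * R => (f p.1 p.2)%:E)^\+ (x, y) - \int[mu]_y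
   (fun p : T * R => (f p.1 p.2)%:E)^\- (x, y))%E); last first.
  apply/funext => x; rewrite integralE; congr (_ - _)%E;
    by apply: eq_integral => y _; rewrite ?funeposE ?funenegE.
apply: emeasurable_funB.
  apply: (measurable_fun_fubini_tonelli_F (m2 := mu) (fun p : T * R => (f p.1 p.2)%:E)^\+%E) => //.
  exact: measurable_funepos.
apply: (measurable_fun_fubini_tonelli_F (m2 := mu) (fun p : T * R => (f p.1 p.2)%:E)^\-%E) => //.
exact: measurable_funeneg.
Qed.

(** The domination has the shape met in every later use of Fubini: an integrable function of the
    outer variable times a function of the inner one, a kernel or a symbol, whose integral is
    bounded uniformly. *)
Lemma integrable_prod_dom (F : R -> R -> R) (a : R -> R) (b : R -> R -> R) (M : R) :
  measurable_fun setT (fun p : R * R => F p.1 p.2) ->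
  integrableR a -> (forall x, 0 <= a x) ->
  (forall x, measurable_fun setT (b x)) -> (forall x y, 0 <= b x y) ->
  (forall x, \int[mu]_y (b x y)%:E <= M%:E)%E ->
  (forall x y, `|F x y| <= a x * b x y) ->
  (mu \x mu)%E.-integrable setT (fun p : R * R => (F p.1 p.2)%:E).
Proof.
move=> mF ai a0 mb b0 bM Fab.
have mE : measurable_fun setT (fun p : R * R => (F p.1 p.2)%:E) by exact/measurable_EFinP.
apply: (integrable12ltyP mu mu mE).2 => /=.
apply: (@le_lt_trans _ _ (\int[mu]_x (M%:E * (a x)%:E))%E).
  apply: ge0_le_integral => //.
  - by move=> x _; apply: integral_ge0.
  - apply: (measurable_fun_fubini_tonelli_F (m2 := mu) (fun p : R * R => `|(F p.1 p.2)%:E|%E)) => //.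
    exact: measurableT_comp.
  - apply: emeasurable_funM => //; exact: (measurable_int _ ai).
  - move=> x _; apply: (@le_trans _ _ (\int[mu]_y ((a x)%:E * (b x y)%:E))%E).
      apply: ge0_le_integral => //.
      + apply/measurable_EFinP; apply: measurableT_comp => //.
        exact: measurable_pair1 mF.
      + by apply/measurable_EFinP/measurable_funM => //; exact: mb.
      + by move=> y _ /=; rewrite lee_fin.
    rewrite ge0_integralZl//=; last 3 first.
      by apply/measurable_EFinP; exact: mb.
      by move=> y _; rewrite lee_fin; exact: b0.
      by rewrite lee_fin; exact: a0.
    by rewrite muleC; apply: lee_wpmul2r; rewrite ?lee_fin; [exact: a0|exact: bM].
have M0 : 0 <= M by rewrite -lee_fin (le_trans _ (bM 0))// integral_ge0// => y _; rewrite lee_fin.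
rewrite ge0_integralZl//=; last 2 first.
  exact: (measurable_int _ ai).
  by move=> x _; rewrite lee_fin.
by rewrite (EFin_Rint ai) -EFinM ltry.
Qed.

Lemma Rint_Fubini (F : R -> R -> R) (a : R -> R) (b : R -> R -> R) (M : R) :
  measurable_fun setT (fun p : R * R => F p.1 p.2) ->
  integrableR a -> (forall x, 0 <= a x) ->
  (forall x, measurable_fun setT (b x)) -> (forall x y, 0 <= b x y) ->
  (forall x, \int[mu]_y (b x y)%:E <= M%:E)%E ->
  (forall x y, `|F x y| <= a x * b x y) ->
  Rint (fun x => Rint (F x)) = Rint (fun y => Rint (F ^~ y)).
Proof.
move=> mF ai a0 mb b0 bM Fab.
have iF := integrable_prod_dom mF ai a0 mb b0 bM Fab.
have mE : measurable_fun setT (fun p : R * R => (F p.1 p.2)%:E) by exact/measurable_EFinP.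
rewrite {1}/Rint [RHS]/Rint /Rintegral; congr fine.
transitivity (\int[mu]_x \int[mu]_y (F x y)%:E)%E.
  (* Slices are integrable only for almost every point, and only there is [Rint] the extended
     integral. *)
  apply: ae_eq_integral => //.
  - by apply/measurable_EFinP; exact: measurable_Rint_param.
  - exact: (measurable_fubini_F iF).
  apply: filterS (ae_integrable1 iF) => x xi _.
  by rewrite EFin_Rint.
rewrite (Fubini iF); apply/esym.
apply: ae_eq_integral => //.
- apply/measurable_EFinP; apply: (measurable_Rint_param (f := fun y x => F x y)).
  apply: (measurableT_comp mF (g := fun p : R * R => (p.2, p.1))).
  exact: measurable_swap.
- exact: (measurable_fubini_G iF).
apply: filterS (ae_integrable2 iF) => x xi _.
by rewrite EFin_Rint.
Qed.

Lemma ae_imp (P Q : R -> Prop) : (forall x, P x -> Q x) ->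
  {ae mu, forall x, P x} -> {ae mu, forall x, Q x}.
Proof. by move=> PQ; apply: negligibleS => x /= nQ /PQ. Qed.

Lemma ae_and (P Q : R -> Prop) : {ae mu, forall x, P x} -> {ae mu, forall x, Q x} ->
  {ae mu, forall x, P x /\ Q x}.
Proof.
move=> aP aQ; apply: negligibleS (negligibleU aP aQ) => x /= nPQ.
by apply/not_andP.
Qed.

Lemma poweR_half_mul (x : \bar R) : (0 <= x -> x `^ 2^-1 * x `^ 2^-1 = x)%E.
Proof.
case: x => [r| |] //= r0; first by rewrite powR12_sqrt -?EFinM -?expr2 ?sqr_sqrtr.
by rewrite invr_eq0 pnatr_eq0 /= mulyy.
Qed.

(** Hölder at exponent 2, squared so that no root remains; it holds in the extended reals and can be
    used before any finiteness is known. *)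
Lemma Cauchy_Schwarz_integral f g : measurable_fun setT f -> measurable_fun setT g ->
  ((\int[mu]_x (`|f x * g x|)%:E) * (\int[mu]_x (`|f x * g x|)%:E) <=
   (\int[mu]_x (f x ^+ 2)%:E) * (\int[mu]_x (g x ^+ 2)%:E))%E.
Proof.
move=> mf mg.
have H : ('N[mu]_1[(EFin \o (f \* g)%R)] <= 'N[mu]_2%:E[EFin \o f] * 'N[mu]_2%:E[EFin \o g])%E.
  by apply: hoelder => //; rewrite [RHS]splitr !div1r.
rewrite Lnorm1 !unlock in H.
move: H; set I := (\int[mu]_x _)%E.
have E h : (\int[mu]_x (`|(EFin \o h) x| `^ 2) = \int[mu]_x (h x ^+ 2)%:E)%E.
  apply: eq_integral => x _ /=.
  by rewrite powR_mulrn// -normrX ger0_norm// sqr_ge0.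
rewrite !E.
have I0 : (0 <= I)%E by apply: integral_ge0 => x _; rewrite lee_fin.
set A := (\int[mu]_x _)%E; set B := (\int[mu]_x _)%E => H.
have A0 : (0 <= A)%E by apply: integral_ge0 => x _; rewrite lee_fin sqr_ge0.
have B0 : (0 <= B)%E by apply: integral_ge0 => x _; rewrite lee_fin sqr_ge0.
apply: (le_trans (lee_pmul _ _ H H)) => //.
by rewrite muleACA !poweR_half_mul.
Qed.

(** Write w h as the product of sqrt w and sqrt w h. *)
Lemma Cauchy_Schwarz_weight (w h : R -> R) :
  measurable_fun setT w -> measurable_fun setT h ->
  (forall x, 0 <= w x) -> (forall x, 0 <= h x) ->
  ((\int[mu]_x (w x * h x)%:E) * (\int[mu]_x (w x * h x)%:E) <=
   (\int[mu]_x (w x)%:E) * (\int[mu]_x (w x * h x ^+ 2)%:E))%E.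
Proof.
move=> mw mh w0 h0.
have ms : measurable_fun setT (fun x => Num.sqrt (w x)).
  apply: measurableT_comp => //; apply: continuous_measurable_fun; exact: sqrt_continuous.
have := @Cauchy_Schwarz_integral (fun x => Num.sqrt (w x)) (fun x => Num.sqrt (w x) * h x) ms
  (measurable_funM ms mh).
under [X in (X * _ <= _)%E -> _]eq_integral => x _.
  rewrite mulrA -expr2 sqr_sqrtr// ger0_norm ?mulr_ge0//; over.
under [X in (_ * X <= _)%E -> _]eq_integral => x _.
  rewrite mulrA -expr2 sqr_sqrtr// ger0_norm ?mulr_ge0//; over.
under [X in (_ <= X * _)%E -> _]eq_integral => x _ do rewrite sqr_sqrtr//.
under [X in (_ <= _ * X)%E -> _]eq_integral => x _ do rewrite exprMn sqr_sqrtr//.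
by [].
Qed.

Lemma lor_ge0 (N z : R) : 0 <= N -> 0 <= lor N z.
Proof. by move=> N0; rewrite lor.unlock divr_ge0// addr_ge0// sqr_ge0. Qed.

Lemma lor_le (N z : R) : 0 <= N -> lor N z <= N.
Proof.
move=> N0; rewrite lor.unlock ler_pdivrMr ?ltr_pwDl ?sqr_ge0//.
by rewrite ler_peMr// lerDl sqr_ge0.
Qed.

Lemma lorN (N z : R) : lor N (- z) = lor N z.
Proof. by rewrite lor.unlock mulrN sqrrN. Qed.

Lemma lor_oneDsqr (N z : R) : lor N z = (oneDsqr (N * z))^-1 * N.
Proof. by rewrite lor.unlock mulrC. Qed.

Lemma continuous_lor (N : R) : continuous (lor N).
Proof.
move=> z; rewrite (_ : lor N = (fun z => (oneDsqr (N * z))^-1 * N)); last first.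
  by apply/funext => x; rewrite lor_oneDsqr.
apply: cvgM; last exact: cvg_cst.
apply: (@continuous_comp _ _ _ ( *%R N) (fun x => (oneDsqr x)^-1)).
  exact: mulrl_continuous.
exact: continuous_oneDsqrV.
Qed.

Lemma measurable_lor (N : R) : measurable_fun setT (lor N).
Proof. by apply: continuous_measurable_fun; exact: continuous_lor. Qed.

(** The substitution x = N z reduces to 1 / (1 + x^2), whose integral is twice its value pi / 2 on
    the half-line. *)
Lemma integral_lor (N : R) : 0 < N -> (\int[mu]_z (lor N z)%:E = (pi : R)%:E)%E.
Proof.
move=> N0.
have -> : (pi%:E = \int[mu]_x ((oneDsqr x)^-1)%:E :> \bar R)%E.
  rewrite ge0_symfun_integralT//.
  - have := @integral0y_oneDsqr R; rewrite set_itvcy => ->.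
    by rewrite -EFinM mulrC divfK.
  - exact: continuous_oneDsqrV.
  - by move=> x /=; rewrite /oneDsqr sqrrN.
have dN : forall x : R, is_derive x 1 ( *%R N) N.
  move=> x; have := @is_deriveM _ _ (cst N) id x 1 0 1 _ _.
  by rewrite scaler0 addr0 /GRing.scale /= mulr1; apply.
have dE : derive1 ( *%R N) = cst N.
  by apply/funext => x; rewrite derive1E derive_val.
rewrite [RHS](increasing_ge0_integration_by_substitutionT (F := *%R N))//.
- by apply: eq_integral => x _ /=; rewrite dE lor_oneDsqr.
- by move=> x y xy; rewrite ltr_pM2l.
- by rewrite dE; move=> x; exact: cvg_cst.
- by rewrite dE; exact: is_cvg_cst.
- by rewrite dE; exact: is_cvg_cst.
- by apply: gt0_cvgMrNy.
- by apply: gt0_cvgMry.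
- exact: continuous_oneDsqrV.
Qed.

Lemma integrable_lor (N : R) : 0 < N -> integrableR (lor N).
Proof.
move=> N0; apply/integrableP; split.
  by apply/measurable_EFinP; exact: measurable_lor.
rewrite (_ : (\int[mu]_x _)%E = (pi : R)%:E) ?ltry// -(integral_lor N0).
by apply: eq_integral => z _ /=; rewrite ger0_norm// lor_ge0// ltW.
Qed.

Lemma Rint_lor (N : R) : 0 < N -> Rint (lor N) = pi.
Proof. by move=> N0; rewrite /Rint /Rintegral integral_lor. Qed.

End Integration.

(** * Lorentzian averages at Lebesgue points *)

Section ApproximateIdentity.
Variable R : realType.
Local Notation mu := (@lebesgue_measure R).
Implicit Types f g h : R -> R.

(** Dyadic layers: for the least j with |z| < 2^j / 2^n, either j = 0 and the bound by 2^n suffices,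
    or |2^n z| >= 2^(j-1), so that the Lorentzian is at most 2^n / 4^(j-1). This is the origin of
    the factor 4. *)
Lemma lor_ball_le (n D : nat) (z : R) : (D <= n)%N -> `|z| < 2 ^- D ->
  lor (2 ^+ n) z <=
  \sum_(j < (n - D).+1) 4 * 2 ^+ n * 4 ^- j * \1_(ball 0 (2 ^+ j / 2 ^+ n) : set R) z.
Proof.
move=> Dn zD.
have N0 : 0 < 2 ^+ n :> R by rewrite exprn_gt0.
have ex : exists j, (`|z| < 2 ^+ j / 2 ^+ n) && (j <= n - D)%N.
  exists (n - D)%N; rewrite leqnn andbT; apply: (lt_le_trans zD).
  by rewrite ler_pdivlMr// mulrC -[X in 2 ^+ X / _](subnK Dn) exprD mulfK ?expf_neq0.
have [j /andP[zj jJ] jmin] := ex_minnP ex.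
have term0 : forall k : 'I_(n - D).+1, 0 <= 4 * 2 ^+ n * 4 ^- k * \1_(ball 0 (2 ^+ k / 2 ^+ n) : set R) z :> R.
  move=> k; rewrite mulr_ge0// ?mulr_ge0 ?invr_ge0 ?exprn_ge0//.
rewrite (bigD1 (Ordinal (jJ : j < (n - D).+1)%N))//=.
apply: ler_wpDr; first by apply: sumr_ge0.
rewrite indicE mem_set ?mulr1; last by rewrite /ball/= sub0r normrN.
case: j zj jJ jmin => [|j] zj jJ jmin.
  rewrite expr0 invr1 mulr1; apply: (le_trans (lor_le _ (ltW N0))).
  by rewrite ler_peMl ?(ltW N0)// ler1n.
have zge : 2 ^+ j / 2 ^+ n <= `|z|.
  rewrite leNgt; apply/negP => zlt.
  have := jmin j; rewrite zlt (ltnW jJ) => /(_ isT); by rewrite ltnn.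
have {zge} : 4 ^+ j <= (2 ^+ n * z) ^+ 2.
  have -> : 4 ^+ j = (2 ^+ j) ^+ 2 :> R by rewrite -exprM mulnC exprM; congr (_ ^+ _); ring.
  rewrite -(real_normK (num_real (_ * _))) lerXn2r ?nnegrE ?exprn_ge0//.
  by rewrite normrM (ger0_norm (ltW N0)) mulrC -ler_pdivrMr.
rewrite lor.unlock => H; rewrite ler_pdivrMr ?ltr_pwDl ?sqr_ge0//.
have A0 : 0 < 4 ^+ j :> R by rewrite exprn_gt0.
set X := _ ^+ 2 in H *.
rewrite [leRHS](_ : _ = 2 ^+ n * ((1 + X) / 4 ^+ j)); last by rewrite exprS; field; lra.
by rewrite ler_peMr ?(ltW N0)// ler_pdivlMr// mul1r (le_trans H)// lerDr.
Qed.

(** Away from the origin the kernel is of order 1 / N times a fixed Lorentzian, so the far part of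
    an average vanishes in the limit as soon as the function is integrable against [lor 1]. *)
Lemma lor_far (N D : R) (z : R) : 0 < N -> 0 < D -> D <= `|z| ->
  lor N z <= (1 + D ^- 2) / N * lor 1 z.
Proof.
move=> N0 D0 Dz; rewrite lor.unlock mul1r.
have z0 : 0 < z ^+ 2.
  by rewrite -(real_normK (num_real z)) exprn_gt0 // (lt_le_trans D0).
have Dz2 : D ^+ 2 <= z ^+ 2.
  by rewrite -(real_normK (num_real z)) lerXn2r// nnegrE ltW.
have D2 : 0 < D ^+ 2 by rewrite exprn_gt0.
have N2 : 0 < N ^+ 2 by rewrite exprn_gt0.
apply: (@le_trans _ _ (1 / (N * z ^+ 2))).
  rewrite ler_pdivrMr; last by rewrite ltr_pwDl ?sqr_ge0.
  rewrite exprMn mulrAC mul1r ler_pdivlMr; last exact: mulr_gt0.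
  by nra.
rewrite !mul1r invfM mulrC mulrAC ler_wpM2r ?invr_ge0 ?(ltW N0)//.
rewrite ler_pdivlMr ?ltr_pwDl ?sqr_ge0// mulrDr mulr1 mulVf ?gt_eqF// addrC lerD2l.
by rewrite lef_pV2.
Qed.

Lemma lor_ge1_le (N z : R) : 1 <= N -> lor N z <= N * lor 1 z.
Proof.
move=> N1; rewrite lor.unlock !mul1r ler_wpM2l ?(le_trans ler01)//.
rewrite lef_pV2 ?posrE ?ltr_pwDl ?sqr_ge0// lerD2l exprMn ler_peMl ?sqr_ge0//.
by rewrite exprn_ege1.
Qed.

Section lebesgue_point.
Variables (f : R -> R) (x : R).
Hypothesis mf : measurable_fun setT f.
Hypothesis fi : integrableR (fun y => lor 1 (x - y) * f y).

Let g (y : R) : R := `|f y - f x|.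
Let g0 (y : R) : 0 <= g y. Proof. exact: normr_ge0. Qed.

Let mg : measurable_fun setT g.
Proof. by apply: measurableT_comp => //; apply: measurable_funB. Qed.

Let mlor (N : R) : measurable_fun setT (fun y : R => lor N (x - y)).
Proof. by apply: measurableT_comp; [exact: measurable_lor|exact: measurable_subl]. Qed.

Let gi1 : integrableR (fun y => lor 1 (x - y) * g y).
Proof.
apply: (integrableR_dom (g := fun y => `|lor 1 (x - y) * f y| + `|f x| * lor 1 (x - y))).
- exact: measurable_funM.
- apply: integrableRD; first exact: integrableR_norm.
  by apply: integrableRZl; apply: integrableR_subl; exact: integrable_lor.
- move=> y; have l0 : 0 <= lor 1 (x - y) by exact: lor_ge0.
  rewrite /g !normrM normr_id (ger0_norm l0).
  by rewrite (mulrC `|f x|) -mulrDr ler_wpM2l ?lor_ge0// ler_normB.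
Qed.

Lemma integrable_lor_dev (N : R) : 1 <= N -> integrableR (fun y => lor N (x - y) * g y).
Proof.
move=> N1; apply: (integrableR_dom (g := fun y => N * (lor 1 (x - y) * g y))).
- exact: measurable_funM.
- exact: integrableRZl.
- move=> y; have N0 : 0 <= N by rewrite (le_trans ler01).
  rewrite normrM normr_id ger0_norm ?lor_ge0//.
  by rewrite mulrA ler_wpM2r// lor_ge1_le.
Qed.

(** Near x, the dyadic layers are controlled by the means of |f - f x| over small balls; far from x,
    [lor_far] gives a term of order 1 / 2^n. *)
Lemma lebesgue_pt_lor : lebesgue_pt f x ->
  (fun n => Rint (fun y => lor (2 ^+ n) (x - y) * g y)) @ \oo --> 0.
Proof.
move=> fx.
set M := Rint (fun y => lor 1 (x - y) * g y).
have M0 : 0 <= M by apply: Rint_ge0 => y; rewrite mulr_ge0 ?lor_ge0 ?normr_ge0.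
have key (e : R) : 0 < e -> exists D : nat, forall n, (D <= n)%N ->
  Rint (fun y => lor (2 ^+ n) (x - y) * g y) <= 16 * e + (1 + (2 ^- D) ^- 2) / 2 ^+ n * M.
  move=> e0.
  (* At a Lebesgue point the means over small balls are below e, and a ball of radius r has measure
     2 r. *)
  have [d d0 Hd] : exists2 d : R, 0 < d & forall r, 0 < r -> r < d ->
      (\int[mu]_(y in ball x r) (g y)%:E <= (2 * r * e)%:E)%E.
    have : \forall r \near (0 : R)^'+, (davg f x r < e%:E)%E.
      move/fine_cvgP: fx => [fx1 fx2].
      have : \forall r \near (0 : R)^'+, `|0 - fine (davg f x r)| < e by move/cvgrPdist_lt : fx2; exact.
      apply: filter_app2 fx1; near=> r => fr.
      rewrite sub0r normrN => H; rewrite -(fineK fr) lte_fin.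
      by apply: le_lt_trans H; exact: ler_norm.
    move=> [d /= d0 H]; exists d => // r r0 rd.
    have := H r; rewrite /ball_ /= sub0r normrN gtr0_norm// => /(_ rd r0).
    rewrite /davg /iavg lebesgue_measure_ball; last exact: ltW.
    rewrite inver mulrn_eq0/= gt_eqF//.
    rewrite lte_pdivrMl ?mulrn_wgt0// => /ltW H2; apply: le_trans (le_trans H2 _) => //.
    by rewrite -EFinM lee_fin mulr2n; lra.
  have [D Dd] : exists D : nat, 2 ^- D < d.
    have [D _ HD] := near_infty_natSinv_expn_lt (PosNum d0).
    by exists D; have := HD D (leqnn D); rewrite /= div1r.
  exists D => n Dn.
  have N0 : 0 < 2 ^+ n :> R by rewrite exprn_gt0.
  have N1 : 1 <= 2 ^+ n :> R by rewrite exprn_ege1// ler1n.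
  have D0 : 0 < 2 ^- D :> R by rewrite invr_gt0 exprn_gt0.
  have gi : integrableR (fun y => lor (2 ^+ n) (x - y) * g y) by exact: integrable_lor_dev.
  set c := (1 + _) / _; have c0 : 0 <= c.
    by rewrite /c divr_ge0 ?ltW// ltr_pwDl// invr_ge0 sqr_ge0.
  pose h (j : 'I_(n - D).+1) (y : R) : R := 4 * 2 ^+ n * 4 ^- j * (\1_(ball x (2 ^+ j / 2 ^+ n)) y * g y).
  have h0 j y : 0 <= h j y.
    by rewrite /h !mulr_ge0 ?invr_ge0 ?exprn_ge0// /g.
  have mh j : measurable_fun setT (h j).
    apply: measurable_funM => //; apply: measurable_funM => //.
    by apply: measurable_indic; exact: measurable_ball.
  have mk : measurable_fun setT (fun y : R => c * (lor 1 (x - y) * g y)).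
    by apply: measurable_funM => //; exact: measurable_funM.
  have k0 y : 0 <= c * (lor 1 (x - y) * g y) by rewrite !mulr_ge0// ?lor_ge0// /g.
  have pt y : lor (2 ^+ n) (x - y) * g y <= \sum_(j < (n - D).+1) h j y + c * (lor 1 (x - y) * g y).
    have [xyD|xyD] := ltP `|x - y| (2 ^- D).
      apply: ler_wpDr => //; apply: le_trans (ler_wpM2r _ (lor_ball_le Dn xyD)) _ => //.
      rewrite mulr_suml; apply: ler_sum => j _; rewrite /h mulrA.
      rewrite (_ : \1_(ball 0 _ : set R) (x - y) = \1_(ball x (2 ^+ j / 2 ^+ n) : set R) y)//.
      rewrite !indicE; congr ((nat_of_bool _)%:R).
      by apply/idP/idP; rewrite !inE /ball/= sub0r normrN.
    apply: ler_wpDl; first by apply: sumr_ge0.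
    rewrite mulrA; apply: ler_wpM2r => //; exact: lor_far.
  rewrite -lee_fin -EFin_Rint//.
  apply: (@le_trans _ _ (\int[mu]_y (\sum_(j < (n - D).+1) (h j y)%:E + (c * (lor 1 (x - y) * g y))%:E))%E).
    apply: ge0_le_integral => //.
    - by move=> y _; rewrite lee_fin mulr_ge0// lor_ge0// ltW.
    - exact: (measurable_int _ gi).
    - apply: emeasurable_funD; last exact/measurable_EFinP.
      by apply: emeasurable_sum => j; apply/measurable_EFinP; exact: mh.
    - by move=> y _; rewrite sumEFin lee_fin.
  rewrite ge0_integralD//; last 4 first.
  - by move=> y _; apply: sume_ge0 => j _; rewrite lee_fin.
  - by apply: emeasurable_sum => j; apply/measurable_EFinP; exact: mh.
  - by move=> y _; rewrite lee_fin.
  - exact/measurable_EFinP.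
  rewrite EFinD; apply: leeD; last first.
    rewrite EFin_Rint; last exact: integrableRZl.
    by rewrite RintZl.
  rewrite ge0_integral_sum//; last 2 first.
    by move=> j; apply/measurable_EFinP; exact: mh.
    by move=> j y _; rewrite lee_fin.
  (* Layer j contributes at most 4 * 2^n / 4^j times 2 (2^j / 2^n) e, which is 8 e / 2^j; the layers
     add up to less than 16 e. *)
  apply: (@le_trans _ _ (\sum_(j < (n - D).+1) (8 * e * 2 ^- j)%:E)%E).
    apply: lee_sum => j _.
    under eq_integral do rewrite /h EFinM.
    rewrite ge0_integralZl//=; last 2 first.
    - apply/measurable_EFinP; apply: measurable_funM => //.
      by apply: measurable_indic; exact: measurable_ball.
    - by move=> y _; rewrite lee_fin mulr_ge0// /g.
    have -> : (\int[mu]_y (\1_(ball x (2 ^+ j / 2 ^+ n)) y * g y)%:E = \int[mu]_(y in ball x (2 ^+ j / 2 ^+ n)) (g y)%:E)%E.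
      rewrite [RHS]integral_mkcond; apply: eq_integral => y _.
      by rewrite patchE indicE; case: ifP; rewrite ?mul1r ?mul0r.
    have r0 : 0 < 2 ^+ j / 2 ^+ n :> R by rewrite divr_gt0 ?exprn_gt0.
    have rd : 2 ^+ j / 2 ^+ n < d.
      apply: le_lt_trans Dd; rewrite ler_pdivrMr// mulrC ler_pdivlMr ?exprn_gt0//.
      have := ltn_ord j; rewrite ltnS => jn.
      by rewrite -exprD ler_eXn2l ?ltr1n// addnC -leq_subRL.
    apply: le_trans (lee_wpmul2l _ (Hd _ r0 rd)) _.
      by rewrite lee_fin !mulr_ge0 ?invr_ge0 ?exprn_ge0//.
    rewrite -EFinM lee_fin le_eqVlt; apply/orP; left; apply/eqP.
    have -> : 4 ^+ j = 2 ^+ j * 2 ^+ j :> R by rewrite -exprMn; congr (_ ^+ _); ring.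
    by field; rewrite !expf_neq0//.
  rewrite sumEFin lee_fin -mulr_sumr.
  rewrite (_ : 16 * e = 8 * e * 2); last by ring.
  rewrite ler_wpM2l ?mulr_ge0 ?(ltW e0)//.
  have -> : \sum_(j < (n - D).+1) 2 ^- j = 2 - 2 ^- (n - D) :> R.
    elim: (n - D)%N => [|k IH]; first by rewrite big_ord1 expr0; lra.
    by rewrite big_ord_recr /= IH exprS; field; rewrite expf_neq0.
  by rewrite gerBl invr_ge0 exprn_ge0.
apply/cvgrPdist_le => e e0.
(* With e / 32 the near part is at most e / 2. The index [K] below makes 2^n exceed 2 c M / e, so
   the far part is at most e / 2 as well. *)
have e32 : 0 < e / 32 by rewrite divr_gt0.
have [D HD] := key _ e32.
set c := 1 + _ in HD.
have cM : 0 <= 2 * (c * M) / e.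
  have c0 : 0 <= c by rewrite /c addr_ge0// invr_ge0 sqr_ge0.
  by rewrite divr_ge0 ?(ltW e0)// mulr_ge0// mulr_ge0.
have I0 : 0 < (2 * (c * M) / e + 1)^-1 by rewrite invr_gt0 ltr_pwDr.
have [K _ HK] := near_infty_natSinv_expn_lt (PosNum I0).
exists (maxn D K) => // n; rewrite /= geq_max => /andP[Dn Kn].
rewrite sub0r normrN ger0_norm; last first.
  by apply: Rint_ge0 => y; rewrite mulr_ge0 ?lor_ge0 ?exprn_ge0 ?normr_ge0.
apply: le_trans (HD n Dn) _.
rewrite (_ : 16 * (e / 32) = e / 2); last by field.
have := HK n Kn; rewrite /= div1r ltf_pV2 ?posrE ?exprn_gt0//; last by rewrite ltr_pwDr.
have N0 : 0 < 2 ^+ n :> R by rewrite exprn_gt0.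
set N := 2 ^+ n in N0 * => H.
suff : c / N * M <= e / 2 by lra.
rewrite mulrAC ler_pdivrMr//.
have : 2 * (c * M) / e <= N by lra.
by rewrite ler_pdivrMr//; lra.
Unshelve. all: by end_near. Qed.

End lebesgue_point.

End ApproximateIdentity.

(** * Oscillatory integrals and Fourier inversion *)

(** The phase [th] covers the cosine and sine transforms at once and keeps everything real; it also
    makes the family stable under translation of the symbol and multiplication by a cosine. *)
HB.lock Definition osc (R : realType) (a : R -> R) (th z : R) : R :=
  Rint (fun e => cos (z * e + th) * a e).

Section OscillatoryIntegral.
Variable R : realType.
Local Notation mu := (@lebesgue_measure R).
Implicit Types (a : R -> R) (r M th z : R).

Lemma is_derive1M (f g : R -> R) (x df dg : R) :
  is_derive x 1 f df -> is_derive x 1 g dg ->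
  is_derive x 1 (fun y => f y * g y) (df * g x + f x * dg).
Proof.
move=> hf hg; apply: (is_derive_eq (is_deriveM hf hg)).
by rewrite /GRing.scale/= addrC mulrC.
Qed.

Lemma is_derive1D (f g : R -> R) (x df dg : R) :
  is_derive x 1 f df -> is_derive x 1 g dg ->
  is_derive x 1 (fun y => f y + g y) (df + dg).
Proof. by move=> hf hg; exact: is_deriveD. Qed.

Lemma is_derive_affine (z th x : R) : is_derive x 1 (fun e : R => z * e + th) z.
Proof.
apply: (is_derive_eq (is_derive1D (is_derive1M (is_derive_cst z x 1) (is_derive_id x 1)) (is_derive_cst th x 1))).
by rewrite mul0r add0r mulr1 addr0.
Qed.

Lemma is_derive1_continuous (f df : R -> R) :
  (forall x : R, is_derive x 1 f (df x)) -> continuous f.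
Proof.
move=> fd x; apply: differentiable_continuous; apply/derivable1_diffP.
by have [] := fd x.
Qed.

Lemma continuous_affine (z th : R) : continuous (fun e : R => z * e + th).
Proof. exact: (is_derive1_continuous (is_derive_affine z th)). Qed.

Lemma continuousRM (f g : R -> R) : continuous f -> continuous g ->
  continuous (fun x => f x * g x).
Proof. by move=> cf cg x; apply: cvgM; [exact: cf|exact: cg]. Qed.

Lemma continuousRD (f g : R -> R) : continuous f -> continuous g ->
  continuous (fun x => f x + g x).
Proof. by move=> cf cg x; apply: cvgD; [exact: cf|exact: cg]. Qed.

Lemma continuousRcomp (f g : R -> R) : continuous f -> continuous g ->
  continuous (fun x => f (g x)).
Proof. by move=> cf cg x; apply: (continuous_comp (cg x)); exact: cf. Qed.

Definition Cc r a : Prop := continuous a /\ forall x : R, r <= `|x| -> a x = 0.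

Lemma Rint_supp r M a : 0 <= r -> measurable_fun setT a ->
  (forall x : R, r <= `|x| -> a x = 0) -> (forall x, `|a x| <= M) ->
  integrableR a /\ `|Rint a| <= 2 * r * M.
Proof.
move=> r0 ma supp aM.
have M0 : 0 <= M by apply: le_trans (aM 0).
have E : (\int[mu]_x (\1_(`[(- r), r] : set R) x)%:E = (2 * r)%:E)%E.
  rewrite integral_indic// setIT; transitivity (mu `[(- r), r]%classic) => //.
  rewrite lebesgue_measure_itv/= lte_fin.
  case: ltP => H; first by rewrite -EFinB; congr EFin; lra.
  by congr EFin; lra.
have i1 : integrableR (\1_(`[(- r), r] : set R) : R -> R).
  apply/integrableP; split; first by apply/measurable_EFinP; exact: measurable_indic.
  rewrite (_ : (\int[mu]_x _)%E = (2 * r)%:E) ?ltry// -E.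
  by apply: eq_integral => x _ /=; rewrite ger0_norm.
have iM := integrableRZl M i1.
have dom x : `|a x| <= M * \1_(`[(- r), r] : set R) x.
  rewrite indicE; case: (boolP (x \in _)); rewrite ?mulr1 ?mulr0// => /negP H.
  rewrite supp ?normr0//; rewrite leNgt; apply/negP => xr; apply: H.
  by rewrite inE /= in_itv /=; move: xr; rewrite ltr_norml => /andP[/ltW-> /ltW->].
split; first exact: (integrableR_dom ma iM).
apply: le_trans (normr_Rint_dom ma iM dom) _.
by rewrite RintZl// {1}/Rint /Rintegral E /= mulrC.
Qed.

Lemma Cc_bounded r a : 0 < r -> Cc r a -> exists2 M : R, 0 <= M & forall x, `|a x| <= M.
Proof.
move=> r0 [ca supp].
have cn : {within `[(- r), r], continuous (fun x => `|a x|)}.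
  apply: continuous_subspaceT => x; apply: (@continuous_comp _ _ _ a Num.norm).
    exact: ca.
  exact: norm_continuous.
have rr : - r <= r by rewrite ge0_cp// ltW.
have [c _ Hc] := EVT_max rr cn.
exists `|a c| => // x.
have [xr|xr] := leP r `|x|; first by rewrite supp// normr0.
by apply: Hc; rewrite in_itv /=; move: xr; rewrite ltr_norml => /andP[/ltW-> /ltW->].
Qed.

Lemma Cc_measurable r a : Cc r a -> measurable_fun setT a.
Proof. by move=> [ca _]; exact: continuous_measurable_fun. Qed.

Lemma Cc_integrable r a : 0 < r -> Cc r a -> integrableR a.
Proof.
move=> r0 Ca; have [M M0 aM] := Cc_bounded r0 Ca.
by have [] := Rint_supp (ltW r0) (Cc_measurable Ca) Ca.2 aM.
Qed.

Lemma measurable_cos_affine (d : measure_display) (T : measurableType d) (f : T -> R) :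
  measurable_fun setT f -> measurable_fun setT (fun x => cos (f x)).
Proof.
move=> mf; apply: measurableT_comp => //.
by apply: continuous_measurable_fun; exact: continuous_cos.
Qed.

Lemma measurable_osc_integrand2 a th : measurable_fun setT a ->
  measurable_fun setT (fun p : R * R => cos (p.1 * p.2 + th) * a p.2).
Proof.
move=> ma; apply: measurable_funM; last exact: measurableT_comp.
apply: measurable_cos_affine; apply: measurable_funD => //.
by apply: measurable_funM.
Qed.

Lemma measurable_osc_integrand a th z : measurable_fun setT a ->
  measurable_fun setT (fun e : R => cos (z * e + th) * a e).
Proof.
move=> /(measurable_osc_integrand2 th) H.
exact: (measurable_pair1 (f := fun z e => cos (z * e + th) * a e)).
Qed.

Lemma measurable_osc a th : measurable_fun setT a -> measurable_fun setT (osc a th).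
Proof.
move=> ma; rewrite (_ : osc a th = fun z => Rint (fun e => cos (z * e + th) * a e)).
  apply: measurable_Rint_param; exact: measurable_osc_integrand2.
by apply/funext => z; rewrite osc.unlock.
Qed.

Lemma norm_cos_le (x y : R) : `|cos x * y| <= `|y|.
Proof.
rewrite normrM ler_piMl// ler_norml cos_geN1 cos_le1//.
Qed.

Lemma integrable_osc_integrand a th z : integrableR a ->
  integrableR (fun e : R => cos (z * e + th) * a e).
Proof.
move=> ai; apply: (integrableR_dom (g := fun e => `|a e|)).
- by apply: measurable_osc_integrand; exact: integrableR_measurable.
- exact: integrableR_norm.
- by move=> e; exact: norm_cos_le.
Qed.

Lemma osc_le r M a th z : 0 <= r -> measurable_fun setT a ->
  (forall x : R, r <= `|x| -> a x = 0) -> (forall x, `|a x| <= M) ->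
  `|osc a th z| <= 2 * r * M.
Proof.
move=> r0 ma supp aM; rewrite osc.unlock.
apply: (@Rint_supp r M (fun e => cos (z * e + th) * a e) r0
  (measurable_osc_integrand _ _ ma) _ _).2.
  by move=> x rx; rewrite supp// mulr0.
by move=> x; apply: le_trans (norm_cos_le _ _) (aM x).
Qed.

Lemma Rint_supp_itv r a : (forall x : R, r <= `|x| -> a x = 0) ->
  Rint a = Rintegral mu `[(- r), r] a.
Proof.
move=> supp; rewrite [RHS]Rintegral_mkcond; congr Rintegral.
apply/funext => x; rewrite patchE; case: ifPn => // /negP H.
apply: supp; rewrite leNgt; apply/negP => xr; apply: H.
by rewrite inE /= in_itv /=; move: xr; rewrite ltr_norml => /andP[/ltW-> /ltW->].
Qed.

(* One application of the fundamental theorem of calculus to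
   sin (z e + th) / z * a e + cos (z e + th) / z ^ 2 * a' e integrates by parts twice. *)
Lemma osc_by_parts r a a1 a2 th z : 0 < r -> z != 0 ->
  (forall x : R, is_derive x 1 a (a1 x)) -> (forall x : R, is_derive x 1 a1 (a2 x)) ->
  Cc r a -> Cc r a1 -> Cc r a2 ->
  z ^+ 2 * osc a th z = - osc a2 th z.
Proof.
move=> r0 z0 da da1 Ca Ca1 Ca2.
pose F (e : R) : R := sin (z * e + th) / z * a e + cos (z * e + th) / z ^+ 2 * a1 e.
pose f (e : R) : R := cos (z * e + th) * (a e + a2 e / z ^+ 2).
have dF (x : R) : is_derive x 1 F (f x).
  have dl := is_derive_affine z th x.
  have H := is_derive1D
    (is_derive1M (is_derive1M (is_derive1_comp (is_derive_sin _) dl) (is_derive_cst z^-1 x 1)) (da x))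
    (is_derive1M (is_derive1M (is_derive1_comp (is_derive_cos _) dl) (is_derive_cst (z ^- 2) x 1)) (da1 x)).
  by apply: (is_derive_eq H); rewrite /f /=; field.
have cf : continuous f.
  apply: continuousRM.
    by apply: continuousRcomp; [exact: continuous_cos|exact: continuous_affine].
  apply: continuousRD; first exact: Ca.1.
  by apply: continuousRM; [exact: Ca2.1|exact: cst_continuous].
have I0 : Rint f = 0.
  rewrite (Rint_supp_itv (r := r)); last first.
    by move=> x rx; rewrite /f Ca.2// Ca2.2// mul0r addr0 mulr0.
  rewrite /Rintegral (continuous_FTC2 (F := F)).
  - by rewrite /F !(Ca.2, Ca1.2) ?normrN ?ger0_norm ?(ltW r0)// !mulr0 addr0 -EFinB subrr.
  - by rewrite gtrN.
  - exact: continuous_subspaceT.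
  - have cF : continuous F.
      by move=> x; apply: differentiable_continuous; apply/derivable1_diffP.
    split.
    + by move=> x _.
    + by apply: cvg_at_right_filter; exact: cF.
    + by apply: cvg_at_left_filter; exact: cF.
  - by move=> x _; rewrite derive1E derive_val.
have ia := Cc_integrable r0 Ca; have ia2 := Cc_integrable r0 Ca2.
have : Rint (fun e => cos (z * e + th) * a e + z ^- 2 * (cos (z * e + th) * a2 e)) = 0.
  by rewrite -I0; apply: eq_Rint => e; rewrite /f; field.
rewrite RintD; last 2 first.
- exact: integrable_osc_integrand.
- by apply: integrableRZl; exact: integrable_osc_integrand.
rewrite RintZl; last exact: integrable_osc_integrand.
rewrite osc.unlock => /eqP; rewrite addr_eq0 => /eqP ->.
by field.
Qed.

End OscillatoryIntegral.

(** * Abel summation and inversion at one point *)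

Section Inversion.
Variable R : realType.
Local Notation mu := (@lebesgue_measure R).

Lemma Rint_dominated_cvg (f_ : nat -> R -> R) (f g : R -> R) :
  (forall n, measurable_fun setT (f_ n)) -> measurable_fun setT f ->
  (forall x, (fun n => f_ n x) @ \oo --> f x) -> integrableR g ->
  (forall n x, `|f_ n x| <= g x) ->
  (fun n => Rint (f_ n)) @ \oo --> Rint f.
Proof.
move=> mf_ mf ff gi fg.
have mE n : measurable_fun setT (EFin \o f_ n) by apply/measurable_EFinP; exact: mf_.
have mE0 : measurable_fun setT (EFin \o f) by apply/measurable_EFinP.
have c1 : {ae mu, forall x, setT x -> (fun n => (EFin \o f_ n) x) @ \oo --> (EFin \o f) x}.
  by apply: aeW => x _; apply: cvg_EFin; [exact: nearW|exact: ff].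
have c2 : {ae mu, forall x n, setT x -> (`|(EFin \o f_ n) x| <= (EFin \o g) x)%E}.
  by apply: aeW => x n _ /=; rewrite lee_fin.
have [fi _ H] := @dominated_convergence _ _ R mu setT measurableT _ _ _ mE mE0 c1 gi c2.
apply: fine_cvg; rewrite -EFin_Rint//.
Qed.

Lemma sqrD_gt0 (x e : R) : 0 < x -> 0 < x ^+ 2 + e ^+ 2.
Proof. by move=> x0; rewrite ltr_wpDr ?sqr_ge0 ?exprn_gt0. Qed.

(** Adding 1 to the cosine makes the integrand nonnegative, which the symmetry lemma and the
    fundamental theorem on the half-line ask for. The 1 is subtracted again in [Rint_wexp_cos]. *)
Lemma integral_exp_abs (x e : R) : 0 < x ->
  (\int[mu]_z (expR (- (x * `|z|)) * (1 + cos (e * z)))%:E =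
   (2 / x + 2 * x / (x ^+ 2 + e ^+ 2))%:E)%E.
Proof.
move=> x0.
have xe0 := sqrD_gt0 e x0.
have cl (k : R) : continuous (fun z : R => k * z).
  by apply: continuousRM; [exact: cst_continuous|move=> ?; exact: cvg_id].
have cc : continuous (fun z : R => 1 + cos (e * z)).
  apply: continuousRD; first exact: cst_continuous.
  by apply: continuousRcomp; [exact: continuous_cos|exact: cl].
have c0 z : 0 <= 1 + cos (e * z) by have := cos_geN1 (e * z); lra.
rewrite ge0_symfun_integralT; last 3 first.
- by move=> z; rewrite mulr_ge0 ?expR_ge0.
- apply: continuousRM; last exact: cc.
  apply: continuousRcomp; first exact: continuous_expR.
  move=> z; apply: cvgN; apply: cvgM; first exact: cvg_cst.
  exact: norm_continuous.
- by move=> z /=; rewrite normrN mulrN cosN.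
(* The second term is the real part of exp((i e - x) z) / (i e - x). This primitive vanishes at
   +oo. *)
pose F (z : R) : R := expR (- x * z) * (- x^-1 + (e * sin (e * z) + - x * cos (e * z)) / (x ^+ 2 + e ^+ 2)).
pose f (z : R) : R := expR (- x * z) * (1 + cos (e * z)).
have dF (z : R) : is_derive z 1 F (f z).
  have dl k : is_derive z 1 (fun z : R => k * z) k.
    apply: (is_derive_eq (is_derive1M (is_derive_cst k z 1) (is_derive_id z 1))).
    by rewrite mul0r add0r mulr1.
  have ds := is_derive1_comp (is_derive_sin _) (dl e).
  have dc := is_derive1_comp (is_derive_cos _) (dl e).
  have de := is_derive1_comp (is_derive_expR _) (dl (- x)).
  have H := is_derive1M de (is_derive1D (is_derive_cst (- x^-1) z 1)
    (is_derive1M (is_derive1D (is_derive1M (is_derive_cst e z 1) ds)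
                              (is_derive1M (is_derive_cst (- x) z 1) dc))
       (is_derive_cst ((x ^+ 2 + e ^+ 2)^-1) z 1))).
  rewrite (_ : F = fun y : R => (expR \o (fun z0 : R => - x * z0)) y *
       (cst (- x^-1) y + (cst e y * (sin \o (fun z0 : R => e * z0)) y +
         cst (- x) y * (cos \o (fun z0 : R => e * z0)) y) * cst ((x ^+ 2 + e ^+ 2)^-1) y)); last first.
    by [].
  apply: (is_derive_eq H); rewrite /f /=; field.
  by rewrite !gt_eqF.
have -> : (\int[mu]_(z in [set z | (0 <= z)%R]) (expR (- (x * `|z|)) * (1 + cos (e * z)))%:E
    = \int[mu]_(z in `[0%R, +oo[) (f z)%:E)%E.
  rewrite set_itvcy; apply: eq_integral => z; rewrite inE/= => z0.
  by rewrite /f ger0_norm// mulNr.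
rewrite (ge0_continuous_FTC2y (F := F) (l := 0)).
- rewrite /F !mulr0 expR0 cos0 sin0 -EFinB -EFinM; congr EFin; field.
  by rewrite !gt_eqF.
- by move=> z _; rewrite mulr_ge0 ?expR_ge0.
- apply: continuous_subspaceT; apply: continuousRM; last exact: cc.
  by apply: continuousRcomp; [exact: continuous_expR|exact: cl].
- pose M := x^-1 + (`|e| + x) / (x ^+ 2 + e ^+ 2).
  have M0 : 0 <= M by rewrite addr_ge0 ?invr_ge0 ?(ltW x0)// divr_ge0 ?(ltW xe0)// addr_ge0// ltW.
  have FM z : `|F z| <= expR (- (x * z)) * M.
    rewrite normrM mulNr ger0_norm ?expR_ge0// ler_wpM2l ?expR_ge0//.
    rewrite (le_trans (ler_normD _ _))// /M normrN (ger0_norm (_ : 0 <= x^-1)) ?invr_ge0 ?(ltW x0)//.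
    rewrite lerD2l normrM (ger0_norm (_ : 0 <= (_ + _)^-1)) ?invr_ge0 ?(ltW xe0)//.
    rewrite ler_wpM2r ?invr_ge0 ?(ltW xe0)//.
    rewrite mulNr (le_trans (ler_normB _ _))// lerD//.
      by rewrite normrM ler_piMr// ler_norml sin_geN1 sin_le1.
    by rewrite normrM (ger0_norm (ltW x0)) ler_piMr ?(ltW x0)// ler_norml cos_geN1 cos_le1.
  apply/norm_cvg0P.
  have H : (fun z => expR (- (x * z)) * M) @ +oo%R --> 0.
    rewrite -[X in _ --> X](mul0r M); apply: cvgMl.
    apply: (cvg_comp (fun z : R => x * z) (fun z => expR (- z)) _ (@cvgr_expR R)).
    by apply: gt0_cvgMry => //; exact: cvg_id.
  apply: (squeeze_cvgr _ (cvg_cst 0) H).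
  by apply: nearW => z; rewrite normr_ge0 FM.
- by move=> z _; have [] := dF z.
- by apply: cvg_at_right_filter; apply: (is_derive1_continuous dF).
- by move=> z _; rewrite derive1E derive_val.
Qed.

Definition wexp (x z : R) : R := expR (- (x * `|z|)).

Lemma measurable_wexp (x : R) : measurable_fun setT (wexp x).
Proof.
apply: continuous_measurable_fun; apply: continuousRcomp; first exact: continuous_expR.
move=> z; apply: cvgN; apply: cvgM; first exact: cvg_cst.
exact: norm_continuous.
Qed.

Lemma wexp_ge0 (x z : R) : 0 <= wexp x z.
Proof. exact: expR_ge0. Qed.

Lemma wexp_le1 (x z : R) : 0 <= x -> wexp x z <= 1.
Proof. by move=> x0; rewrite /wexp -expR0 ler_expR oppr_le0 mulr_ge0. Qed.

Lemma integrable_wexp_cos (x e : R) : 0 < x ->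
  integrableR (fun z => wexp x z * (1 + cos (e * z))) /\
  Rint (fun z => wexp x z * (1 + cos (e * z))) = 2 / x + 2 * x / (x ^+ 2 + e ^+ 2).
Proof.
move=> x0; have H := integral_exp_abs e x0.
split; last by rewrite /Rint /Rintegral H.
apply/integrableP; split.
  apply/measurable_EFinP; apply: measurable_funM; first exact: measurable_wexp.
  by apply: measurable_funD => //; apply: measurable_cos_affine; exact: measurable_funM.
rewrite (_ : (\int[mu]_x0 _)%E = (2 / x + 2 * x / (x ^+ 2 + e ^+ 2))%:E) ?ltry// -H.
apply: eq_integral => z _ /=; rewrite ger0_norm// mulr_ge0 ?wexp_ge0//.
Qed.

Lemma integrable_wexp (x : R) : 0 < x -> integrableR (wexp x) /\ Rint (wexp x) = 2 / x.
Proof.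
move=> x0; have [H1 H2] := integrable_wexp_cos 0 x0.
have E : wexp x = fun z => 2^-1 * (wexp x z * (1 + cos (0 * z))).
  by apply/funext => z; rewrite mul0r cos0; field.
split; first by rewrite E; exact: integrableRZl.
by rewrite E RintZl// H2; field; rewrite gt_eqF.
Qed.

(** Expand the cosine of the sum: the sine part is odd and integrates to 0, and the Poisson kernel 2
    x / (x^2 + e^2) is twice the Lorentzian at frequency 1 / x. *)
Lemma Rint_wexp_cos (x e th : R) : 0 < x ->
  Rint (fun z => wexp x z * cos (z * e + th)) = cos th * (2 * lor x^-1 e).
Proof.
move=> x0; have [H1 H2] := integrable_wexp_cos e x0; have [H3 H4] := integrable_wexp x0.
have mw := measurable_wexp x.
have ic : integrableR (fun z => wexp x z * cos (e * z)).
  rewrite (_ : (fun _ => _) = fun z => wexp x z * (1 + cos (e * z)) - wexp x z).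
    exact: integrableRB.
  by apply/funext => z; ring.
have Ic : Rint (fun z => wexp x z * cos (e * z)) = 2 * x / (x ^+ 2 + e ^+ 2).
  rewrite (_ : (fun _ => _) = fun z => wexp x z * (1 + cos (e * z)) - wexp x z).
    by rewrite RintB// H2 H4; ring.
  by apply/funext => z; ring.
have ms : measurable_fun setT (fun z : R => wexp x z * sin (e * z)).
  apply: measurable_funM => //; apply: measurableT_comp; last exact: measurable_funM.
  by apply: continuous_measurable_fun; exact: continuous_sin.
have iS : integrableR (fun z => wexp x z * sin (e * z)).
  apply: (integrableR_dom ms H3) => z.
  by rewrite normrM ger0_norm ?wexp_ge0// ler_piMr ?wexp_ge0// ler_norml sin_geN1 sin_le1.
have Is : Rint (fun z => wexp x z * sin (e * z)) = 0.
  have := Rint_subl 0 ms.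
  rewrite (_ : (fun y => _) = fun y => (- 1) * (wexp x y * sin (e * y))); last first.
    by apply/funext => y; rewrite /wexp sub0r normrN mulrN sinN; ring.
  by rewrite RintZl//; lra.
rewrite (_ : (fun _ => _) = fun z => cos th * (wexp x z * cos (e * z)) - sin th * (wexp x z * sin (e * z))).
  rewrite RintB; last 2 first.
  - exact: integrableRZl.
  - exact: integrableRZl.
  rewrite !RintZl// Is Ic mulr0 subr0 lor.unlock; congr (_ * _).
  by field; rewrite !gt_eqF//; exact: sqrD_gt0.
by apply/funext => z; rewrite cosD (mulrC z e); ring.
Qed.

(** A point of continuity is a Lebesgue point, so [lebesgue_pt_lor] applies at 0; the limit carries
    the mass pi of the Lorentzian. *)
Lemma Cc_lor_cvg (r : R) (a : R -> R) : 0 < r -> Cc r a ->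
  (fun n => Rint (fun e => lor (2 ^+ n) e * a e)) @ \oo --> pi * a 0.
Proof.
move=> r0 Ca; have ai := Cc_integrable r0 Ca; have ma := Cc_measurable Ca.
have mlor (N : R) : measurable_fun setT (fun y : R => lor N (0 - y)).
  by apply: measurableT_comp; [exact: measurable_lor|exact: measurable_subl].
have li : integrableR (fun y => lor 1 (0 - y) * a y).
  apply: (integrableR_dom (g := fun y => `|a y|)); first exact: measurable_funM.
    exact: integrableR_norm.
  move=> y; rewrite normrM ger0_norm ?lor_ge0// ler_piMl//.
  exact: lor_le.
have lp : lebesgue_pt a 0.
  apply: (@continuous_lebesgue_pt _ _ _ setT) => //; last exact: Ca.1.
  exact: open_nbhsT.
have H := lebesgue_pt_lor ma li lp.
apply/subr_cvg0 => //.
apply/norm_cvg0P.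
apply: (squeeze_cvgr _ (cvg_cst 0) H).
apply: nearW => n; rewrite normr_ge0/=.
have N1 : 1 <= 2 ^+ n :> R by rewrite exprn_ege1// ler1n.
have N0 : 0 < 2 ^+ n :> R by rewrite exprn_gt0.
have il := integrable_lor N0.
have i1 : integrableR (fun e => lor (2 ^+ n) e * a e).
  apply: (integrableR_dom (g := fun y => 2 ^+ n * `|a y|)).
  - by apply: measurable_funM => //; exact: measurable_lor.
  - by apply: integrableRZl; exact: integrableR_norm.
  - move=> y; rewrite normrM ger0_norm ?lor_ge0 ?(ltW N0)// ler_wpM2r//.
    exact: (lor_le _ (ltW N0)).
rewrite -(Rint_lor N0) mulrC -RintZl// -RintB//; last exact: integrableRZl.
apply: normr_Rint_dom.
- apply: measurable_funB; first by apply: measurable_funM => //; exact: measurable_lor.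
  by apply: measurable_funM => //; exact: measurable_lor.
- exact: (integrable_lor_dev ma li).
- move=> y; rewrite sub0r lorN mulrC -mulrBl normrM mulrC (ger0_norm (lor_ge0 _ (ltW N0))).
  by [].
Qed.

(* Abel summation: integrate against exp (- x |z|) and let x tend to 0, so that the Poisson
   kernel replaces the Dirac mass. *)
Lemma Rint_osc (r : R) (a : R -> R) (th : R) : 0 < r -> Cc r a -> integrableR (osc a th) ->
  Rint (osc a th) = 2 * pi * a 0 * cos th.
Proof.
move=> r0 Ca oi; have ai := Cc_integrable r0 Ca; have ma := Cc_measurable Ca.
pose I n := Rint (fun z => wexp (2 ^- n) z * osc a th z).
have mo := measurable_osc th ma.
have L1 : I @ \oo --> Rint (osc a th).
  apply: (Rint_dominated_cvg (g := fun z => `|osc a th z|)) => //.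
  - by move=> n; apply: measurable_funM => //; exact: measurable_wexp.
  - move=> z; rewrite -[X in _ --> X]mul1r; apply: cvgMl.
    have H0 : (fun n => - (2 ^- n * `|z|)) @ \oo --> (0 : R).
      rewrite -oppr0; apply: cvgN; rewrite -[X in _ --> X](mul0r `|z|); apply: cvgMl.
      under eq_fun do rewrite -exprVn.
      by apply: cvg_expr; rewrite ger0_norm ?invr_ge0// invf_lt1// ltr1n.
    by have := cvg_comp _ _ H0 (@continuous_expR R 0); rewrite expR0; apply.
  - exact: integrableR_norm.
  - move=> n z; rewrite normrM ger0_norm ?wexp_ge0// ler_piMl//.
    by rewrite wexp_le1// invr_ge0 exprn_ge0.
have IE n : I n = 2 * cos th * Rint (fun e => lor (2 ^+ n) e * a e).
  have x0 : 0 < 2 ^- n :> R by rewrite invr_gt0 exprn_gt0.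
  have [wi _] := integrable_wexp x0.
  have -> : I n = Rint (fun z => Rint (fun e => wexp (2 ^- n) z * (cos (z * e + th) * a e))).
    rewrite /I; apply: eq_Rint => z; rewrite RintZl; first by rewrite osc.unlock.
    exact: integrable_osc_integrand.
  rewrite (Rint_Fubini (a := wexp (2 ^- n)) (b := fun _ e => `|a e|) (M := Rint (fun e => `|a e|))).
  - rewrite -RintZl; last first.
      apply: (integrableR_dom (g := fun y => 2 ^+ n * `|a y|)).
      + by apply: measurable_funM => //; exact: measurable_lor.
      + by apply: integrableRZl; exact: integrableR_norm.
      + move=> y; rewrite normrM ger0_norm ?lor_ge0 ?exprn_ge0// ler_wpM2r//.
        by apply: lor_le; rewrite exprn_ge0.
    apply: eq_Rint => e.
    have -> : (fun z => wexp (2 ^- n) z * (cos (z * e + th) * a e)) =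
              (fun z => a e * (wexp (2 ^- n) z * cos (z * e + th))).
      by apply/funext => z; ring.
    rewrite RintZl; first by rewrite Rint_wexp_cos// invrK; ring.
    apply: (integrableR_dom _ wi).
      apply: measurable_funM; first exact: measurable_wexp.
      by apply: measurable_cos_affine; apply: measurable_funD => //; exact: measurable_funM.
    by move=> z; rewrite mulrC (le_trans (norm_cos_le _ _))// ger0_norm// wexp_ge0.
  - apply: measurable_funM; last exact: measurable_osc_integrand2.
    by apply: measurableT_comp => //; exact: measurable_wexp.
  - exact: wi.
  - by move=> z; exact: wexp_ge0.
  - by move=> _; exact: measurableT_comp.
  - by [].
  - by move=> _; rewrite EFin_Rint//; exact: integrableR_norm.
  - move=> z e; rewrite normrM ger0_norm ?wexp_ge0// ler_wpM2l ?wexp_ge0//.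
    exact: norm_cos_le.
have L2 : I @ \oo --> 2 * cos th * (pi * a 0).
  rewrite (_ : I = fun n => 2 * cos th * Rint (fun e => lor (2 ^+ n) e * a e)); last exact/funext.
  by apply: cvgMr; exact: (Cc_lor_cvg r0 Ca).
by rewrite (cvg_unique _ L1 L2) //; ring.
Qed.

End Inversion.

(** * Rescaled symbols and their action on plane waves *)

Section Symbols.
Variable R : realType.
Local Notation mu := (@lebesgue_measure R).
Implicit Types (a : R -> R) (r M th z xi : R).

Definition C2c r a : Prop := exists a1 a2 : R -> R,
  [/\ (forall x : R, is_derive x 1 a (a1 x)), (forall x : R, is_derive x 1 a1 (a2 x)),
      Cc r a, Cc r a1 & Cc r a2].

Lemma Cc_scale r a (A N : R) : 0 < N -> Cc r a -> Cc (r * N) (fun x => A * a (x / N)).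
Proof.
move=> N0 [ca supp]; split.
  apply: continuousRM; first exact: cst_continuous.
  apply: (continuousRcomp ca) => x; apply: cvgM; [exact: cvg_id|exact: cvg_cst].
move=> x rx; rewrite supp ?mulr0// normrM (ger0_norm (_ : 0 <= N^-1)) ?invr_ge0 ?(ltW N0)//.
by rewrite ler_pdivlMr.
Qed.

(** The trivial bound and the one from two integrations by parts are added: (1 + (N z)^2) |osc| <= 2
    r N A (M0 + M2), where M0 and M2 bound the profile and its second derivative. The constant is
    therefore the same at all frequencies. *)
Lemma osc_scaled_bound r a : 0 < r -> C2c r a -> exists2 C : R, 0 <= C &
  forall A N th z : R, 0 < N -> 0 <= A ->
    `|osc (fun x => A * a (x / N)) th z| <= A * C * lor N z.
Proof.
move=> r0 [a1 [a2 [da da1 Ca Ca1 Ca2]]].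
have [M0 M00 aM0] := Cc_bounded r0 Ca.
have [M2 M20 aM2] := Cc_bounded r0 Ca2.
exists (2 * r * (M0 + M2)); first by rewrite !mulr_ge0 ?addr_ge0// ltW.
move=> A N th z N0 A0.
pose b (x : R) : R := A * a (x / N).
pose b1 (x : R) : R := A / N * a1 (x / N).
pose b2 (x : R) : R := A / N ^+ 2 * a2 (x / N).
have Cb : Cc (r * N) b := Cc_scale A N0 Ca.
have Cb1 : Cc (r * N) b1 := Cc_scale (A / N) N0 Ca1.
have Cb2 : Cc (r * N) b2 := Cc_scale (A / N ^+ 2) N0 Ca2.
have rN : 0 < r * N by rewrite mulr_gt0.
have dl (x : R) : is_derive x 1 (fun x : R => x / N) N^-1.
  apply: (is_derive_eq (is_derive1M (is_derive_id x 1) (is_derive_cst N^-1 x 1))).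
  by rewrite mul1r mulr0 addr0.
have dc (B : R) (c c1 : R -> R) : (forall x : R, is_derive x 1 c (c1 x)) ->
    forall x : R, is_derive x 1 (fun x => B * c (x / N)) (B / N * c1 (x / N)).
  move=> dcc x.
  apply: (is_derive_eq (is_derive1M (is_derive_cst B x 1) (is_derive1_comp (dcc _) (dl x)))).
  by rewrite /= mul0r add0r /cst; ring.
have db : forall x : R, is_derive x 1 b (b1 x) by move=> x; exact: dc.
have db1 : forall x : R, is_derive x 1 b1 (b2 x).
  move=> x; apply: (is_derive_eq (dc (A / N) _ _ da1 x)); rewrite /b2; field.
  by rewrite gt_eqF.
have B0 : `|osc b th z| <= 2 * (r * N) * (A * M0).
  apply: osc_le; [exact: ltW|exact: Cc_measurable Cb|exact: Cb.2|].
  by move=> x; rewrite normrM (ger0_norm A0) ler_wpM2l.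
have A2 : 0 <= A / N ^+ 2 by rewrite divr_ge0// exprn_ge0// ltW.
have B2 : z ^+ 2 * `|osc b th z| <= 2 * (r * N) * (A / N ^+ 2 * M2).
  have [->|z0] := eqVneq z 0.
    by rewrite expr0n mul0r; apply: mulr_ge0; [rewrite mulr_ge0// ltW|exact: mulr_ge0].
  rewrite -[z ^+ 2]ger0_norm ?sqr_ge0// -normrM (osc_by_parts th rN z0 db db1 Cb Cb1 Cb2) normrN.
  apply: osc_le; [exact: ltW|exact: Cc_measurable Cb2|exact: Cb2.2|].
  by move=> x; rewrite normrM (ger0_norm A2) ler_wpM2l.
have D0 : 0 < 1 + (N * z) ^+ 2 by rewrite ltr_pwDl ?sqr_ge0.
rewrite -/b lor.unlock mulrA ler_pdivlMr//.
have N2 : 0 < N ^+ 2 by rewrite exprn_gt0.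
have {}B2 : N ^+ 2 * (z ^+ 2 * `|osc b th z|) <= 2 * (r * N) * (A * M2).
  have := ler_wpM2l (ltW N2) B2; congr (_ <= _); field; by rewrite gt_eqF.
rewrite exprMn; lra.
Qed.

Definition symb r a : Prop := [/\ 0 < r, Cc r a & forall th, integrableR (osc a th)].

Lemma C2c_scaled_symb r a (A N : R) : 0 < r -> C2c r a -> 0 < N -> 0 <= A ->
  symb (r * N) (fun x => A * a (x / N)).
Proof.
move=> r0 Ca N0 A0; have [C C0 HC] := osc_scaled_bound r0 Ca.
have CA : Cc (r * N) (fun x => A * a (x / N)).
  by case: Ca => a1 [a2 [_ _ Ca _ _]]; exact: Cc_scale.
split=> //; first by rewrite mulr_gt0.
move=> th; apply: (integrableR_dom (g := fun z => A * C * lor N z)).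
- by apply: measurable_osc; exact: Cc_measurable CA.
- by apply: integrableRZl; exact: integrable_lor.
- by move=> z; exact: HC.
Qed.

Lemma Rint_shift (f : R -> R) (c : R) : measurable_fun setT f ->
  Rint (fun y => f (y + c)) = Rint f.
Proof.
move=> mf; pose g (y : R) : R := f (0 - y).
have mg : measurable_fun setT g by apply: measurableT_comp => //; exact: measurable_subl.
rewrite -(Rint_subl 0 mf) -(Rint_subl (- c) mg); apply: eq_Rint => y.
by rewrite /g; congr f; ring.
Qed.

Lemma Cc_shift r a xi : Cc r a -> Cc (r + `|xi|) (fun e => a (e + xi)).
Proof.
move=> [ca supp]; split.
  apply: (continuousRcomp ca) => x; apply: cvgD; [exact: cvg_id|exact: cvg_cst].
move=> x rx; apply: supp; rewrite -(lerD2r `|xi|) (le_trans rx)//.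
by rewrite -{1}(addrK xi x) ler_normB.
Qed.

(** Translating the symbol modulates its transform. In particular the transform stays integrable, so
    that inversion at 0 gives inversion at every point. *)
Lemma osc_shift a th xi z : integrableR a ->
  osc (fun e => a (e + xi)) th z =
  cos (z * xi) * osc a th z + sin (z * xi) * osc a (th - pi / 2) z.
Proof.
move=> ai; have ma := integrableR_measurable ai.
rewrite osc.unlock -!RintZl; [|exact: integrable_osc_integrand..].
rewrite -RintD; [|by apply: integrableRZl; exact: integrable_osc_integrand..].
rewrite -[RHS](Rint_shift xi); last first.
  by apply: measurable_funD; apply: measurable_funM => //; exact: measurable_osc_integrand.
apply: eq_Rint => e.
rewrite !mulrA -mulrDl; congr (_ * _).
rewrite addrA [cos (_ + _ - _)]cosB cos_pihalf sin_pihalf mulr0 add0r mulr1.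
rewrite -[in LHS](addrK (z * xi) (z * e + th)) cosB.
by rewrite (_ : z * e + th + z * xi = z * (e + xi) + th); ring.
Qed.

Lemma Rint_osc_shift r a th xi : symb r a ->
  Rint (osc (fun e => a (e + xi)) th) = 2 * pi * a xi * cos th.
Proof.
move=> [r0 Ca oi].
have ai := Cc_integrable r0 Ca; have ma := Cc_measurable Ca.
have -> : 2 * pi * a xi * cos th = 2 * pi * (fun e => a (e + xi)) 0 * cos th by rewrite add0r.
have Cs := Cc_shift xi Ca.
apply: (Rint_osc _ Cs); first by rewrite ltr_pwDl.
apply: (integrableR_dom (g := fun z => `|osc a th z| + `|osc a (th - pi / 2) z|)).
- by apply: measurable_osc; exact: Cc_measurable Cs.
- by apply: integrableRD; exact: integrableR_norm.
- move=> z; rewrite osc_shift// (le_trans (ler_normD _ _))// lerD// normrM ler_piMl// ler_norml.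
    by rewrite cos_geN1 cos_le1.
  by rewrite sin_geN1 sin_le1.
Qed.

(** Conversely, multiplication by a cosine splits the symbol into its translates by xi and -xi. Both
    sides are expanded in the cosine and sine transforms of [a] at z. *)
Lemma osc_cos r a th th' xi z : symb r a ->
  osc a th z * cos (z * xi + th') =
  2^-1 * (osc (fun e => a (e - xi)) (th + th') z + osc (fun e => a (e + xi)) (th - th') z).
Proof.
move=> [r0 Ca _]; have ai := Cc_integrable r0 Ca.
rewrite !osc_shift//.
have cosE t : osc a t z = cos t * osc a 0 z - sin t * Rint (fun e => sin (z * e) * a e).
  have iS : integrableR (fun e => sin (z * e) * a e).
    have := integrable_osc_integrand (- (pi / 2)) z ai.
    congr integrableR; apply/funext => e.
    by rewrite cosB cos_pihalf sin_pihalf mulr0 add0r mulr1.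
  rewrite osc.unlock -!RintZl//; last exact: integrable_osc_integrand.
  rewrite -RintB; [|by apply: integrableRZl; exact: integrable_osc_integrand|exact: integrableRZl].
  by apply: eq_Rint => e; rewrite addr0 cosD; ring.
rewrite !(cosE th, cosE (_ - _), cosE (_ + _)) mulrN cosN sinN.
set c := osc _ _ _; set s := Rint _.
rewrite !cosB !sinB !cosD !sinD cos_pihalf sin_pihalf !cosN !sinN.
by field.
Qed.

(** The kernel acts on a plane wave through the values of the symbol at its two frequencies xi and
    -xi, by inversion of the two translates. *)
Lemma Rint_osc_cos r a th th' xi x : symb r a ->
  Rint (fun y => osc a th (x - y) * cos (y * xi + th')) =
  pi * (a (- xi) * cos (th - (x * xi + th')) + a xi * cos (th + (x * xi + th'))).
Proof.
move=> sa; have [r0 Ca oi] := sa; have ma := Cc_measurable Ca.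
pose t := - (x * xi + th').
have mz : measurable_fun setT (fun z => osc a th z * cos (z * xi + t)).
  apply: measurable_funM; first exact: measurable_osc.
  by apply: measurable_cos_affine; apply: measurable_funD => //; exact: measurable_funM.
transitivity (Rint (fun z => osc a th z * cos (z * xi + t))).
  rewrite -(Rint_subl x mz); apply: eq_Rint => y; congr (_ * _).
  by rewrite -cosN /t; congr cos; ring.
under eq_Rint do rewrite (osc_cos _ _ _ _ sa).
have si c th0 : integrableR (osc (fun e => a (e + c)) th0).
  have ai := Cc_integrable r0 Ca.
  have Cs := Cc_shift c Ca.
  apply: (integrableR_dom (g := fun z => `|osc a th0 z| + `|osc a (th0 - pi / 2) z|)).
  - by apply: measurable_osc; exact: Cc_measurable Cs.
  - by apply: integrableRD; exact: integrableR_norm.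
  - move=> z; rewrite osc_shift// (le_trans (ler_normD _ _))// lerD// normrM ler_piMl// ler_norml.
      by rewrite cos_geN1 cos_le1.
    by rewrite sin_geN1 sin_le1.
rewrite RintZl; last exact: integrableRD.
rewrite RintD//.
rewrite (Rint_osc_shift _ (- xi) sa) (Rint_osc_shift _ xi sa) /t opprK.
by field.
Qed.

End Symbols.

(** * The Littlewood-Paley kernels *)

(* Kernels of the multipliers phi (xi / 2 ^ k) and (i xi) ^ 3 psi_k xi. Both are real, phi being
   even; the phase - pi / 2 turns the cosine in [osc] into a sine. *)
HB.lock Definition kap (R : realType) (phi : R -> R) (k : int) (z : R) : R :=
  (2 * pi)^-1 * osc (fun x => phi (x / dyad R k)) 0 z.

HB.lock Definition ker3 (R : realType) (phi : R -> R) (k : int) (z : R) : R :=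
  (2 * pi)^-1 * osc (fun x => x ^+ 3 * psiN phi (dyad R k) x) (- (pi / 2)) z.

Section Kernels.
Variable R : realType.
Local Notation mu := (@lebesgue_measure R).
Variable phi : R -> R.
Hypothesis Hphi : admissible_cutoff phi.

Let phi1 (x : R) : `|x| <= 1 -> phi x = 1.
Proof. by case: Hphi => _ [_ [_ [_ [H _]]]]; exact: H. Qed.

Let phiN (x : R) : phi (- x) = phi x.
Proof. by case: Hphi => _ [_ [_ [H _]]]; exact: H. Qed.

(** The inequality is strict because the function must vanish in a neighbourhood of the point. *)
Lemma derive_supp (f df : R -> R) (a : R) : (forall x : R, is_derive x 1 f (df x)) ->
  (forall x : R, a < `|x| -> f x = 0) -> forall x : R, a < `|x| -> df x = 0.
Proof.
move=> fd f0 x ax.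
have -> : df x = 'D_1 f x by rewrite derive_val.
rewrite (near_eq_derive (g := cst 0)) ?oner_neq0//; first by rewrite derive_val.
have : \forall y \near x, a < `|y|.
  by move: (@norm_continuous _ R x) => /cvgr_gt; apply.
by apply: filterS => y; exact: f0.
Qed.

(** The gap between a and 2 in the support condition makes the derivatives vanish up to and
    including |x| = 2. *)
Lemma cutoff_C2c : C2c 2 phi.
Proof.
case: Hphi => dphi [[a [a2 supp]] _].
pose p1 := derive1n 1 phi; pose p2 := derive1n 2 phi.
have d (n : nat) (x : R) : is_derive x 1 (derive1n n phi) (derive1n n.+1 phi x).
  by apply: DeriveDef; [exact: dphi|rewrite derive1nS derive1E].
have s0 (x : R) : a < `|x| -> phi x = 0 by move=> ax; apply: supp; exact: ltW.
have s1 := derive_supp (d 0%N) s0.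
have s2 := derive_supp (d 1%N) s1.
have s3 (n : nat) : (forall x : R, a < `|x| -> derive1n n phi x = 0) -> Cc 2 (derive1n n phi).
  move=> H; split; first exact: (is_derive1_continuous (d n)).
  by move=> x x2; apply: H; exact: lt_le_trans x2.
exists p1, p2; split; [exact: (d 0%N)|exact: (d 1%N)|exact: (s3 0%N)|exact: s3|exact: s3].
Qed.

(** The profile at unit frequency; by [psiN_sym3] the symbol at frequency 2^k is its dilate times
    2^(3k). *)
Definition sym3 (x : R) : R := x ^+ 3 * (phi x - phi (2 * x)).

Lemma C2cM (p p1 p2 : R -> R) (r : R) (a : R -> R) :
  (forall x : R, is_derive x 1 p (p1 x)) -> (forall x : R, is_derive x 1 p1 (p2 x)) ->
  continuous p2 -> C2c r a -> C2c r (fun x => p x * a x).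
Proof.
move=> dp dp1 cp2 [a1 [a2 [da da1 [ca sa] [ca1 sa1] [ca2 sa2]]]].
have cp := is_derive1_continuous dp; have cp1 := is_derive1_continuous dp1.
exists (fun x => p1 x * a x + p x * a1 x).
exists (fun x => (p2 x * a x + p1 x * a1 x) + (p1 x * a1 x + p x * a2 x)); split.
- by move=> x; exact: is_derive1M.
- by move=> x; apply: is_derive1D; exact: is_derive1M.
- by split; [exact: continuousRM|move=> x rx; rewrite sa// mulr0].
- split; first by apply: continuousRD; exact: continuousRM.
  by move=> x rx; rewrite sa// sa1// !mulr0 addr0.
- split; first by apply: continuousRD; apply: continuousRD; exact: continuousRM.
  by move=> x rx; rewrite sa// sa1// sa2// !mulr0 !addr0.
Qed.

Lemma C2cB (r : R) (a b : R -> R) : C2c r a -> C2c r b -> C2c r (fun x => a x + (- 1) * b x).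
Proof.
move=> [a1 [a2 [da da1 [ca sa] [ca1 sa1] [ca2 sa2]]]] [b1 [b2 [db db1 [cb sb] [cb1 sb1] [cb2 sb2]]]].
have dN (f g : R -> R) : (forall x : R, is_derive x 1 f (g x)) ->
    forall x : R, is_derive x 1 (fun x => (- 1) * f x) ((- 1) * g x).
  move=> fg x; apply: (is_derive_eq (is_derive1M (is_derive_cst (- 1 : R) x 1) (fg x))).
  by rewrite mul0r add0r.
have cN (f : R -> R) : continuous f -> continuous (fun x => (- 1) * f x).
  by move=> cf; apply: continuousRM => //; exact: cst_continuous.
exists (fun x => a1 x + (- 1) * b1 x), (fun x => a2 x + (- 1) * b2 x); split.
- by move=> x; apply: is_derive1D => //; exact: dN.
- by move=> x; apply: is_derive1D => //; exact: dN.
- by split; [apply: continuousRD => //; exact: cN|move=> x rx; rewrite sa// sb// mulr0 addr0].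
- by split; [apply: continuousRD => //; exact: cN|move=> x rx; rewrite sa1// sb1// mulr0 addr0].
- by split; [apply: continuousRD => //; exact: cN|move=> x rx; rewrite sa2// sb2// mulr0 addr0].
Qed.

Lemma cutoff_double_C2c : C2c 2 (fun x => phi (2 * x)).
Proof.
have [a1 [a2 [da da1 Ca Ca1 Ca2]]] := cutoff_C2c.
have dl (x : R) : is_derive x 1 (fun x : R => 2 * x) 2.
  apply: (is_derive_eq (is_derive1M (is_derive_cst (2 : R) x 1) (is_derive_id x 1))).
  by rewrite mul0r add0r mulr1.
have cl : continuous (fun x : R => 2 * x) := is_derive1_continuous dl.
have s2 (x : R) : 2 <= `|x| -> 2 <= `|2 * x|.
  by move=> x2; rewrite normrM ger0_norm// ler_peMr// (le_trans _ x2)// ler1n.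
have dc (c c1 : R -> R) (A : R) : (forall x : R, is_derive x 1 c (c1 x)) ->
    forall x : R, is_derive x 1 (fun x => A * c (2 * x)) (A * 2 * c1 (2 * x)).
  move=> dcc x.
  apply: (is_derive_eq (is_derive1M (is_derive_cst A x 1) (is_derive1_comp (dcc _) (dl x)))).
  by rewrite mul0r add0r /cst; ring.
have CC (c : R -> R) (A : R) : Cc 2 c -> Cc 2 (fun x => A * c (2 * x)).
  move=> [cc sc]; split; last by move=> x x2; rewrite sc ?mulr0// s2.
  apply: continuousRM; [exact: cst_continuous|exact: continuousRcomp].
exists (fun x => 2 * a1 (2 * x)), (fun x => 2 * 2 * a2 (2 * x)); split.
- move=> x; have := dc _ _ 1 da x; rewrite mul1r.
  by congr is_derive; apply/funext => y; rewrite mul1r.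
- exact: dc.
- have := CC _ 1 Ca; congr Cc; apply/funext => y; rewrite mul1r //.
- exact: CC.
- exact: CC.
Qed.

Lemma sym3_C2c : C2c 2 sym3.
Proof.
have d2 (A x : R) : is_derive x 1 (fun y : R => A * (y * y)) (A * (2 * x)).
  apply: (is_derive_eq (is_derive1M (is_derive_cst A x 1)
    (is_derive1M (is_derive_id x 1) (is_derive_id x 1)))).
  by rewrite /cst; ring.
have d3 (x : R) : is_derive x 1 (fun y : R => y ^+ 3) (3 * (x * x)).
  rewrite (_ : (fun y : R => y ^+ 3) = fun y => y * (1 * (y * y))); last first.
    by apply/funext => y; ring.
  by apply: (is_derive_eq (is_derive1M (is_derive_id x 1) (d2 1 x))); ring.
have c1 : continuous (fun x : R => 3 * (2 * x)).
  apply: continuousRM; first exact: cst_continuous.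
  by apply: continuousRM; [exact: cst_continuous|move=> x; exact: cvg_id].
have := C2cM d3 (d2 3) c1 (C2cB cutoff_C2c cutoff_double_C2c).
by congr C2c; apply/funext => x; rewrite /sym3 mulN1r.
Qed.

Local Notation dy := (dyad R).

Lemma dyad_gt0 (k : int) : 0 < dy k.
Proof. by rewrite /dyad exprz_gt0. Qed.

Lemma dyad_ge0 (k : int) : 0 <= dy k.
Proof. exact: ltW (dyad_gt0 k). Qed.

Lemma dyadD (j k : int) : dy (j + k) = dy j * dy k.
Proof. by rewrite /dyad expfzDr. Qed.

Lemma dyad_nat (n : nat) : dy n%:Z = 2 ^+ n.
Proof. by []. Qed.

Lemma dyad_neg (n : nat) : dy (- n%:Z) = 2 ^- n.
Proof. by rewrite /dyad exprnN. Qed.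

Lemma dyad_le (j k : int) : (j <= k)%R -> dy j <= dy k.
Proof. by move=> jk; rewrite /dyad ler_eXz2l ?ltr1n. Qed.

Local Notation kap := (@kap R phi).
Local Notation ker3 := (@ker3 R phi).

Lemma kapE k z : kap k z = (2 * pi)^-1 * Rint (fun e => cos (z * e + 0) * phi (e / dy k)).
Proof. by rewrite kap.unlock osc.unlock. Qed.

Lemma psiN_sym3 k : (fun x => x ^+ 3 * psiN phi (dy k) x) =
  (fun x => dy k ^+ 3 * sym3 (x / dy k)).
Proof.
apply/funext => x; rewrite /psiN /sym3 mulrA; congr (_ * (_ - phi _)).
  by rewrite exprMn exprVn mulrCA divff ?mulr1// expf_neq0// gt_eqF// dyad_gt0.
by rewrite mulrA.
Qed.

Lemma symb_kap k : symb (2 * dy k) (fun x => phi (x / dy k)).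
Proof.
have := C2c_scaled_symb (ltr0n R 2) cutoff_C2c (dyad_gt0 k) ler01.
by congr symb; apply/funext => x; rewrite mul1r.
Qed.

Lemma symb_ker3 k : symb (2 * dy k) (fun x => x ^+ 3 * psiN phi (dy k) x).
Proof.
rewrite psiN_sym3; apply: C2c_scaled_symb => //; first exact: sym3_C2c.
- exact: dyad_gt0.
- by rewrite exprn_ge0// dyad_ge0.
Qed.

Lemma kap_bound : exists2 C : R, 0 <= C & forall k z, `|kap k z| <= C * lor (dy k) z.
Proof.
have [C C0 H] := osc_scaled_bound (ltr0n R 2) cutoff_C2c.
have pi0 : 0 <= (2 * pi)^-1 :> R by rewrite invr_ge0 mulr_ge0// pi_ge0.
exists ((2 * pi)^-1 * C) => [|k z]; first by rewrite mulr_ge0.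
have := H 1 (dy k) 0 z (dyad_gt0 k) ler01.
rewrite (_ : (fun x => 1 * phi (x / dy k)) = fun x => phi (x / dy k)); last first.
  by apply/funext => x; rewrite mul1r.
by rewrite mul1r => HH; rewrite kap.unlock normrM ger0_norm// -mulrA ler_wpM2l.
Qed.

Lemma ker3_bound : exists2 C : R, 0 <= C &
  forall k z, `|ker3 k z| <= C * dy k ^+ 3 * lor (dy k) z.
Proof.
have [C C0 H] := osc_scaled_bound (ltr0n R 2) sym3_C2c.
have pi0 : 0 <= (2 * pi)^-1 :> R by rewrite invr_ge0 mulr_ge0// pi_ge0.
exists ((2 * pi)^-1 * C) => [|k z]; first by rewrite mulr_ge0.
have := H (dy k ^+ 3) (dy k) (- (pi / 2)) z (dyad_gt0 k) (exprn_ge0 _ (dyad_ge0 k)).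
move=> HH; rewrite ker3.unlock psiN_sym3 normrM ger0_norm//.
by rewrite -!(mulrA (2 * pi)^-1) ler_wpM2l// (mulrC C).
Qed.

Lemma measurable_kap k : measurable_fun setT (kap k).
Proof.
rewrite kap.unlock; apply: measurable_funM => //; apply: measurable_osc.
by case: (symb_kap k) => _ /Cc_measurable.
Qed.

Lemma measurable_ker3 k : measurable_fun setT (ker3 k).
Proof.
rewrite ker3.unlock; apply: measurable_funM => //; apply: measurable_osc.
by case: (symb_ker3 k) => _ /Cc_measurable.
Qed.

Lemma integrable_kap k : integrableR (kap k).
Proof. by rewrite kap.unlock; apply: integrableRZl; case: (symb_kap k) => _ _; exact. Qed.

(** Because phi is even, the two frequencies carry the same value and recombine into the original
    wave. *)
Lemma Rint_kap_cos k (x eta th : R) :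
  Rint (fun y => kap k (x - y) * cos (y * eta + th)) = phi (eta / dy k) * cos (x * eta + th).
Proof.
have [r0 Ca oi] := symb_kap k.
transitivity (Rint (fun y => (2 * pi)^-1 *
    (osc (fun x => phi (x / dy k)) 0 (x - y) * cos (y * eta + th)))).
  by apply: eq_Rint => y; rewrite kap.unlock mulrA.
rewrite RintZl.
  rewrite (Rint_osc_cos _ _ _ _ (symb_kap k)) !add0r cosN mulNr phiN.
  have : pi != 0 :> R by rewrite gt_eqF// pi_gt0.
  by move: (pi : R) => c c0; field.
apply: (integrableR_dom (g := fun y => `|osc (fun x => phi (x / dy k)) 0 (x - y)|)).
- apply: measurable_funM; last first.
    by apply: measurable_cos_affine; apply: measurable_funD => //; exact: measurable_funM.
  apply: measurableT_comp; last exact: measurable_subl.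
  by apply: measurable_osc; exact: Cc_measurable Ca.
- by apply: integrableR_norm; exact: (integrableR_subl x (oi 0)).
- by move=> y; rewrite mulrC norm_cos_le.
Qed.

Lemma Rint_kap k : Rint (kap k) = 1.
Proof.
have := Rint_kap_cos k 0 0 0.
rewrite mul0r phi1 ?normr0// mul0r add0r cos0 mulr1 => <-.
rewrite -(Rint_subl 0 (measurable_kap k)); apply: eq_Rint => y.
by rewrite mulr0 addr0 cos0 mulr1.
Qed.

Lemma psiN0 k (x : R) : `|x| <= dy k / 2 -> psiN phi (dy k) x = 0.
Proof.
move=> xk; have d0 := dyad_gt0 k; rewrite /psiN !phi1 ?subrr// normrM.
  rewrite normfV (ger0_norm (dyad_ge0 k)) ler_pdivrMr// mul1r normrM ger0_norm//.
  by rewrite mulrC -ler_pdivlMr.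
rewrite normfV (ger0_norm (dyad_ge0 k)) ler_pdivrMr// mul1r (le_trans xk)//.
by lra.
Qed.

(** Both cutoffs in psi_k equal 1 at eta and -eta. This cancellation is what later lets a
    low-frequency product be subtracted at no cost. *)
Lemma Rint_ker3_cos k (x eta th : R) : `|eta| <= dy k / 2 ->
  Rint (fun y => ker3 k (x - y) * cos (y * eta + th)) = 0.
Proof.
move=> ek; have [r0 Ca oi] := symb_ker3 k.
transitivity (Rint (fun y => (2 * pi)^-1 *
    (osc (fun x => x ^+ 3 * psiN phi (dy k) x) (- (pi / 2)) (x - y) * cos (y * eta + th)))).
  by apply: eq_Rint => y; rewrite ker3.unlock mulrA.
rewrite RintZl.
  by rewrite (Rint_osc_cos _ _ _ _ (symb_ker3 k)) !psiN0 ?normrN// !mulr0 !mul0r addr0 !mulr0.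
apply: (integrableR_dom (g := fun y => `|osc (fun x => x ^+ 3 * psiN phi (dy k) x) (- (pi / 2)) (x - y)|)).
- apply: measurable_funM; last first.
    by apply: measurable_cos_affine; apply: measurable_funD => //; exact: measurable_funM.
  apply: measurableT_comp; last exact: measurable_subl.
  by apply: measurable_osc; exact: Cc_measurable Ca.
- by apply: integrableR_norm; exact: (integrableR_subl x (oi _)).
- by move=> y; rewrite mulrC norm_cos_le.
Qed.

Lemma Rint_odd (f : R -> R) : integrableR f -> (forall x, f (- x) = - f x) -> Rint f = 0.
Proof.
move=> fi fN; have := Rint_subl 0 (integrableR_measurable fi).
rewrite (_ : (fun y => f (0 - y)) = fun y => (- 1) * f y); last first.
  by apply/funext => y; rewrite sub0r fN mulN1r.
by rewrite RintZl//; lra.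
Qed.

Let cint_even_part (s : R -> R) (z : R) : integrableR s -> (forall x, s (- x) = s x) ->
  Rint (fun x => sin (z * x) * s x) = 0.
Proof.
move=> si sN; apply: Rint_odd; last by move=> x; rewrite mulrN sinN sN mulNr.
have := integrable_osc_integrand (- (pi / 2)) z si.
congr integrableR; apply/funext => e.
by rewrite cosB cos_pihalf sin_pihalf mulr0 add0r mulr1.
Qed.

Lemma psiN_kap k : psiN phi (dy k) = fun x => phi (x / dy k) - phi (x / dy (k - 1)).
Proof.
apply/funext => x; rewrite /psiN; congr (_ - phi _).
have E : dy (k - 1) = dy k / 2.
  by rewrite /dyad expfzDr// exprzN1.
by rewrite E invf_div mulrCA mulrA.
Qed.

Lemma mult_kernel_PN k z :
  mult_kernel (PN_symbol phi k) z = Complex (kap k z - kap (k - 1) z) 0.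
Proof.
have [r0 Ca oi] := symb_kap k; have [r0' Ca' oi'] := symb_kap (k - 1).
have ia := Cc_integrable r0 Ca; have ia' := Cc_integrable r0' Ca'.
have E1 : Rint (fun x => cos (z * x) * psiN phi (dy k) x) =
    osc (fun x => phi (x / dy k)) 0 z - osc (fun x => phi (x / dy (k - 1))) 0 z.
  rewrite osc.unlock -RintB; [|exact: integrable_osc_integrand..].
  by apply: eq_Rint => x; rewrite psiN_kap addr0 mulrBr.
have E2 : Rint (fun x => sin (z * x) * psiN phi (dy k) x) = 0.
  apply: cint_even_part; first by rewrite psiN_kap; exact: integrableRB.
  by move=> x; rewrite psiN_kap !mulNr !phiN.
rewrite /mult_kernel /cint.
have -> : Rintegral mu setT (fun y => complex.Re (cexp (z * y) * PN_symbol phi k y)) =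
   Rint (fun x => cos (z * x) * psiN phi (dy k) x).
  by apply: eq_Rint => x /=; rewrite mulr0 subr0.
have -> : Rintegral mu setT (fun y => complex.Im (cexp (z * y) * PN_symbol phi k y)) =
   Rint (fun x => sin (z * x) * psiN phi (dy k) x).
  by apply: eq_Rint => x /=; rewrite mulr0 add0r.
rewrite E1 E2 kap.unlock -mulrBr; apply/eqP; rewrite eq_complex /= !mul0r !mulr0 subr0 addr0.
by rewrite !eqxx.
Qed.

(** As (i xi)^3 = - i xi^3 and psi_k is even, the imaginary part of the integrand is odd and drops
    out, while the real part is the sine transform, that is [osc] at phase - pi / 2. *)
Lemma mult_kernel_PND3 k z :
  mult_kernel (PND3_symbol phi k) z = Complex (ker3 k z) 0.
Proof.
have [r0 Ca oi] := symb_ker3 k.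
have ia := Cc_integrable r0 Ca.
set s := (fun x => x ^+ 3 * psiN phi (dy k) x) in r0 Ca oi ia *.
have sN x : s (- x) = - s x.
  by rewrite /s psiN_kap !mulNr !phiN exprNn -mulrA; ring.
have E1 : Rint (fun x => sin (z * x) * s x) = osc s (- (pi / 2)) z.
  rewrite osc.unlock; apply: eq_Rint => e.
  by rewrite cosB cos_pihalf sin_pihalf mulr0 add0r mulr1.
have E2 : Rint (fun x => (- 1) * (cos (z * x + 0) * s x)) = 0.
  apply: Rint_odd; first by apply: integrableRZl; exact: integrable_osc_integrand.
  by move=> x; rewrite !addr0 mulrN cosN sN; ring.
have E3 y : cexp (z * y) * PND3_symbol phi k y =
    Complex (sin (z * y) * s y) ((- 1) * (cos (z * y + 0) * s y)).
  rewrite /PND3_symbol /cexp addr0 /s.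
  apply/eqP; rewrite eq_complex /=; apply/andP; split; apply/eqP; ring.
rewrite /mult_kernel /cint.
have -> : Rintegral mu setT (fun y => complex.Re (cexp (z * y) * PND3_symbol phi k y)) =
   Rint (fun x => sin (z * x) * s x).
  by apply: eq_Rint => x; rewrite E3.
have -> : Rintegral mu setT (fun y => complex.Im (cexp (z * y) * PND3_symbol phi k y)) =
   Rint (fun x => (- 1) * (cos (z * x + 0) * s x)).
  by apply: eq_Rint => x; rewrite E3.
rewrite E1 E2 ker3.unlock -/s; apply/eqP; rewrite eq_complex /= !mul0r !mulr0 subr0 addr0.
by rewrite !eqxx.
Qed.

End Kernels.

(** * Convolution on Lebesgue spaces, Bernstein's inequality and frequency supports *)

Definition conv (R : realType) (K f : R -> R) (x : R) : R := Rint (fun y : R => K (x - y) * f y).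

Definition Lp (R : realType) (p : nat) (f : R -> R) : Prop :=
  measurable_fun setT f /\ integrableR (fun y : R => `|f y| ^+ p).

Section LpConvolution.
Variable R : realType.
Local Notation mu := (@lebesgue_measure R).
Implicit Types (f g K : R -> R).

Lemma conv_arg_measurable K f (x : R) : measurable_fun setT K -> measurable_fun setT f ->
  measurable_fun setT (fun y : R => K (x - y) * f y).
Proof.
move=> mK mf; apply: measurable_funM => //.
by apply: measurableT_comp => //; exact: measurable_subl.
Qed.

Lemma measurable_conv_param d (T : measurableType d) K (f : T -> R -> R) :
  measurable_fun setT K -> measurable_fun setT (fun p : T * R => f p.1 p.2) ->
  measurable_fun setT (fun p : T * R => conv K (f p.1) p.2).
Proof.
move=> mK mf; apply: (measurable_Rint_param (f := fun (p : T * R) y => K (p.2 - y) * f p.1 y)).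
apply: measurable_funM.
  apply: measurableT_comp => //; apply: measurable_funB => //.
  by apply: measurableT_comp.
apply: (measurableT_comp mf (g := fun q : (T * R) * R => (q.1.1, q.2))).
apply: measurable_fun_pair => //.
by apply: measurableT_comp.
Qed.

Lemma measurable_conv K f : measurable_fun setT K -> measurable_fun setT f ->
  measurable_fun setT (conv K f).
Proof.
move=> mK mf.
have H := @measurable_conv_param _ R K (fun _ => f) mK (measurableT_comp mf measurable_snd).
exact: (@measurable_pair1 R _ R (fun _ x => conv K f x) 0 H).
Qed.

(** A replacement for Hölder's inequality, obtained by comparing v with the threshold e. The free e
    is used in [conv_kap_low]. *)
Lemma split_power (e v : R) (q : nat) : 0 < e -> 0 <= v -> v <= e + e ^- q * v ^+ q.+1.
Proof.
move=> e0 v0; have [ve|ve] := leP v e.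
  by rewrite (le_trans ve)// lerDl mulr_ge0 ?exprn_ge0// invr_ge0 exprn_ge0// ltW.
apply: ler_wpDl; first exact: ltW.
rewrite exprSr mulrA ler_peMl// mulrC ler_pdivlMr ?exprn_gt0// mul1r.
by rewrite lerXn2r ?nnegrE ?(ltW e0) ?(ltW ve).
Qed.

Section fixed.
Variables (p : nat) (f : R -> R).
Hypothesis (p0 : (0 < p)%N) (fp : Lp p f).

Let q := p.-1.
Let pq : p = q.+1. Proof. by rewrite /q prednK. Qed.
Let S := Rint (fun y : R => `|f y| ^+ p).

Lemma Lp_mass_ge0 : 0 <= S.
Proof. by apply: Rint_ge0 => y; rewrite exprn_ge0. Qed.

Lemma lor_Lp (N e : R) (x : R) : 0 < N -> 0 < e ->
  integrableR (fun y : R => lor N (x - y) * f y) /\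
  Rint (fun y : R => lor N (x - y) * `|f y|) <= e * pi + e ^- q * N * S.
Proof.
move=> N0 e0; have [mf fi] := fp.
have mlor : measurable_fun setT (fun y : R => lor N (x - y)).
  by apply: measurableT_comp; [exact: measurable_lor|exact: measurable_subl].
have il : integrableR (fun y : R => lor N (x - y)).
  by apply: integrableR_subl; exact: integrable_lor.
pose g (y : R) : R := e * lor N (x - y) + e ^- q * N * `|f y| ^+ p.
have ig : integrableR g by apply: integrableRD; exact: integrableRZl.
have le y : lor N (x - y) * `|f y| <= g y.
  have l0 : 0 <= lor N (x - y) by rewrite lor_ge0// ltW.
  apply: le_trans (ler_wpM2l l0 (split_power q e0 (normr_ge0 (f y)))) _.
  rewrite -pq mulrDr mulrC lerD2l mulrCA -mulrA ler_wpM2l ?invr_ge0 ?exprn_ge0 ?(ltW e0)//.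
  by rewrite ler_wpM2r ?exprn_ge0// lor_le// ltW.
have m1 : measurable_fun setT (fun y : R => lor N (x - y) * f y) by exact: measurable_funM.
have i1 : integrableR (fun y : R => lor N (x - y) * f y).
  apply: (integrableR_dom m1 ig) => y.
  by rewrite normrM ger0_norm ?lor_ge0 ?(ltW N0).
split=> //.
have i2 : integrableR (fun y : R => lor N (x - y) * `|f y|).
  have := integrableR_norm i1; congr integrableR; apply/funext => y.
  by rewrite normrM ger0_norm// lor_ge0// ltW.
apply: (le_trans (Rint_le i2 ig le)).
rewrite /g RintD; [|exact: integrableRZl..].
by rewrite !RintZl// (Rint_subl x (measurable_lor N)) Rint_lor.
Qed.

Lemma conv_Lp (K : R -> R) (C N e : R) (x : R) : measurable_fun setT K ->
  0 <= C -> 0 < N -> 0 < e -> (forall z, `|K z| <= C * lor N z) ->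
  integrableR (fun y : R => K (x - y) * f y) /\
  `|conv K f x| <= C * (e * pi + e ^- q * N * S).
Proof.
move=> mK C0 N0 e0 HK; have [mf fi] := fp; have [i1 I1] := lor_Lp x N0 e0.
have m1 : measurable_fun setT (fun y : R => K (x - y) * f y) by exact: conv_arg_measurable.
have dom y : `|K (x - y) * f y| <= C * `|lor N (x - y) * f y|.
  by rewrite !normrM (ger0_norm (lor_ge0 _ (ltW N0))) mulrA ler_wpM2r.
have ig := integrableRZl C (integrableR_norm i1).
split; first exact: (integrableR_dom m1 ig).
apply: (le_trans (normr_Rint_dom m1 ig dom)).
rewrite RintZl; last exact: integrableR_norm.
rewrite ler_wpM2l//; apply: le_trans I1.
apply: Rint_le; first exact: integrableR_norm.
  have := integrableR_norm i1; congr integrableR; apply/funext => y.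
  by rewrite normrM ger0_norm// lor_ge0// ltW.
by move=> y; rewrite normrM (ger0_norm (lor_ge0 _ (ltW N0))).
Qed.

(** On a compact set contained in |y| <= B, the kernel [lor 1] is at least 1 / (1 + B^2), so
    integrability against it suffices. *)
Lemma Lp_locally_integrable : locally_integrable setT f.
Proof.
have [mf fi] := fp; split=> //; first exact: openT.
move=> K _ cK.
have [M [_ HM]] := compact_bounded cK.
pose B := M + 1.
have HB (y : R) : K y -> `|y| <= B by apply: HM; rewrite /B ltrDl.
have mK : measurable K by exact: compact_measurable.
have [i1 _] := lor_Lp 0 (ltr01 : 0 < 1 :> R) (ltr01 : 0 < 1 :> R).
have ig := integrableRZl (1 + B ^+ 2) (integrableR_norm i1).
apply: (@le_lt_trans _ _ (\int[mu]_y ((1 + B ^+ 2) * `|lor 1 (0 - y) * f y|)%:E)%E); last first.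
  by rewrite EFin_Rint// ltry.
rewrite integral_mkcond; apply: ge0_le_integral => //.
- by move=> y _; rewrite patchE; case: ifP => // _; rewrite lee_fin.
- apply/(measurable_restrictT _ _).1 => //; apply/measurable_EFinP.
  by apply: measurableT_comp => //; exact: measurable_funTS.
- exact: (measurable_int _ ig).
- move=> y _; rewrite patchE; case: ifPn => [/set_mem Ky|_]; last first.
    by rewrite lee_fin mulr_ge0// addr_ge0// sqr_ge0.
  rewrite lee_fin normrM mulrA ler_peMl// sub0r lorN lor.unlock mul1r ger0_norm; last first.
    by rewrite invr_ge0 addr_ge0// sqr_ge0.
  rewrite ler_pdivlMr ?ltr_pwDl ?sqr_ge0// !mul1r lerD2l.
  rewrite -(real_normK (num_real y)) lerXn2r ?nnegrE//; last exact: HB.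
  by rewrite (le_trans _ (HB _ Ky)).
Qed.

End fixed.
End LpConvolution.

(** * Low-pass convolutions: limits, reproduction and Bernstein's inequality *)

Section KernelConvolution.
Variable R : realType.
Local Notation mu := (@lebesgue_measure R).
Variable phi : R -> R.
Hypothesis Hphi : admissible_cutoff phi.
Local Notation dy := (dyad R).
Local Notation kap := (@kap R phi).
Local Notation ker3 := (@ker3 R phi).

Let mkap := measurable_kap Hphi.
Let phi1 (x : R) : `|x| <= 1 -> phi x = 1.
Proof. by case: Hphi => _ [_ [_ [_ [H _]]]]; exact: H. Qed.

Lemma conv_kap_integrable p f k x : (0 < p)%N -> Lp p f ->
  integrableR (fun y : R => kap k (x - y) * f y).
Proof.
move=> p0 fp; have [C C0 HC] := kap_bound Hphi.
by have [] := conv_Lp p0 fp x (mkap k) C0 (dyad_gt0 R k) ltr01 (HC k).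
Qed.

Lemma conv_kap_bounded p f k : (0 < p)%N -> Lp p f ->
  exists2 M : R, 0 <= M & forall x, `|conv (kap k) f x| <= M.
Proof.
move=> p0 fp; have [C C0 HC] := kap_bound Hphi.
eexists; last first.
  by move=> x; have [_] := conv_Lp p0 fp x (mkap k) C0 (dyad_gt0 R k) ltr01 (HC k); exact.
rewrite mulr_ge0// addr_ge0 ?mulr_ge0 ?pi_ge0 ?invr_ge0 ?exprn_ge0 ?dyad_ge0//.
exact: (Lp_mass_ge0 p f).
Qed.

Lemma conv_kap_low p f x : (0 < p)%N -> Lp p f ->
  (fun n : nat => conv (kap (- n%:Z)) f x) @ \oo --> 0.
Proof.
move=> p0 fp; have [C C0 HC] := kap_bound Hphi.
have S0 := Lp_mass_ge0 p f; set S := Rint _ in S0.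
apply/cvgrPdist_le => e e0.
pose d := e / (2 * (C + 1) * pi).
have d0 : 0 < d by rewrite divr_gt0// !mulr_gt0 ?pi_gt0// ltr_wpDl.
pose A := C * (d ^- p.-1 * S).
have A0 : 0 <= A by rewrite !mulr_ge0// invr_ge0 exprn_ge0// ltW.
have I0 : 0 < (2 * A / e + 1)^-1.
  by rewrite invr_gt0 ltr_wpDl// divr_ge0 ?(ltW e0)// mulr_ge0.
have [K _ HK] := near_infty_natSinv_expn_lt (PosNum I0).
exists K => // n Kn /=; rewrite sub0r normrN.
have [_] := conv_Lp p0 fp x (mkap (- n%:Z)) C0 (dyad_gt0 R _) d0 (HC _) => H.
apply: (le_trans H); rewrite -/S.
have -> : dy (- n%:Z) = 2 ^- n by rewrite /dyad exprnN.
have := HK n Kn; rewrite /= div1r => {}HK.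
have h1 : C * (d * pi) <= e / 2.
  have c1 : 0 < C + 1 by rewrite ltr_wpDl.
  have -> : e / 2 = (C + 1) * (d * pi).
    rewrite /d; have : pi != 0 :> R by rewrite gt_eqF// pi_gt0.
    by move: (pi : R) => c c0; field; rewrite c0 gt_eqF.
  by apply: ler_wpM2r; [rewrite mulr_ge0 ?pi_ge0// ltW|lra].
have h2 : A * 2 ^- n <= e / 2.
  have X0 : 0 <= 2 * A / e by rewrite divr_ge0 ?(ltW e0)// mulr_ge0.
  move: HK; rewrite -[X in _ < X]div1r ltr_pdivlMr ?ltr_wpDl// => HK.
  have t0 : 0 < 2 ^- n :> R by rewrite invr_gt0 exprn_gt0.
  have : 2 ^- n * (2 * A / e) <= 1 by nra.
  by rewrite mulrA ler_pdivrMr//; lra.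
by rewrite mulrDr; move: h1 h2; rewrite /A; lra.
Qed.

(** The kernel has integral 1, so the error is its integral against f(y) - f(x), dominated by the
    Lorentzian average at a Lebesgue point. *)
Lemma conv_kap_ae p f : (0 < p)%N -> Lp p f ->
  {ae mu, forall x, (fun n : nat => conv (kap n%:Z) f x) @ \oo --> f x}.
Proof.
move=> p0 fp; have [C C0 HC] := kap_bound Hphi.
have H0 := lebesgue_differentiation (Lp_locally_integrable p0 fp).
apply: ae_imp H0 => x lx; have [mf _] := fp.
have [li _] := lor_Lp p0 fp x (ltr01 : 0 < 1 :> R) (ltr01 : 0 < 1 :> R).
have H := lebesgue_pt_lor mf li lx.
apply/subr_cvg0 => //; apply/norm_cvg0P.
have HCn : (fun n : nat => C * Rint (fun y : R => lor (2 ^+ n) (x - y) * `|f y - f x|)) @ \oo --> 0.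
  by rewrite -[X in _ --> X](mulr0 C); apply: cvgMr.
apply: (squeeze_cvgr _ (cvg_cst 0) HCn).
apply: nearW => n; rewrite normr_ge0/=.
have ik := integrableR_subl x (integrable_kap Hphi n%:Z).
have icf := conv_kap_integrable n%:Z x p0 fp.
have N1 : 1 <= 2 ^+ n :> R by rewrite exprn_ege1// ler1n.
have -> : conv (kap n%:Z) f x - f x =
    Rint (fun y : R => kap n%:Z (x - y) * f y - f x * kap n%:Z (x - y)).
  by rewrite RintB ?RintZl ?Rint_subl ?Rint_kap ?mulr1//; exact: integrableRZl.
have il := integrable_lor_dev mf li N1.
rewrite -RintZl//; apply: normr_Rint_dom.
- apply: measurable_funB; first exact: conv_arg_measurable.
  apply: measurable_funM => //; apply: measurableT_comp => //; exact: measurable_subl.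
- exact: integrableRZl.
- by move=> y; rewrite mulrC -mulrBl normrM mulrC mulrA ler_wpM2r// HC.
Qed.

(** For j < L the symbol of [kap j] lives where that of [kap L] equals 1. Writing [kap j] as an
    integral of cosines, [kap L] acts on each by its symbol. *)
Lemma conv_conv_kap j L (x : R) : (j < L)%R -> conv (kap L) (kap j) x = kap j x.
Proof.
move=> jL; have [C C0 HC] := kap_bound Hphi.
have [r0 Ca oi] := symb_kap Hphi j; have ai := Cc_integrable r0 Ca; have ma := Cc_measurable Ca.
have E (y : R) : kap L (x - y) * kap j y =
    Rint (fun e => (2 * pi)^-1 * (kap L (x - y) * (cos (y * e + 0) * phi (e / dy j)))).
  rewrite RintZl; last by apply: integrableRZl; exact: integrable_osc_integrand.
  rewrite RintZl; last exact: integrable_osc_integrand.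
  by rewrite [kap j y]kapE; ring.
rewrite /conv (eq_Rint E).
rewrite (Rint_Fubini (a := fun y : R => (2 * pi)^-1 * `|kap L (x - y)|)
  (b := fun _ e => `|phi (e / dy j)|) (M := Rint (fun e => `|phi (e / dy j)|))).
- have jL2 (e : R) : phi (e / dy j) * phi (e / dy L) = phi (e / dy j).
    have [ej|ej] := leP (2 * dy j) `|e|; first by rewrite Ca.2// mul0r.
    rewrite [X in _ * X]phi1 ?mulr1// normrM normfV (ger0_norm (dyad_ge0 R L)).
    rewrite ler_pdivrMr ?dyad_gt0// mul1r (le_trans (ltW ej))//.
    by rewrite -[2 * _](dyadD R 1 j) dyad_le// addrC lezD1.
  rewrite [RHS]kapE -[RHS]RintZl; last exact: integrable_osc_integrand.
  apply: eq_Rint => e.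
  transitivity (Rint (fun y => ((2 * pi)^-1 * phi (e / dy j)) * (kap L (x - y) * cos (y * e + 0)))).
    by apply: eq_Rint => y; ring.
  rewrite RintZl; first by rewrite Rint_kap_cos// -{2}jL2; ring.
  apply: (integrableR_dom (g := fun y => `|kap L (x - y)|)).
  + apply: conv_arg_measurable => //; apply: measurable_cos_affine.
    by apply: measurable_funD => //; exact: measurable_funM.
  + by apply: integrableR_norm; apply: integrableR_subl; exact: integrable_kap.
  + by move=> y; rewrite mulrC norm_cos_le.
- apply: measurable_funM => //; apply: measurable_funM; last exact: (measurable_osc_integrand2 0 ma).
  by apply: measurableT_comp => //; exact: measurable_funB.
- by apply: integrableRZl; apply: integrableR_norm; apply: integrableR_subl; exact: integrable_kap.
- by move=> y; rewrite mulr_ge0// invr_ge0 mulr_ge0// pi_ge0.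
- by move=> _; exact: measurableT_comp.
- by [].
- by move=> _; rewrite EFin_Rint//; exact: integrableR_norm.
- move=> y e; rewrite !normrM -!mulrA ger0_norm ?invr_ge0 ?mulr_ge0 ?pi_ge0//.
  by rewrite ler_wpM2l ?invr_ge0 ?mulr_ge0 ?pi_ge0// ler_wpM2l// -normrM norm_cos_le.
Qed.

(** Fubini moves the outer kernel onto the inner one, where [conv_conv_kap] applies; no transform of
    f is needed. *)
Lemma conv_conv p f j L x : (0 < p)%N -> Lp p f -> (j < L)%R ->
  conv (kap L) (conv (kap j) f) x = conv (kap j) f x.
Proof.
move=> p0 fp jL; have [C C0 HC] := kap_bound Hphi.
have mf := fp.1.
have E (y : R) : kap L (x - y) * conv (kap j) f y =
    Rint (fun z => kap L (x - y) * (kap j (y - z) * f z)).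
  by rewrite RintZl//; exact: conv_kap_integrable p0 fp.
rewrite {1}/conv (eq_Rint E).
have S0 := Lp_mass_ge0 p f; set S := Rint _ in S0.
rewrite (Rint_Fubini (a := fun y : R => `|kap L (x - y)|)
  (b := fun y z => `|kap j (y - z) * f z|)
  (M := C * (1 * pi + 1 ^- p.-1 * dy j * S))).
- apply: eq_Rint => z.
  transitivity (Rint (fun y => f z * (kap L (x - y) * kap j (y - z)))).
    by apply: eq_Rint => y; ring.
  rewrite RintZl; last first.
    have [C' C0' HC'] := kap_bound Hphi.
    apply: (integrableR_dom (g := fun y => C' * dy j * `|kap L (x - y)|)).
    + apply: conv_arg_measurable => //.
      by apply: measurableT_comp => //; exact: measurable_funB.
    + by apply: integrableRZl; apply: integrableR_norm; apply: integrableR_subl; exact: integrable_kap.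
    + move=> y; rewrite normrM mulrC ler_wpM2r// (le_trans (HC' _ _))// ler_wpM2l//.
      by rewrite lor_le// dyad_ge0.
  rewrite mulrC; congr (_ * _).
  rewrite -(conv_conv_kap (x - z) jL) /conv.
  have m2 : measurable_fun setT (fun y : R => kap L (x - z - y) * kap j y).
    exact: conv_arg_measurable.
  rewrite -(Rint_shift (- z) m2); apply: eq_Rint => y.
  by congr (kap _ _ * _); ring.
- apply: measurable_funM.
    by apply: measurableT_comp => //; exact: measurable_funB.
  apply: measurable_funM; last exact: measurableT_comp.
  by apply: measurableT_comp => //; exact: measurable_funB.
- by apply: integrableR_norm; apply: integrableR_subl; exact: integrable_kap.
- by [].
- by move=> y; apply: measurableT_comp => //; exact: conv_arg_measurable.
- by [].
- move=> y.
  have [i1 _] := conv_Lp p0 fp y (mkap j) C0 (dyad_gt0 R j) ltr01 (HC j).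
  have [i2 I2] := lor_Lp p0 fp y (dyad_gt0 R j) ltr01.
  rewrite EFin_Rint; last exact: integrableR_norm.
  rewrite lee_fin; apply: (@le_trans _ _ (C * Rint (fun z => lor (dy j) (y - z) * `|f z|))); last first.
    by rewrite ler_wpM2l.
  have i3 : integrableR (fun z : R => lor (dy j) (y - z) * `|f z|).
    have := integrableR_norm i2; congr integrableR; apply/funext => z.
    by rewrite normrM ger0_norm// lor_ge0// dyad_ge0.
  rewrite -RintZl//; apply: Rint_le => [||z].
  + exact: integrableR_norm.
  + exact: integrableRZl.
  + by rewrite normrM mulrA ler_wpM2r.
- by move=> y z; rewrite normrM.
Qed.

Definition LP (k : int) (f : R -> R) (x : R) : R := conv (kap k) f x - conv (kap (k - 1)) f x.

Lemma measurable_LP k f : measurable_fun setT f -> measurable_fun setT (LP k f).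
Proof. by move=> mf; apply: measurable_funB; exact: measurable_conv. Qed.

Lemma integrable_kap_conv p f j L x : (0 < p)%N -> Lp p f ->
  integrableR (fun y : R => kap L (x - y) * conv (kap j) f y).
Proof.
move=> p0 fp; have [M M0 HM] := conv_kap_bounded j p0 fp.
apply: (integrableR_dom (g := fun y => M * `|kap L (x - y)|)).
- by apply: conv_arg_measurable => //; apply: measurable_conv => //; exact: fp.1.
- by apply: integrableRZl; apply: integrableR_norm; apply: integrableR_subl; exact: integrable_kap.
- by move=> y; rewrite normrM mulrC ler_wpM2r.
Qed.

Lemma conv_LP p f k x : (0 < p)%N -> Lp p f -> conv (kap (k + 1)) (LP k f) x = LP k f x.
Proof.
move=> p0 fp; rewrite /LP.
rewrite -(conv_conv x p0 fp (_ : k < k + 1)%R); last by rewrite ltrDl.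
rewrite -(conv_conv x p0 fp (_ : k - 1 < k + 1)%R); last by lia.
rewrite {1 4 7}/conv -RintB; [|exact: integrable_kap_conv p0 fp..].
by apply: eq_Rint => y; rewrite mulrBr.
Qed.

(** The piece is reproduced by [kap (k + 1)], and Cauchy-Schwarz leaves the integral of the squared
    kernel. As lor^2 <= N lor with N = 2^(k+1), this is at most 2 C^2 pi 2^k. An infinite L^2 norm
    is allowed. *)
Lemma Bernstein : exists2 C : R, 0 <= C & forall p f k x, (0 < p)%N -> Lp p f ->
  ((LP k f x ^+ 2)%:E <= (C * dy k)%:E * \int[mu]_y (LP k f y ^+ 2)%:E)%E.
Proof.
have [C C0 HC] := kap_bound Hphi.
exists (C ^+ 2 * 2 * pi); first by rewrite !mulr_ge0 ?sqr_ge0 ?pi_ge0.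
move=> p f k x p0 fp; have mL := measurable_LP k fp.1.
have mk : measurable_fun setT (fun y : R => kap (k + 1) (x - y)).
  by apply: measurableT_comp => //; exact: measurable_subl.
have ih : integrableR (fun y : R => kap (k + 1) (x - y) * LP k f y).
  rewrite (_ : (fun y : R => _) = fun y : R => kap (k + 1) (x - y) * conv (kap k) f y -
    kap (k + 1) (x - y) * conv (kap (k - 1)) f y); last first.
    by apply/funext => y; rewrite -mulrBr.
  by apply: integrableRB; exact: integrable_kap_conv p0 fp.
have CS := Cauchy_Schwarz_integral mk mL.
rewrite EFin_Rint in CS; last exact: integrableR_norm.
apply: (@le_trans _ _ (\int[mu]_y (kap (k + 1) (x - y) ^+ 2)%:E * \int[mu]_y (LP k f y ^+ 2)%:E)%E).
  apply: le_trans CS; rewrite -EFinM lee_fin -{1}(conv_LP k x p0 fp) -expr2.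
  rewrite -(real_normK (num_real (conv _ _ _))) lerXn2r ?nnegrE//; last exact: normr_Rint.
  by apply: Rint_ge0 => y.
apply: lee_wpmul2r; first by apply: integral_ge0 => y _; rewrite lee_fin sqr_ge0.
have L0 := dyad_gt0 R (k + 1).
have il : integrableR (fun y : R => lor (dy (k + 1)) (x - y)).
  by apply: integrableR_subl; exact: integrable_lor.
have -> : C ^+ 2 * 2 * pi * dy k = Rint (fun y : R => C ^+ 2 * dy (k + 1) * lor (dy (k + 1)) (x - y)).
  rewrite RintZl// (Rint_subl x (measurable_lor _)) Rint_lor// dyadD.
  by rewrite (_ : dy 1 = 2)//; ring.
rewrite -EFin_Rint; last exact: integrableRZl.
apply: ge0_le_integral => //.
- by move=> y _; rewrite lee_fin sqr_ge0.
- by apply/measurable_EFinP; exact: measurable_funX.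
- by apply/measurable_EFinP; apply: measurable_funM => //; exact: integrableR_measurable.
- move=> y _; rewrite lee_fin -(real_normK (num_real (kap _ _))).
  apply: (@le_trans _ _ ((C * lor (dy (k + 1)) (x - y)) ^+ 2)).
    by rewrite lerXn2r ?nnegrE// mulr_ge0// lor_ge0// ltW.
  rewrite exprMn -mulrA ler_wpM2l ?sqr_ge0// expr2 ler_wpM2r ?lor_ge0 ?(ltW L0)//.
  by apply: lor_le; exact: ltW.
Qed.

(** * Frequency supports without Fourier transforms *)

Section Vanishing.
Variables (n : int) (x : R).

(* [g] is bounded, measurable and has frequencies at distance at least [B] from the edge
   of the region seen by [ker3 n]; multiplying by a low-frequency factor shrinks [B]. *)
Definition invisible (B : R) (g : R -> R) : Prop :=
  [/\ measurable_fun setT g, (exists M : R, forall y, `|g y| <= M) &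
    forall xi th : R, `|xi| <= B ->
      Rint (fun y => ker3 n (x - y) * cos (y * xi + th) * g y) = 0].

Lemma integrable_ker3 : integrableR (fun y : R => ker3 n (x - y)).
Proof.
apply: integrableR_subl; rewrite ker3.unlock; apply: integrableRZl.
by case: (symb_ker3 Hphi n) => _ _; exact.
Qed.

Lemma integrable_ker3_bounded (g : R -> R) : measurable_fun setT g ->
  (exists M : R, forall y, `|g y| <= M) -> integrableR (fun y : R => ker3 n (x - y) * g y).
Proof.
move=> mg [M HM]; apply: (integrableR_dom (g := fun y => M * `|ker3 n (x - y)|)).
- by apply: conv_arg_measurable => //; exact: measurable_ker3.
- by apply: integrableRZl; apply: integrableR_norm; exact: integrable_ker3.
- by move=> y; rewrite normrM mulrC ler_wpM2r.
Qed.

Lemma measurable_cos_lin (a b : R) : measurable_fun setT (fun y : R => cos (y * a + b)).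
Proof. by apply: measurable_cos_affine; apply: measurable_funD => //; exact: measurable_funM. Qed.

Lemma integrable_ker3_cos (g : R -> R) (xi th : R) : measurable_fun setT g ->
  (exists M : R, forall y, `|g y| <= M) ->
  integrableR (fun y : R => ker3 n (x - y) * cos (y * xi + th) * g y).
Proof.
move=> mg [M HM].
rewrite (_ : (fun y : R => _) = fun y => ker3 n (x - y) * (cos (y * xi + th) * g y)); last first.
  by apply/funext => y; rewrite mulrA.
apply: integrable_ker3_bounded; first by apply: measurable_funM => //; exact: measurable_cos_lin.
by exists M => y; apply: le_trans (norm_cos_le _ _) (HM y).
Qed.

Lemma invisible_one : invisible (dy n / 2) (cst 1).
Proof.
split; [exact: measurable_cst|by exists 1 => y; rewrite normr1|move=> xi th H].
rewrite -[RHS](Rint_ker3_cos Hphi x th H); apply: eq_Rint => y /=.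
by rewrite mulr1.
Qed.

Lemma invisible_lin (B a b : R) (f g : R -> R) : invisible B f -> invisible B g ->
  invisible B (fun y => a * f y + b * g y).
Proof.
move=> [mf bf f0] [mg bg g0]; split.
- by apply: measurable_funD; exact: measurable_funM.
- case: bf bg => [M HM] [M' HM']; exists (`|a| * M + `|b| * M') => y.
  by rewrite (le_trans (ler_normD _ _))// !normrM lerD// ler_wpM2l.
- move=> xi th H.
  transitivity (Rint (fun y => a * (ker3 n (x - y) * cos (y * xi + th) * f y) +
                               b * (ker3 n (x - y) * cos (y * xi + th) * g y))).
    by apply: eq_Rint => y; ring.
  rewrite RintD; [|by apply: integrableRZl; exact: integrable_ker3_cos..].
  by rewrite !RintZl ?f0 ?g0 ?mulr0 ?addr0//; exact: integrable_ker3_cos.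
Qed.

(** Expand [kap K] into cosines of frequency e, only |e| < 2 * 2^K being relevant. A product of two
    cosines is a sum of cosines at xi + e and xi - e, both within the range B, so every term
    vanishes. *)
Lemma invisible_kap (B : R) (g : R -> R) (K : int) (z xi th : R) : invisible B g ->
  `|xi| <= B - 2 * dy K ->
  Rint (fun y => ker3 n (x - y) * cos (y * xi + th) * g y * kap K (y - z)) = 0.
Proof.
move=> [mg bg g0] xiB.
have [r0 Ca oi] := symb_kap Hphi K; have ai := Cc_integrable r0 Ca; have ma := Cc_measurable Ca.
pose h (y : R) := ker3 n (x - y) * cos (y * xi + th) * g y.
have ih : integrableR h by exact: integrable_ker3_cos.
have mh := integrableR_measurable ih.
have E (y : R) : h y * kap K (y - z) =
    Rint (fun e => (2 * pi)^-1 * (h y * (cos ((y - z) * e + 0) * phi (e / dy K)))).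
  rewrite RintZl; last by apply: integrableRZl; exact: integrable_osc_integrand.
  rewrite RintZl; last exact: integrable_osc_integrand.
  by rewrite kapE; ring.
rewrite (eq_Rint E).
rewrite (Rint_Fubini (a := fun y : R => (2 * pi)^-1 * `|h y|)
  (b := fun _ e => `|phi (e / dy K)|) (M := Rint (fun e => `|phi (e / dy K)|))).
- rewrite -[RHS](_ : Rint (fun=> 0 : R) = 0); last by rewrite /Rint /Rintegral integral0.
  apply: eq_Rint => e.
  have [eK|eK] := leP (2 * dy K) `|e|.
    rewrite Ca.2//; rewrite -[RHS](_ : Rint (fun=> 0 : R) = 0); last by rewrite /Rint /Rintegral integral0.
    by apply: eq_Rint => y; rewrite !mulr0.
  have xe1 : `|xi + e| <= B by rewrite (le_trans (ler_normD _ _))//; lra.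
  have xe2 : `|xi - e| <= B by rewrite (le_trans (ler_normB _ _))//; lra.
  transitivity (Rint (fun y => ((2 * pi)^-1 * phi (e / dy K) / 2) *
    (ker3 n (x - y) * cos (y * (xi + e) + (th - z * e)) * g y +
     ker3 n (x - y) * cos (y * (xi - e) + (th + z * e)) * g y))).
    apply: eq_Rint => y; rewrite /h addr0.
    have -> : y * (xi + e) + (th - z * e) = (y * xi + th) + (y - z) * e by ring.
    have -> : y * (xi - e) + (th + z * e) = (y * xi + th) - (y - z) * e by ring.
    move: (y * xi + th) ((y - z) * e) => v w; rewrite cosD cosB.
    have : pi != 0 :> R by rewrite gt_eqF// pi_gt0.
    by move: (pi : R) => c c0; field.
  rewrite RintZl; last by apply: integrableRD; exact: integrable_ker3_cos.
  by rewrite RintD ?g0 ?addr0 ?mulr0//; exact: integrable_ker3_cos.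
- apply: measurable_funM => //; apply: measurable_funM; first exact: measurableT_comp.
  apply: measurable_funM; last exact: (measurableT_comp ma measurable_snd).
  apply: measurable_cos_affine; apply: measurable_funD => //; apply: measurable_funM => //.
  exact: measurable_funB.
- by apply: integrableRZl; exact: integrableR_norm.
- by move=> y; rewrite mulr_ge0// invr_ge0 mulr_ge0// pi_ge0.
- by move=> _; exact: measurableT_comp.
- by [].
- by move=> _; rewrite EFin_Rint//; exact: integrableR_norm.
- move=> y e; rewrite normrM (ger0_norm (_ : 0 <= (2 * pi)^-1)) ?invr_ge0 ?mulr_ge0 ?pi_ge0//.
  rewrite -(mulrA (2 * pi)^-1) ler_wpM2l ?invr_ge0 ?mulr_ge0 ?pi_ge0// (normrM (h y)) ler_wpM2l//.
  exact: norm_cos_le.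
Qed.

(** Fubini brings the integral over the argument z of f outside; for each z the inner integral
    vanishes by [invisible_kap]. *)
Lemma invisible_mul (B : R) (g : R -> R) (K : int) p f : (0 < p)%N -> Lp p f ->
  invisible B g -> invisible (B - 2 * dy K) (fun y => g y * conv (kap K) f y).
Proof.
move=> p0 fp ig; have [mg bg g0] := ig; have [M M0 HM] := conv_kap_bounded K p0 fp.
have mc : measurable_fun setT (conv (kap K) f) by apply: measurable_conv => //; exact: fp.1.
split; first exact: measurable_funM.
  case: bg => G HG; exists (G * M) => y.
  by rewrite normrM ler_pM.
move=> xi th xiB.
pose h (y : R) := ker3 n (x - y) * cos (y * xi + th) * g y.
have ih : integrableR h by exact: integrable_ker3_cos.
have mh := integrableR_measurable ih.
have E (y : R) : ker3 n (x - y) * cos (y * xi + th) * (g y * conv (kap K) f y) =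
    Rint (fun z => h y * (kap K (y - z) * f z)).
  by rewrite RintZl; [rewrite /h /conv mulrA|exact: conv_kap_integrable p0 fp].
rewrite (eq_Rint E).
have [C C0 HC] := kap_bound Hphi.
have S0 := Lp_mass_ge0 p f; set S := Rint (fun y => _ ^+ p) in S0.
rewrite (Rint_Fubini (a := fun y : R => `|h y|)
  (b := fun y z => `|kap K (y - z) * f z|)
  (M := C * (1 * pi + 1 ^- p.-1 * dy K * S))).
- rewrite -[RHS](_ : Rint (fun=> 0 : R) = 0); last by rewrite /Rint /Rintegral integral0.
  apply: eq_Rint => z.
  transitivity (Rint (fun y => f z * (h y * kap K (y - z)))).
    by apply: eq_Rint => y; ring.
  rewrite RintZl.
    by rewrite /h (invisible_kap z th ig xiB) mulr0.
  apply: (integrableR_dom (g := fun y => C * dy K * `|h y|)).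
  + apply: measurable_funM => //; apply: measurableT_comp => //; exact: measurable_funB.
  + by apply: integrableRZl; exact: integrableR_norm.
  + move=> y; rewrite normrM mulrC ler_wpM2r// (le_trans (HC _ _))// ler_wpM2l//.
    by rewrite lor_le// dyad_ge0.
- apply: measurable_funM; first exact: measurableT_comp.
  apply: measurable_funM; last by apply: measurableT_comp => //; exact: fp.1.
  by apply: measurableT_comp => //; exact: measurable_funB.
- exact: integrableR_norm.
- by [].
- by move=> y; apply: measurableT_comp => //; apply: conv_arg_measurable => //; exact: fp.1.
- by [].
- move=> y.
  have [i1 _] := conv_Lp p0 fp y (mkap K) C0 (dyad_gt0 R K) ltr01 (HC K).
  have [i2 I2] := lor_Lp p0 fp y (dyad_gt0 R K) ltr01.
  rewrite EFin_Rint; last exact: integrableR_norm.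
  rewrite lee_fin; apply: (@le_trans _ _ (C * Rint (fun z => lor (dy K) (y - z) * `|f z|))); last first.
    by rewrite ler_wpM2l.
  have i3 : integrableR (fun z : R => lor (dy K) (y - z) * `|f z|).
    have := integrableR_norm i2; congr integrableR; apply/funext => z.
    by rewrite normrM ger0_norm// lor_ge0// dyad_ge0.
  rewrite -RintZl//; apply: Rint_le => [||z].
  + exact: integrableR_norm.
  + exact: integrableRZl.
  + by rewrite normrM mulrA ler_wpM2r.
- by move=> y z; rewrite normrM.
Qed.

Lemma invisible_ker3 (B : R) (g : R -> R) : 0 <= B -> invisible B g ->
  Rint (fun y => ker3 n (x - y) * g y) = 0.
Proof.
move=> B0 [_ _ g0]; rewrite -[RHS](g0 0 0); last by rewrite normr0.
by apply: eq_Rint => y; rewrite mulr0 add0r cos0 mulr1.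
Qed.

End Vanishing.

End KernelConvolution.

(** * Dyadic sums *)

Section DyadicSums.
Variable R : realType.
Local Notation mu := (@lebesgue_measure R).
Local Notation dy := (dyad R).

Lemma geom_bilateral (rho : R) (n : nat) (d : int) : 0 < rho -> rho < 1 ->
  \sum_(i < n) rho ^+ `|(d - i%:Z)%R|%N <= 2 / (1 - rho).
Proof.
move=> r0 r1; have q0 : 0 < 1 - rho by rewrite subr_gt0.
have Hneg m (e : nat) : \sum_(i < m) rho ^+ `|(- e%:Z - i%:Z)%R|%N <= rho ^+ e / (1 - rho).
  have -> : \sum_(i < m) rho ^+ `|(- e%:Z - i%:Z)%R|%N = rho ^+ e * \sum_(i < m) rho ^+ i.
    rewrite mulr_sumr; apply: eq_bigr => i _; rewrite -exprD; congr (_ ^+ _); lia.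
  rewrite ler_wpM2l ?exprn_ge0 ?(ltW r0)// -[leRHS]mul1r ler_pdivlMr//.
  rewrite mulrC -opprB mulNr -subrX1 opprB lerBlDr lerDl exprn_ge0// ltW //.
case: d => [d|d]; last first.
  rewrite NegzE; apply: le_trans (Hneg n d.+1) _.
  rewrite ler_wpM2r ?invr_ge0 ?(ltW q0)// (@le_trans _ _ 1)// ?exprn_ile1// ?(ltW r0) ?(ltW r1)//.
  by rewrite ler1n.
(* The subtracted term is what makes the induction on d close: the step amounts to rho^d (1 - rho)^2
   >= 0. *)
suff : \sum_(i < n) rho ^+ `|(d%:Z - i%:Z)%R|%N <= (2 - rho ^+ d) / (1 - rho).
  move=> H; apply: le_trans H _; rewrite ler_wpM2r ?invr_ge0 ?(ltW q0)//.
  by rewrite gerBl exprn_ge0// ltW.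
elim: d n => [|d IH] n.
  have := Hneg n 0%N; rewrite oppr0 expr0; congr (_ <= _ / _); ring.
case: n => [|n].
  rewrite big_ord0 divr_ge0 ?(ltW q0)// subr_ge0 (@le_trans _ _ 1)// ?exprn_ile1// ?(ltW r0) ?(ltW r1)//.
  by rewrite ler1n.
rewrite big_ord_recl.
have -> : \sum_(i < n) rho ^+ `|(d.+1%:Z - (lift ord0 i)%:Z)%R|%N = \sum_(i < n) rho ^+ `|(d%:Z - i%:Z)%R|%N.
  by apply: eq_bigr => i _; congr (_ ^+ _); rewrite lift0; lia.
have := IH n; rewrite !ler_pdivlMr// => {}IH.
have E : rho ^+ d.+1 = rho * rho ^+ d by rewrite exprS.
have X0 : 0 <= rho ^+ d by rewrite exprn_ge0// ltW.
rewrite (_ : `|(d.+1%:Z - (ord0 : 'I_n.+1)%:Z)%R|%N = d.+1); last by rewrite subr0.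
move: IH; rewrite E; set X := rho ^+ d in X0 *; set T := \sum_(i < n) _.
by have := mulr_ge0 X0 (sqr_ge0 (1 - rho)); lra.
Qed.

Lemma dyad_expR (k : int) : dy k = expR (k%:~R * ln 2).
Proof.
have l2 : expR (ln (2 : R)) = 2 by rewrite lnK// posrE.
case: k => n; first by rewrite dyad_nat expRM_natl l2.
by rewrite NegzE dyad_neg mulrNz mulNr expRN expRM_natl l2.
Qed.

Lemma dyad_powR (k : int) (r : R) : dy k `^ r = expR (r * (k%:~R * ln 2)).
Proof. by rewrite /powR gt_eqF ?dyad_gt0// dyad_expR expRK. Qed.

Lemma ln2_gt0 : 0 < ln (2 : R).
Proof. by rewrite ln_gt0// ltr1n. Qed.

Lemma int_le_nat (k L : int) : (k <= L)%R ->
  exists d : nat, L = (k + d%:Z)%R /\ `|(L - k)%R|%N = d.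
Proof. by move=> kL; exists `|(L - k)%R|%N; split => //; lia. Qed.

Lemma int_lt_nat (k L : int) : (L < k)%R ->
  exists d : nat, k = (L + d%:Z + 1)%R /\ `|(L - k)%R|%N = d.+1.
Proof. by move=> kL; exists `|(k - L - 1)%R|%N; split => //; lia. Qed.

(** The bounds 2^(k/p) and (2^(-k(1 - 4/p)) Q)^(1/4) cross at 2^k = Q with value Q^(1/p), and decay
    geometrically away from the crossing, at the rates [b] below it and [al] above it. The
    hypothesis on p makes [al] positive. *)
Lemma interpolated_sum (p : nat) : (5 <= p)%N -> exists2 C : R, 0 <= C &
  forall (a : int -> R) (Q : R), 0 <= Q -> (forall k, 0 <= a k) ->
    (forall k, a k <= dy k `^ p%:R^-1) ->
    (forall k, dy k `^ (1 - 4 / p%:R) * a k ^+ 4 <= Q) ->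
    forall K n, \sum_(i < n) a (K - i%:Z)%R <= C * Q `^ p%:R^-1.
Proof.
move=> p5.
pose b : R := p%:R^-1; pose al : R := 4^-1 - b.
have p0 : 0 < p%:R :> R by rewrite ltr0n; lia.
have b0 : 0 < b by rewrite invr_gt0.
have al0 : 0 < al by rewrite subr_gt0 ltf_pV2 ?posrE// ltr_nat.
(* The slower rate serves both sides; one factor rho^-1 pays for rounding the crossing to an
   integer. *)
pose c := Num.min b al; have c0 : 0 < c by rewrite lt_min b0.
have cb : c <= b by rewrite ge_min lexx.
have cal : c <= al by rewrite ge_min lexx orbT.
have l0 := ln2_gt0; set l := ln 2 in l0.
pose rho : R := expR (- (c * l)).
have rho0 : 0 < rho by rewrite expR_gt0.
have rho1 : rho < 1 by rewrite -expR0 ltr_expR oppr_lt0 mulr_gt0.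
exists (rho^-1 * (2 / (1 - rho))).
  by rewrite mulr_ge0 ?invr_ge0 ?(ltW rho0)// divr_ge0// subr_ge0 ltW.
(* When Q = 0 there is no crossing, but the second bound forces every a k to vanish. *)
move=> a Q; rewrite le_eqVlt => /predU1P[<-|Q0] a0 a1 a4 K n.
  rewrite powR0 ?invr_eq0 ?gt_eqF// mulr0 big1// => i _.
  have := a4 (K - i%:Z)%R; rewrite pmulr_rle0 ?powR_gt0 ?dyad_gt0// => H.
  have : a (K - i%:Z)%R ^+ 4 == 0 by rewrite eq_le H exprn_ge0.
  by rewrite expf_eq0 => /eqP.
pose q := ln Q.
have Qq : Q = expR q by rewrite lnK.
pose L := Num.floor (q / l).
have L1 : L%:~R * l <= q by rewrite -ler_pdivlMr//; exact: Num.Theory.ge_floor.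
have L2 : q <= (L%:~R + 1) * l.
  rewrite -ler_pdivrMr// ltW//; have := Num.Theory.floorD1_gt (q / l).
  by rewrite intrD.
have key k : a k <= expR (q * b) * (rho^-1 * rho ^+ `|(L - k)%R|%N).
  rewrite /rho -expRN -expRM_natl -!expRD.
  have [kL|kL] := leP k L.
    have [d [Lk ->]] := int_le_nat kL.
    have dE : L%:~R = k%:~R + d%:R :> R by rewrite Lk intrD.
    apply: (le_trans (a1 k)); rewrite dyad_powR ler_expR -/l -/b.
    have d0 : 0 <= d%:R :> R by rewrite ler0n.
    have h1 : d%:R * (c * l) <= d%:R * (b * l) by rewrite ler_wpM2l// ler_wpM2r// ltW.
    have h2 : b * (L%:~R * l) <= b * q by rewrite ler_wpM2l// ltW.
    have h3 : 0 <= c * l by rewrite mulr_ge0// ltW.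
    by move: h2; rewrite dE; lra.
  have [d [Lk ->]] := int_lt_nat kL.
  have dE : k%:~R = L%:~R + d%:R + 1 :> R by rewrite Lk !intrD.
  have := a4 k; rewrite dyad_powR Qq -/l => H4.
  have {}H4 : a k ^+ 4 <= expR ((q - (1 - 4 * b) * (k%:~R * l)) / 4) ^+ 4.
    rewrite -expRM_natl mulrC divfK// expRB ler_pdivlMr ?expR_gt0//.
    by rewrite mulrC.
  have {}H4 : a k <= expR ((q - (1 - 4 * b) * (k%:~R * l)) / 4).
    by move: H4; rewrite ler_pXn2r// nnegrE ?expR_ge0.
  apply: (le_trans H4); rewrite ler_expR -[d.+1%:R]natr1.
  have d0 : 0 <= d%:R :> R by rewrite ler0n.
  have h1 : d%:R * (c * l) <= d%:R * (al * l) by rewrite ler_wpM2l// ler_wpM2r// ltW.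
  have h2 : al * q <= al * ((L%:~R + 1) * l) by rewrite ler_wpM2l// ltW.
  by move: h1 h2; rewrite dE /al; lra.
have E : Q `^ p%:R^-1 = expR (q * b).
  by rewrite /powR gt_eqF// mulrC.
rewrite E mulrC.
apply: (@le_trans _ _ (\sum_(i < n) expR (q * b) * (rho^-1 * rho ^+ `|((K - L) - i%:Z)%R|%N))).
  apply: ler_sum => i _; apply: (le_trans (key _)).
  by rewrite (_ : (K - L - i%:Z)%R = - (L - (K - i%:Z))%R) ?abszN//; ring.
rewrite -mulr_sumr ler_wpM2l ?expR_ge0// -mulr_sumr ler_wpM2l ?invr_ge0 ?(ltW rho0)//.
exact: geom_bilateral.
Qed.

Local Open Scope ereal_scope.

(** The enumeration 0, -1, 1, -2, ..., which turns sums over the integers into series. *)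
Definition int_of_nat (n : nat) : int := if odd n then Negz n./2 else Posz n./2.

Lemma int_of_nat_bij : set_bij [set: nat] [set: int] int_of_nat.
Proof.
split=> //.
- move=> i j _ _; rewrite /int_of_nat.
  have Hi := odd_double_half i; have Hj := odd_double_half j.
  by case: (odd i) Hi; case: (odd j) Hj => //= Hj Hi [] E; rewrite -Hi -Hj E.
- move=> [k|k] _.
    by exists k.*2 => //; rewrite /int_of_nat odd_double doubleK.
  by exists k.*2.+1 => //; rewrite /int_of_nat /= odd_double /= uphalf_double.
Qed.

Lemma esum_int (f : int -> \bar R) : (forall k, 0 <= f k) ->
  \esum_(k in [set: int]) f k = \sum_(n <oo) f (int_of_nat n).
Proof.
move=> f0; rewrite (reindex_esum [set: nat] [set: int] int_of_nat)//; last exact: int_of_nat_bij.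
by rewrite nneseries_esumT.
Qed.

Lemma esum_int_shift (c : int) (f : int -> \bar R) :
  \esum_(k in [set: int]) f (k + c)%R = \esum_(k in [set: int]) f k.
Proof.
rewrite [RHS](reindex_esum [set: int] [set: int] (fun k => k + c)%R)//.
split=> //; first by move=> x y _ _ /addIr.
by move=> x _; exists (x - c)%R => //; rewrite subrK.
Qed.

Lemma esum_int_ge (f : int -> \bar R) (j : int) : (forall k, 0 <= f k) ->
  f j <= \esum_(k in [set: int]) f k.
Proof.
move=> f0; apply: esum_ge; exists [set j]; first by split.
by rewrite fsbig_set1.
Qed.

Lemma ge0_integral_esum_int (f : int -> R -> \bar R) :
  (forall k, measurable_fun setT (f k)) -> (forall k x, 0 <= f k x) ->
  \int[mu]_x (\esum_(k in [set: int]) f k x) = \esum_(k in [set: int]) \int[mu]_x f k x.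
Proof.
move=> mf f0; rewrite esum_int; last by move=> k; exact: integral_ge0.
under eq_integral => x _ do rewrite esum_int//.
by rewrite integral_nneseries// => n; exact: mf.
Qed.

Lemma measurable_esum_int d (T : measurableType d) (f : int -> T -> \bar R) :
  (forall k, measurable_fun setT (f k)) -> (forall k x, 0 <= f k x) ->
  measurable_fun setT (fun x => \esum_(k in [set: int]) f k x).
Proof.
move=> mf f0; under eq_fun do rewrite esum_int//.
by apply: ge0_emeasurable_sum.
Qed.

Lemma esumZ_int (c : R) (f : int -> \bar R) : (0 <= c)%R -> (forall k, 0 <= f k) ->
  \esum_(k in [set: int]) (c%:E * f k) = c%:E * \esum_(k in [set: int]) f k.
Proof.
move=> c0 f0; rewrite !esum_int//; last by move=> k; rewrite mule_ge0.
by rewrite nneseriesZl// => n _; exact: f0.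
Qed.

Lemma nneseries_half (S : \bar R) : 0 <= S -> \sum_(i <oo) ((2 ^- i.+1)%:E * S) = S.
Proof.
have H : \sum_(i <oo) ((2 ^- i.+1)%:E : \bar R) = 1.
  have := @cvg_geometric_eseries_half R 1 0; rewrite expr0 divr1 => /cvg_lim => H.
  rewrite -[RHS]H//; apply: congr_lim; apply/funext => n; apply: eq_bigr => i _.
  by rewrite addn1 div1r natrX.
case: S => [r| |//] r0; last first.
  apply/eqP; rewrite eq_le leey /=; apply: le_trans (nneseries_lim_ge 1 _).
    by rewrite big_nat1 gt0_muley// lte_fin invr_gt0 exprn_gt0.
  by move=> i _; rewrite mule_ge0// lee_fin invr_ge0 exprn_ge0.
under eq_eseriesr do rewrite muleC.
by rewrite nneseriesZl ?H ?mule1// => i _; rewrite lee_fin invr_ge0 exprn_ge0.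
Qed.

(* The weight 2 ^ i is beaten by the decay 2 ^ (- (2 s + 3) i). *)
Lemma esum_tail (s : R) (J : nat) (x : int -> R) : (0 <= s)%R ->
  \esum_(n in [set: int]) (((dy n `^ s) ^+ 2 * dy n ^+ 3)%:E *
    (\sum_(i <oo) (2 ^+ i.+1 * dy (n - J%:Z + i.+1%:Z)%R ^- 3 * x (n - J%:Z + i.+1%:Z)%R ^+ 2)%:E)) <=
  (((2 ^+ J) `^ s) ^+ 2 * (2 ^+ J) ^+ 3)%:E *
    \esum_(k in [set: int]) ((dy k `^ s) ^+ 2 * x k ^+ 2)%:E.
Proof.
move=> s0.
have A0 n : (0 <= (dy n `^ s) ^+ 2 * dy n ^+ 3)%R by rewrite mulr_ge0 ?sqr_ge0// exprn_ge0// dyad_ge0.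
have B0 k i : (0 <= 2 ^+ i.+1 * dy k ^- 3 * x k ^+ 2)%R.
  by rewrite mulr_ge0 ?sqr_ge0// mulr_ge0 ?exprn_ge0// invr_ge0 exprn_ge0// dyad_ge0.
set S := \esum_(k in [set: int]) ((dy k `^ s) ^+ 2 * x k ^+ 2)%:E.
have S0 : 0 <= S by apply: esum_ge0 => k _; rewrite lee_fin mulr_ge0 ?sqr_ge0.
set c : R := (((2 ^+ J) `^ s) ^+ 2 * (2 ^+ J) ^+ 3)%R.
have c0 : (0 <= c)%R by rewrite mulr_ge0 ?sqr_ge0// !exprn_ge0.
rewrite esum_int; last first.
  move=> n; rewrite mule_ge0 ?lee_fin//; apply: nneseries_ge0 => i _ _; by rewrite lee_fin.
under eq_eseriesr => n _ do (rewrite -nneseriesZl; last by move=> i _; rewrite lee_fin).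
rewrite nneseries_interchange; last by move=> n i; rewrite -EFinM lee_fin mulr_ge0.
(* The right-hand side is distributed over i with weights 2^-(i+1), so that it remains to compare
   the sums over n for each fixed i. *)
rewrite -[leRHS]nneseries_half; last by rewrite mule_ge0.
apply: lee_nneseries => [i _ _|i _].
  by apply: nneseries_ge0 => n _ _; rewrite -EFinM lee_fin mulr_ge0.
rewrite -(esum_int (f := fun n => ((dy n `^ s) ^+ 2 * dy n ^+ 3)%:E *
  (2 ^+ i.+1 * dy (n - J%:Z + i.+1%:Z)%R ^- 3 * x (n - J%:Z + i.+1%:Z)%R ^+ 2)%:E)); last first.
  by move=> n; rewrite -EFinM lee_fin mulr_ge0.
rewrite -(esum_int_shift (J%:Z - i.+1%:Z)%R).
rewrite muleA -EFinM -esumZ_int; last 2 first.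
- by rewrite mulr_ge0// invr_ge0 exprn_ge0.
- by move=> k; rewrite lee_fin mulr_ge0 ?sqr_ge0.
apply: le_esum => k _.
rewrite (_ : (k + (J%:Z - i.+1%:Z) - J%:Z + i.+1%:Z)%R = k); last by ring.
rewrite -!EFinM lee_fin !dyadD dyad_neg dyad_nat.
set P : R := (dy k `^ s)%R.
have dk0 := dyad_gt0 R k.
have p0 : (0 < 2 ^+ J :> R)%R by rewrite exprn_gt0.
have q0 : (0 < 2 ^+ i.+1 :> R)%R by rewrite exprn_gt0.
have q1 : (1 <= 2 ^+ i.+1 :> R)%R by rewrite exprn_ege1// ler1n.
rewrite !powRM ?mulr_ge0 ?invr_ge0 ?exprn_ge0 ?dyad_ge0//.
set q : R := (2 ^+ i.+1)%R in q0 q1 *; set p : R := (2 ^+ J)%R in p0 c c0 *.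
have qs : (0 <= q^-1 `^ s <= 1)%R.
  rewrite powR_ge0 /= -(powRr0 q^-1) ger_powR// invr_gt0 q0 invf_le1//.
have -> : ((P * (p `^ s * q^-1 `^ s)) ^+ 2 * (dy k * (p * q^-1)) ^+ 3 * (q * dy k ^- 3 * x k ^+ 2) =
  (q^-1 `^ s) ^+ 2 * q^-1 * (q^-1 * c * (P ^+ 2 * x k ^+ 2)))%R.
  by rewrite /c; field; rewrite !gt_eqF.
have W0 : (0 <= q^-1 * c * (P ^+ 2 * x k ^+ 2))%R.
  apply: mulr_ge0; apply: mulr_ge0; rewrite ?sqr_ge0//.
  by rewrite invr_ge0 ltW.
rewrite -[leRHS]mul1r ler_wpM2r// mulr_ile1 ?sqr_ge0 ?invr_ge0 ?(ltW q0) ?invf_le1//.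
by move/andP: qs => [qs0 qs1]; rewrite exprn_ile1.
Qed.

End DyadicSums.

(** * Telescoping over frequencies *)

Lemma int_reach_up (K : int) (N : nat) :
  exists n M : nat, (K + n%:Z)%R = M%:Z /\ (N <= M)%N.
Proof. by exists (N + `|K|)%N, `|(K + (N + `|K|)%N%:Z)%R|%N; lia. Qed.

Lemma int_reach_down (K : int) (N : nat) :
  exists2 M : nat, (K - (N + `|K|)%N%:Z)%R = (- M%:Z)%R & (N <= M)%N.
Proof. by exists `|(K - (N + `|K|)%N%:Z)%R|%N; lia. Qed.

Section ComplexSequences.
Variable R : realType.
Local Notation C := R[i].
Implicit Types z w : C.

Lemma cabsE z : cabs z = ComplexField.Normc.normc z.
Proof. by case: z. Qed.

Lemma cabs_ge0 z : 0 <= cabs z.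
Proof. exact: sqrtr_ge0. Qed.

Lemma cabs0 : cabs (0 : C) = 0.
Proof. by rewrite cabsE ComplexField.Normc.normc0. Qed.

Lemma cabs1 : cabs (1 : C) = 1.
Proof. by rewrite cabsE ComplexField.Normc.normc1. Qed.

Lemma cabsM z w : cabs (z * w) = cabs z * cabs w.
Proof. by rewrite !cabsE ComplexField.Normc.normcM. Qed.

Lemma cabsJ z : cabs (conjc z) = cabs z.
Proof. by case: z => a b; rewrite /cabs /= sqrrN. Qed.

Lemma sqr_cabs z : cabs z ^+ 2 = complex.Re z ^+ 2 + complex.Im z ^+ 2.
Proof. by rewrite sqr_sqrtr// addr_ge0 ?sqr_ge0. Qed.

Lemma cabsD z w : cabs (z + w) <= cabs z + cabs w.
Proof.
have := ler_normD z w; rewrite !normc_def -!raddfD /=.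
by rewrite lecR.
Qed.

Lemma cabsN z : cabs (- z) = cabs z.
Proof. by case: z => a b; rewrite /cabs /= !sqrrN. Qed.

Lemma cabs_sum n (f : 'I_n -> C) : cabs (\sum_(i < n) f i) <= \sum_(i < n) cabs (f i).
Proof.
elim/big_ind2: _ => [||i _] //; first by rewrite cabs0.
by move=> a b c d H1 H2; apply: le_trans (cabsD _ _) _; exact: lerD.
Qed.

Lemma cabs_prod n (f : 'I_n -> C) : cabs (\prod_(i < n) f i) = \prod_(i < n) cabs (f i).
Proof. by elim/big_ind2: _ => [|a b c d <- <-|//]; rewrite ?cabs1 ?cabsM. Qed.

Lemma norm_Re_le z : `|complex.Re z| <= cabs z.
Proof. by rewrite -(sqrtr_sqr (complex.Re z)) ler_wsqrtr// lerDl sqr_ge0. Qed.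

Lemma norm_Im_le z : `|complex.Im z| <= cabs z.
Proof. by rewrite -(sqrtr_sqr (complex.Im z)) ler_wsqrtr// lerDr sqr_ge0. Qed.

Lemma cabs_le_ReIm z : cabs z <= `|complex.Re z| + `|complex.Im z|.
Proof.
rewrite -(@ger0_norm _ (`|complex.Re z| + `|complex.Im z|)) ?addr_ge0//.
rewrite -sqrtr_sqr ler_wsqrtr// sqrrD !real_normK ?num_real//.
by rewrite lerD2r lerDl mulrn_wge0// mulr_ge0.
Qed.

Variables (L : int -> C) (z : C).
Hypothesis Ltop : forall e : R, 0 < e -> exists N : nat, forall n : nat, (N <= n)%N ->
  cabs (z - L n%:Z) < e.

Lemma telescope_down (K : int) (n : nat) :
  L K - L (K - n%:Z) = \sum_(i < n) (L (K - i%:Z) - L (K - i%:Z - 1)).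
Proof.
elim: n => [|n IH]; first by rewrite big_ord0 subr0 subrr.
rewrite big_ord_recr /= -IH addrA subrK; congr (_ - L _).
by rewrite -addn1 PoszD opprD addrA.
Qed.

Lemma telescope_up (K : int) (n : nat) :
  L (K + n%:Z) - L K = \sum_(i < n) (L (K + i.+1%:Z) - L (K + i.+1%:Z - 1)).
Proof.
elim: n => [|n IH]; first by rewrite big_ord0 addr0 subrr.
rewrite big_ord_recr /= -IH.
rewrite (_ : K + n.+1%:Z - 1 = K + n%:Z); last by rewrite -addn1 PoszD addrA addrK.
by rewrite [RHS]addrC addrA subrK.
Qed.

Let U k := cabs (L k - L (k - 1)).

(** Downwards, L tends to 0, so L K is up to e a finite sum of differences; upwards, z is the limit
    of the L K, which inherit the bound. *)
Lemma telescope_bound (b : R) :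
  (forall e : R, 0 < e -> exists N : nat, forall n : nat, (N <= n)%N ->
    cabs (L (- n%:Z)) < e) ->
  (forall K n, \sum_(i < n) U (K - i%:Z) <= b) ->
  (forall K, cabs (L K) <= b) /\ cabs z <= b.
Proof.
move=> Lbot Ub.
have LK K : cabs (L K) <= b.
  apply/ler_addgt0Pr => e e0; have [N HN] := Lbot e e0.
  pose n := (N + `|K|)%N.
  have [M EM NM] : exists2 M : nat, K - n%:Z = - M%:Z & (N <= M)%N.
    exact: int_reach_down.
  have := telescope_down K n; rewrite EM => E.
  rewrite -[L K](subrK (L (- M%:Z))) (le_trans (cabsD _ _))// lerD ?(ltW (HN _ NM))//.
  by rewrite E (le_trans (cabs_sum _))//; exact: Ub.
split=> //; apply/ler_addgt0Pr => e e0; have [N HN] := Ltop e0.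
rewrite -[z](subrK (L N%:Z)) (le_trans (cabsD _ _))// addrC lerD//.
by rewrite ltW// HN.
Qed.

(** Cauchy-Schwarz with the weights 2^-(i+1), whose total is at most 1. *)
Lemma Cauchy_Schwarz_half (a : nat -> R) n : (forall i, 0 <= a i) ->
  (\sum_(i < n) a i) ^+ 2 <= \sum_(i < n) 2 ^+ i.+1 * a i ^+ 2.
Proof.
move=> a0.
(* The exact partial sum 1 - 2^-n of the weights is kept so that the induction closes. *)
suff : (\sum_(i < n) a i) ^+ 2 <= (1 - 2 ^- n) * \sum_(i < n) 2 ^+ i.+1 * a i ^+ 2.
  move=> /le_trans; apply; rewrite ler_piMl//.
    by apply: sumr_ge0 => i _; rewrite mulr_ge0 ?exprn_ge0.
elim: n => [|n IH]; first by rewrite !big_ord0 expr0n mulr0.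
rewrite !big_ord_recr /=.
set S := \sum_(i < n) a i in IH *; set T := \sum_(i < n) _ in IH *.
have T0 : 0 <= T by apply: sumr_ge0 => i _; rewrite mulr_ge0 ?exprn_ge0.
have S0 : 0 <= S by apply: sumr_ge0.
rewrite (exprS 2 n); move: (a n) (a0 n) => v v0.
have q0 : 0 < 2 ^+ n :> R by rewrite exprn_gt0.
have q1 : 1 <= 2 ^+ n :> R by rewrite exprn_ege1// ler1n.
move: (2 ^+ n) q0 q1 IH => q q0 q1 IH.
set r := q^-1 in IH *.
have rq : r * q = 1 by rewrite mulVf// gt_eqF.
have r0 : 0 < r by rewrite invr_gt0.
have r1 : r <= 1 by rewrite invf_le1.
rewrite (_ : (2 * q)^-1 = r / 2); last by rewrite invfM mulrC.
(* [2 S v <= r T / 2 + 2 S^2 v^2 / (r T)], and [S^2 <= (1 - r) T] *)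
have key : 2 * S * v <= r / 2 * T + 2 * q * (1 - r) * v ^+ 2.
  have h1 : (2 * S * v) ^+ 2 <= 4 * ((1 - r) * T) * v ^+ 2.
    by rewrite !exprMn ler_wpM2r ?sqr_ge0// (_ : 2 ^+ 2 = 4 :> R) ?ler_wpM2l//; lra.
  have : 4 * ((1 - r) * T) * v ^+ 2 <= (r / 2 * T + 2 * q * (1 - r) * v ^+ 2) ^+ 2.
    rewrite -subr_ge0 (_ : _ - _ = (r / 2 * T - 2 * q * (1 - r) * v ^+ 2) ^+ 2 +
      4 * (r * q - 1) * (1 - r) * T * v ^+ 2); last by field.
    by rewrite rq subrr mulr0 !mul0r addr0 sqr_ge0.
  move=> /(le_trans h1); rewrite ler_sqr// nnegrE; first by rewrite !mulr_ge0.
  have r1' : 0 <= 1 - r by rewrite subr_ge0.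
  by have := mulr_ge0 (ltW r0) T0; have := mulr_ge0 (mulr_ge0 (ltW q0) r1') (sqr_ge0 v); lra.
rewrite sqrrD -mulr_natl mulrA.
have E : (1 - r / 2) * (T + 2 * q * v ^+ 2) =
   (1 - r) * T + v ^+ 2 + (r / 2 * T + 2 * q * (1 - r) * v ^+ 2) + (r * q - 1) * v ^+ 2.
  by field.
by rewrite E rq subrr mul0r addr0; move: key IH; rewrite expr2; lra.
Qed.

(** The square of a sum becomes a weighted sum of squares, which can be integrated in time term by
    term. The growing weight is affordable because the smoothing norm gains 2^(-3k). *)
Lemma telescope_tail (K : int) :
  ((cabs (z - L K) ^+ 2)%:E <= \sum_(i <oo) (2 ^+ i.+1 * U (K + i.+1%:Z) ^+ 2)%:E)%E.
Proof.
have U0 i : (0 <= (2 ^+ i.+1 * U (K + i.+1%:Z) ^+ 2)%:E)%E.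
  by rewrite lee_fin mulr_ge0 ?sqr_ge0 ?exprn_ge0.
set H := (X in (_ <= X)%E).
have H0 : (0 <= H)%E by apply: nneseries_ge0.
case EH : H H0 => [h| |] // h0; last by rewrite leey.
rewrite lee_fin in h0; rewrite lee_fin -(sqr_sqrtr h0).
rewrite lerXn2r ?nnegrE ?sqrtr_ge0 ?cabs_ge0//.
apply/ler_addgt0Pr => e e0; have [N HN] := Ltop e0.
have [n [M [EM NM]]] : exists n M : nat, K + n%:Z = M%:Z /\ (N <= M)%N.
  exact: int_reach_up.
rewrite -[z](subrK (L M%:Z)) -addrA (le_trans (cabsD _ _))// [leRHS]addrC lerD ?(ltW (HN _ NM))//.
rewrite -EM telescope_up (le_trans (cabs_sum _))//.
rewrite -(ger0_norm (sumr_ge0 _ _)); last by move=> i _; exact: cabs_ge0.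
rewrite -sqrtr_sqr ler_wsqrtr// -lee_fin -EH.
apply: le_trans (nneseries_lim_ge n _) => //.
rewrite sumEFin lee_fin big_mkord.
exact: (Cauchy_Schwarz_half n (a := fun i => U (K + i.+1%:Z)) (fun i => cabs_ge0 _)).
Qed.

End ComplexSequences.

(** * Frequency pieces of space-time functions *)

Section SpaceTime.
Variable R : realType.
Local Notation mu := (@lebesgue_measure R).
Local Notation dy := (dyad R).

Lemma ae_forall_int (P : int -> R -> Prop) : (forall k, {ae mu, forall t, P k t}) ->
  {ae mu, forall t, forall k, P k t}.
Proof.
move=> H; apply: (ae_imp (P := fun t => forall n, P (int_of_nat n) t)).
  move=> t Ht k; have [_ _ surj] := int_of_nat_bij.
  by have [n _ <-] := surj k I.
by apply: ae_foralln => n; exact: H.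
Qed.

Lemma ae_forall_ord m (P : 'I_m -> R -> Prop) : (forall i, {ae mu, forall t, P i t}) ->
  {ae mu, forall t, forall i, P i t}.
Proof.
move=> H; apply: (ae_imp (P := fun t => forall n, if insub n is Some i then P i t else True)).
  by move=> t Ht i; have := Ht (val i); rewrite valK.
by apply: ae_foralln => n; case: insubP => [i _ _|_]; [exact: H|exact: nearW].
Qed.

Lemma ae_integral0 (f : R -> \bar R) : measurable_fun setT f -> (forall x, 0 <= f x)%E ->
  (\int[mu]_x f x = 0)%E <-> {ae mu, forall x, f x = 0%E}.
Proof.
move=> mf f0; have [H1 H2] := ae_eq_integral_abs mu measurableT mf.
have E : (\int[mu]_x f x = \int[mu]_x `|f x|)%E.
  by apply: eq_integral => x _; rewrite gee0_abs.
rewrite E; split=> [/H1|H]; first by apply: ae_imp => x; exact.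
by apply: H2; apply: ae_imp H => x fx _.
Qed.

(** Tonelli for the indicator of the exceptional set: its slices are null in one direction, hence
    almost all are null in the other. *)
Lemma ae_swap (P : R -> R -> Prop) : measurable [set p : R * R | P p.1 p.2] ->
  (forall y, {ae mu, forall t, P t y}) ->
  {ae mu, forall t, {ae mu, forall y, P t y}}.
Proof.
move=> mP H; set A := [set p : R * R | P p.1 p.2] in mP.
pose f (p : R * R) : \bar R := (\1_(~` A) p)%:E.
have mA : measurable (~` A) by exact: measurableC.
have mf : measurable_fun setT f by apply/measurable_EFinP; exact: measurable_indic.
have f0 p : (0 <= f p)%E by rewrite lee_fin.
have fP t y : f (t, y) = 0%E <-> P t y.
  rewrite /f indicE; case: (boolP ((t, y) \in _)).
    by rewrite inE => H1; split => // -[] /eqP; rewrite oner_eq0.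
  by move=> /negP H1; split => // _; apply: contrapT => H2; apply: H1; rewrite inE.
have mx t : measurable_fun setT (fun y => f (t, y)).
  exact: (measurableT_comp mf (pair1_measurable t)).
have my y : measurable_fun setT (fun t => f (t, y)).
  exact: (measurableT_comp mf (pair2_measurable y)).
have := @fubini_tonelli _ _ _ _ _ mu mu f mf f0.
rewrite [RHS](_ : _ = 0%E); last first.
  rewrite (_ : (fun y => _) = cst 0%E) ?integral_cst ?mul0e//.
  apply/funext => y; apply/ae_integral0 => //.
  by apply: ae_imp (H y) => t; exact: (fP t y).2.
have mF := measurable_fun_fubini_tonelli_F (m2 := mu) f mf f0.
have F0 t : (0 <= fubini_F mu f t)%E by apply: integral_ge0 => y _; exact: f0.
move=> /(ae_integral0 mF F0).
apply: ae_imp => t /(ae_integral0 (mx t) (fun y => f0 _)).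
by apply: ae_imp => y /fP.
Qed.

(** The supremum exceeds r exactly when the section where V exceeds r has nonzero measure, and the
    measure of sections is measurable. *)
Lemma measurable_ess_sup (V : R -> R -> R) : measurable_fun setT (fun p : R * R => V p.1 p.2) ->
  measurable_fun setT (fun y => ess_sup mu (fun t => (V t y)%:E)).
Proof.
move=> mV; apply: (measurability _ (ErealGenOInfty.measurableE R)) => // _ [_ [r ->] <-].
rewrite setTI; pose B := [set p : R * R | r < V p.1 p.2].
have mB : measurable B.
  have mE : measurable_fun setT (fun p : R * R => (V p.1 p.2)%:E) by exact/measurable_EFinP.
  rewrite (_ : B = setT `&` [set p : R * R | (r%:E < (V p.1 p.2)%:E)%E]).
    exact: emeasurable_fun_o_infty.
  by rewrite setTI; apply/seteqP; split => p /=; rewrite lte_fin.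
have mG := measurable_fun_ysection mu mB.
have my y : measurable_fun setT (fun t => (V t y)%:E).
  by apply/measurable_EFinP; exact: (@measurable_pair2 R _ R V y mV).
rewrite (_ : _ @^-1` _ = (mu \o ysection B) @^-1` (~` [set 0%E])).
  rewrite -[X in measurable X]setTI; apply: mG => //; exact: measurableC.
have EB y : ysection B y = (fun t => (V t y)%:E) @^-1` `]r%:E, +oo[.
  by apply/seteqP; split => t /=; rewrite /ysection/= inE in_itv/= andbT lte_fin.
apply/seteqP; split => y /=; rewrite in_itv /= andbT.
  move=> H /eqP; rewrite EB => /eqP /(ae_le_measureP mu _ (my y)) /ess_supP.
  by rewrite leNgt H.
move=> H; rewrite ltNge; apply/negP => /ess_supP /(ae_le_measureP mu _ (my y)).
by rewrite -EB.
Qed.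

Definition lowpass (phi : R -> R) (K : int) (u : R -> R -> R[i]) (t x : R) : R[i] :=
  Complex (conv (kap phi K) (fun y => complex.Re (u t y)) x)
          (conv (kap phi K) (fun y => complex.Im (u t y)) x).

Definition amp (phi : R -> R) (k : int) (u : R -> R -> R[i]) (t x : R) : R :=
  cabs (PN phi k u t x).

End SpaceTime.

Section FrequencyPieces.
Variable R : realType.
Local Notation mu := (@lebesgue_measure R).
Local Notation dy := (dyad R).
Variable phi : R -> R.
Hypothesis Hphi : admissible_cutoff phi.
Local Notation kap := (@kap R phi).
Local Notation PN := (PN phi).
Local Notation lowpass := (lowpass phi).
Local Notation amp := (amp phi).
Implicit Types u : R -> R -> R[i].

Definition jointly_measurable u : Prop :=
  measurable_fun setT (fun p : R * R => complex.Re (u p.1 p.2)) /\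
  measurable_fun setT (fun p : R * R => complex.Im (u p.1 p.2)).

Lemma measurable_sqrt : measurable_fun setT (Num.sqrt : R -> R).
Proof. by apply: continuous_measurable_fun; exact: sqrt_continuous. Qed.

Lemma measurable_cabs d (T : measurableType d) (f : T -> R[i]) :
  measurable_fun setT (fun p => complex.Re (f p)) ->
  measurable_fun setT (fun p => complex.Im (f p)) ->
  measurable_fun setT (fun p => cabs (f p)).
Proof.
move=> mr mi; apply: (measurableT_comp measurable_sqrt).
by apply: measurable_funD; exact: measurable_funX.
Qed.

Lemma PN_conv k u t x : PN k u t x =
  Complex (conv (fun z => kap k z - kap (k - 1) z) (fun y => complex.Re (u t y)) x)
          (conv (fun z => kap k z - kap (k - 1) z) (fun y => complex.Im (u t y)) x).
Proof.
rewrite /Defs.PN /mult_op /cint; congr Complex; apply: eq_Rint => y;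
  rewrite (mult_kernel_PN Hphi); case: (u t y) => a b /=; rewrite !mul0r ?subr0 ?addr0//.
Qed.

Lemma measurable_amp k u : jointly_measurable u ->
  measurable_fun setT (fun p : R * R => amp k u p.1 p.2).
Proof.
move=> [mr mi]; have mk : measurable_fun setT (fun z => kap k z - kap (k - 1) z).
  by apply: measurable_funB; exact: measurable_kap.
apply: (measurable_cabs (f := fun p : R * R => PN k u p.1 p.2));
  (under eq_fun do rewrite PN_conv /=).
  exact: (measurable_conv_param (f := fun t y => complex.Re (u t y)) mk mr).
exact: (measurable_conv_param (f := fun t y => complex.Im (u t y)) mk mi).
Qed.

Lemma measurable_lowpass K u : jointly_measurable u -> jointly_measurable (lowpass K u).
Proof.
have mk := measurable_kap Hphi K.
move=> [mr mi]; split.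
  exact: (measurable_conv_param (f := fun t y => complex.Re (u t y)) mk mr).
exact: (measurable_conv_param (f := fun t y => complex.Im (u t y)) mk mi).
Qed.

Definition slice_Lp (p : nat) u (t : R) : Prop :=
  Lp p (fun y => complex.Re (u t y)) /\ Lp p (fun y => complex.Im (u t y)).

Lemma admissible_slice_Lp p u : (0 < p)%N -> admissible_fun p.+1 u ->
  {ae mu, forall t, slice_Lp p u t}.
Proof.
move=> p0 [mr [mi]]; apply: ae_imp => t /= H.
have mrt := @measurable_pair1 R _ R (fun t y => complex.Re (u t y)) t mr.
have mit := @measurable_pair1 R _ R (fun t y => complex.Im (u t y)) t mi.
have mc : measurable_fun setT (fun y => cabs (u t y)) by exact: measurable_cabs.
have ic : integrableR (fun y => cabs (u t y) ^+ p).
  apply/integrableP; split; first by apply/measurable_EFinP; exact: measurable_funX.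
  rewrite (_ : (\int[mu]_x _ = \int[mu]_y ((cabs (u t y))%:E `^ p%:R))%E); last first.
    apply: eq_integral => y _; rewrite poweR_EFin /= powR_mulrn ?cabs_ge0// ger0_norm//.
    by rewrite exprn_ge0 ?cabs_ge0.
  rewrite ltey; apply/eqP => E; move: H; rewrite E poweRyr// invr_eq0 pnatr_eq0.
  by rewrite -lt0n.
split; split=> //; apply: integrableR_dom ic _.
- by apply: measurable_funX; exact: measurableT_comp.
- move=> y; rewrite normrX normr_id lerXn2r ?nnegrE ?cabs_ge0//; exact: norm_Re_le.
- by apply: measurable_funX; exact: measurableT_comp.
- move=> y; rewrite normrX normr_id lerXn2r ?nnegrE ?cabs_ge0//; exact: norm_Im_le.
Qed.

Lemma conv_kapB p k f x : (0 < p)%N -> Lp p f ->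
  conv (fun z => kap k z - kap (k - 1) z) f x = LP phi k f x.
Proof.
move=> p0 fp; have iK k' := conv_kap_integrable Hphi k' x p0 fp; rewrite /LP /conv -RintB//.
by apply: eq_Rint => y; rewrite mulrBl.
Qed.

Lemma PN_LP p k u t x : (0 < p)%N -> slice_Lp p u t ->
  PN k u t x = Complex (LP phi k (fun y => complex.Re (u t y)) x)
                       (LP phi k (fun y => complex.Im (u t y)) x).
Proof. by move=> p0 [Lr Li]; rewrite PN_conv !(conv_kapB _ _ p0). Qed.

Lemma PN_lowpass p k u t x : (0 < p)%N -> slice_Lp p u t ->
  PN k u t x = lowpass k u t x - lowpass (k - 1) u t x.
Proof. by move=> p0 ut; rewrite (PN_LP k x p0 ut). Qed.

End FrequencyPieces.

(** * The components of the norms at one frequency *)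

Section Norms.
Variable R : realType.
Local Notation mu := (@lebesgue_measure R).
Local Notation dy := (dyad R).
Implicit Types u : R -> R -> R[i].
Local Open Scope ereal_scope.

Lemma lebesgue_setT_gt0 : 0 < mu setT.
Proof.
apply: (@lt_le_trans _ _ (mu `[0%R, 1%R]%classic)).
  by rewrite lebesgue_measure_itv /= lte_fin ltr01 oppr0 adde0.
by apply: le_measure; rewrite ?inE.
Qed.

Lemma ess_sup_ge0 (f : R -> \bar R) : (forall t, 0 <= f t) -> 0 <= ess_sup mu f.
Proof. by move=> f0; apply: ess_sup_gee; [exact: lebesgue_setT_gt0|exact: nearW]. Qed.

Lemma eLnorm_ge0 (q : \bar R) (h : R -> \bar R) : (forall t, 0 <= h t) -> 0 <= eLnorm q h.
Proof. by move=> h0; case: q => [r| |] //=; [exact: poweR_ge0|exact: ess_sup_ge0]. Qed.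

Lemma LtLx_ge0 q r u : 0 <= LtLx q r u.
Proof. by apply: eLnorm_ge0 => t; apply: eLnorm_ge0 => x; rewrite lee_fin cabs_ge0. Qed.

Lemma LxLt_ge0 q r u : 0 <= LxLt q r u.
Proof. by apply: eLnorm_ge0 => t; apply: eLnorm_ge0 => x; rewrite lee_fin cabs_ge0. Qed.

Lemma XN_components N u : [/\ LtLx +oo 2%:E u <= XN N u,
  (N `^ (- 4^-1))%:E * LxLt 4%:E +oo u <= XN N u,
  (N `^ (3 / 2))%:E * LxLt +oo 2%:E u <= XN N u & 0 <= XN N u].
Proof.
rewrite /XN; set a := LtLx _ _ _; set b := _ * _; set c := _ * _.
have a0 : 0 <= a by exact: LtLx_ge0.
have b0 : 0 <= b by rewrite mule_ge0 ?lee_fin ?powR_ge0 ?LxLt_ge0.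
have c0 : 0 <= c by rewrite mule_ge0 ?lee_fin ?powR_ge0 ?LxLt_ge0.
split; last by rewrite !adde_ge0.
- by rewrite -addeA leeDl// adde_ge0.
- by rewrite -addeA addeCA leeDl// adde_ge0.
- by rewrite leeDr// adde_ge0.
Qed.

Lemma le_poweR (x y : \bar R) (r : R) : (0 <= r)%R -> 0 <= x -> x <= y -> x `^ r <= y `^ r.
Proof.
move=> r0 x0 xy; apply: gt0_ler_poweR => //; rewrite in_itv/= leey andbT//.
exact: le_trans xy.
Qed.

Lemma poweR_inv_le (x : \bar R) (n : nat) (y : R) : (0 < n)%N -> 0 <= x -> (0 <= y)%R ->
  x `^ n%:R^-1 <= y%:E -> x <= (y ^+ n)%:E.
Proof.
move=> n0 x0 y0 H; have n0' : n%:R != 0%R :> R by rewrite pnatr_eq0 -lt0n.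
have := @le_poweR _ _ n%:R (ler0n _ _) (poweR_ge0 _ _) H.
by rewrite -poweRrM mulVf// poweRe1// poweR_EFin powR_mulrn.
Qed.

Lemma eLnorm_inner_nat (n : nat) (f : R -> R) : (0 < n)%N -> (forall y, 0 <= f y)%R ->
  eLnorm n%:R%:E (fun y => (f y)%:E) = (\int[mu]_y (f y ^+ n)%:E) `^ n%:R^-1.
Proof.
move=> n0 f0 /=; congr poweR; apply: eq_integral => y _.
by rewrite powR_mulrn.
Qed.

Variable phi : R -> R.
Local Notation PN := (PN phi).
Local Notation amp := (amp phi).

Definition xnorm u (k : int) : R := fine (XN (dy k) (PN k u)).

Lemma xnorm_ge0 u k : (0 <= xnorm u k)%R.
Proof. by apply: fine_ge0; have [] := XN_components (dy k) (PN k u). Qed.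

Lemma Xdot_ge0 (s : R) u : 0 <= Xdot phi s u.
Proof. exact: poweR_ge0. Qed.

(** Every frequency carries a positive weight, so one infinite piece would make the whole sum
    infinite. Finiteness thus allows all pieces to be handled as real numbers. *)
Lemma XN_xnorm (s : R) u k : Xdot phi s u < +oo -> XN (dy k) (PN k u) = (xnorm u k)%:E.
Proof.
move=> H; rewrite /xnorm fineK// ge0_fin_numE; last by have [] := XN_components (dy k) (PN k u).
have X0 j : 0 <= XN (dy j) (PN j u) by have [] := XN_components (dy j) (PN j u).
rewrite ltey; apply/eqP => E.
have := lty_poweRy (_ : 2^-1 != 0)%R H; rewrite invr_eq0 pnatr_eq0 => /(_ isT).
rewrite ltNge => /negP; apply.
apply: le_trans (esum_int_ge k (f := fun k => ((dy k `^ s) ^+ 2)%:E *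
  (XN (dy k) (PN k u) * XN (dy k) (PN k u))) _); last first.
  by move=> j; rewrite !mule_ge0// lee_fin sqr_ge0.
by rewrite E mulyy gt0_muley// lte_fin exprn_gt0// powR_gt0// dyad_gt0.
Qed.

Lemma Xdot_xnorm (s s' : R) u : Xdot phi s u < +oo ->
  Xdot phi s' u * Xdot phi s' u = \esum_(k in [set: int]) ((dy k `^ s') ^+ 2 * xnorm u k ^+ 2)%:E.
Proof.
move=> H; rewrite /Xdot poweR_half_mul; last first.
  apply: esum_ge0 => k _; rewrite mule_ge0 ?lee_fin ?sqr_ge0//.
  by rewrite mule_ge0//; have [] := XN_components (dy k) (PN k u).
by apply: eq_esum => k _; rewrite (XN_xnorm k H) -!EFinM expr2.
Qed.

Lemma xnorm_le (s s' : R) u k : Xdot phi s u < +oo -> Xdot phi s' u < +oo ->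
  (dy k `^ s' * xnorm u k <= fine (Xdot phi s' u))%R.
Proof.
move=> H H'; rewrite -(@ler_pXn2r _ 2)// ?nnegrE ?mulr_ge0 ?powR_ge0 ?xnorm_ge0//; last first.
  exact/fine_ge0/Xdot_ge0.
rewrite -lee_fin exprMn expr2 [in leRHS]EFinM fineK ?ge0_fin_numE ?Xdot_ge0//.
rewrite (Xdot_xnorm s' H) -expr2.
apply: (esum_int_ge k (f := fun k => ((dy k `^ s') ^+ 2 * xnorm u k ^+ 2)%:E)) => j.
by rewrite lee_fin mulr_ge0 ?sqr_ge0.
Qed.

Hypothesis Hphi : admissible_cutoff phi.

(** The norm L^infty_t L^2_x gives the L^2 bound for almost every t, and Bernstein's inequality, for
    real and imaginary parts, then holds at every x. *)
Lemma amp_Bernstein : exists2 C : R, (0 <= C)%R & forall p u s, (0 < p)%N ->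
  admissible_fun p.+1 u -> Xdot phi s u < +oo ->
  {ae mu, forall t, forall k x, (amp k u t x ^+ 2 <= C * (dy k * xnorm u k ^+ 2))%R}.
Proof.
have [C C0 HC] := Bernstein Hphi; exists C => // p u s p0 au Xu.
have A1 := admissible_slice_Lp p0 au.
have A2 : {ae mu, forall t, forall k, \int[mu]_y (amp k u t y ^+ 2)%:E <= (xnorm u k ^+ 2)%:E}.
  apply: ae_forall_int => k; have [H _ _ _] := XN_components (dy k) (PN k u).
  rewrite (XN_xnorm k Xu) in H.
  have {}H : ess_sup mu (fun t => eLnorm 2%:E (fun x => (amp k u t x)%:E)) <= (xnorm u k)%:E.
    exact: H.
  move/ess_supP : H; apply: ae_imp => t.
  rewrite (eLnorm_inner_nat (n := 2))//; last by move=> y; exact: cabs_ge0.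
  apply: poweR_inv_le => //; last exact: xnorm_ge0.
  by apply: integral_ge0 => y _; rewrite lee_fin sqr_ge0.
apply: ae_imp (ae_and A1 A2) => t [ut H] k x.
have [ur ui] := ut; have [mr mi] := au.
rewrite /amp (PN_LP Hphi k x p0 ut) sqr_cabs /= -lee_fin.
apply: (@le_trans _ _ ((C * dy k)%:E * \int[mu]_y (amp k u t y ^+ 2)%:E)); last first.
  rewrite mulrA [in leRHS]EFinM; apply: lee_wpmul2l => //.
  by rewrite lee_fin mulr_ge0// dyad_ge0.
rewrite (_ : \int[mu]_y _ = \int[mu]_y (LP phi k (fun y => complex.Re (u t y)) y ^+ 2)%:E +
    \int[mu]_y (LP phi k (fun y => complex.Im (u t y)) y ^+ 2)%:E); last first.
  rewrite -ge0_integralD//; last 4 first.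
  - by move=> y _; rewrite lee_fin sqr_ge0.
  - by apply/measurable_EFinP; apply: measurable_funX; exact: measurable_LP ur.1.
  - by move=> y _; rewrite lee_fin sqr_ge0.
  - by apply/measurable_EFinP; apply: measurable_funX; exact: measurable_LP ui.1.
  by apply: eq_integral => y _; rewrite /amp (PN_LP Hphi k y p0 ut) sqr_cabs.
rewrite ge0_muleDr; last 2 first.
- by apply: integral_ge0 => y _; rewrite lee_fin sqr_ge0.
- by apply: integral_ge0 => y _; rewrite lee_fin sqr_ge0.
by rewrite EFinD; apply: leeD; apply: HC p0 _.
Qed.

End Norms.

(** * Pointwise control of one factor *)

Section Control.
Variable R : realType.
Local Notation mu := (@lebesgue_measure R).
Local Notation dy := (dyad R).
Variable phi : R -> R.
Hypothesis Hphi : admissible_cutoff phi.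
Local Notation PN := (PN phi).
Local Notation amp := (amp phi).
Implicit Types u : R -> R -> R[i].
Local Open Scope ereal_scope.

(** The second bound is asked for only when X > 0: for X = 0 the density vanishes through the
    convention 0^-1 = 0, but the first bound already gives a = 0. *)
Definition interpolates (p : nat) (C : R) : Prop :=
  forall (a : int -> R) (X Q : R), (0 <= Q)%R -> (0 <= X)%R -> (forall k, 0 <= a k)%R ->
    (forall k, a k <= dy k `^ p%:R^-1 * X)%R ->
    (0 < X -> forall k, dy k `^ (1 - 4 / p%:R) * a k ^+ 4 <= X ^+ 4 * Q)%R ->
    forall K n, (\sum_(i < n) a (K - i%:Z) <= C * (X * Q `^ p%:R^-1))%R.

Lemma interpolated_sum_scaled (p : nat) : (5 <= p)%N -> exists2 C : R, (0 <= C)%R & interpolates p C.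
Proof.
move=> p5; have [C C0 HC] := interpolated_sum R p5; exists C => // a X Q Q0.
rewrite le_eqVlt => /predU1P[<- a0 aX _ K n|X0 a0 aX aQ K n].
  rewrite mul0r mulr0; apply: sumr_le0 => i _.
  by have := aX (K - i%:Z)%R; rewrite mulr0.
have XK (z : R) : (X * (z / X) = z)%R by rewrite mulrC divfK// gt_eqF.
rewrite (_ : (\sum_(i < n) a (K - i%:Z) = X * \sum_(i < n) (a (K - i%:Z) / X))%R); last first.
  by rewrite mulr_sumr; apply: eq_bigr => i _; rewrite XK.
rewrite [leRHS]mulrCA ler_wpM2l ?(ltW X0)//.
apply: (HC (fun k => a k / X)%R Q Q0) => k.
- by rewrite divr_ge0 ?(ltW X0).
- by rewrite ler_pdivrMr.
- rewrite exprMn mulrA exprVn ler_pdivrMr ?exprn_gt0// mulrC.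
  by rewrite [leRHS]mulrC; move: (aQ X0 k); rewrite mulrC.
Qed.

Lemma powR_exprn (a r : R) n : ((a `^ r) ^+ n = a `^ (r * n%:R))%R.
Proof. by rewrite powRrM powR_mulrn// powR_ge0. Qed.

Definition peak u (k : int) (y : R) : \bar R := ess_sup mu (fun t => (amp k u t y)%:E).

Lemma amp_ge0 k u t y : (0 <= amp k u t y)%R.
Proof. exact: cabs_ge0. Qed.

Lemma measurable_peak u k : jointly_measurable u -> measurable_fun setT (peak u k).
Proof. by move=> mu_; apply: measurable_ess_sup; exact: measurable_amp. Qed.

Lemma le_scaled (a x : R) (z : \bar R) : (0 < a)%R -> a^-1%:E * z <= x%:E -> z <= (a * x)%:E.
Proof.
move=> a0; case: z => [z| |]; last by rewrite leNye.
  by rewrite -EFinM !lee_fin mulrC ler_pdivrMr// mulrC.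
by rewrite gt0_muley ?lte_fin ?invr_gt0// leye_eq.
Qed.

Lemma integral_peak (s : R) u k : Xdot phi s u < +oo ->
  \int[mu]_y (peak u k y `^ 4) <= (dy k * xnorm phi u k ^+ 4)%:E.
Proof.
move=> Xu; have [_ H _ _] := XN_components (dy k) (PN k u).
rewrite (XN_xnorm k Xu) powRN in H.
have d0 := dyad_gt0 R k.
have {}H := le_scaled (powR_gt0 _ d0) H.
have {}H : (\int[mu]_y (peak u k y `^ 4)) `^ 4%:R^-1 <= (dy k `^ 4^-1 * xnorm phi u k)%:E.
  exact: H.
have := poweR_inv_le (n := 4) isT _ _ H; rewrite exprMn.
rewrite powR_exprn mulVf ?powRr1 ?(ltW d0) ?pnatr_eq0//.
apply; last by rewrite mulr_ge0 ?powR_ge0 ?xnorm_ge0.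
by apply: integral_ge0 => y _; exact: poweR_ge0.
Qed.

Lemma amp_smoothing (s : R) u : Xdot phi s u < +oo ->
  {ae mu, forall y, forall k, \int[mu]_t (amp k u t y ^+ 2)%:E <= (dy k ^- 3 * xnorm phi u k ^+ 2)%:E}.
Proof.
move=> Xu; apply: ae_forall_int => k; have [_ _ H _] := XN_components (dy k) (PN k u).
have d0 := dyad_gt0 R k.
rewrite (XN_xnorm k Xu) -[(_ `^ _)%R]invrK in H.
have {}H := le_scaled (_ : 0 < _)%R H.
rewrite invr_gt0 in H; have {}H := H (powR_gt0 _ d0).
have {}H : ess_sup mu (fun y => eLnorm 2%:E (fun t => (amp k u t y)%:E)) <=
    ((dy k `^ (3 / 2))^-1 * xnorm phi u k)%:E by exact: H.
move/ess_supP : H; apply: ae_imp => y.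
rewrite (eLnorm_inner_nat (n := 2))//; last by move=> t; exact: amp_ge0.
move=> /poweR_inv_le; rewrite exprMn exprVn powR_exprn divfK ?pnatr_eq0//.
rewrite powR_mulrn ?(ltW d0)//; apply=> //.
  by apply: integral_ge0 => t _; rewrite lee_fin sqr_ge0.
by rewrite mulr_ge0 ?xnorm_ge0// invr_ge0 powR_ge0.
Qed.

(** The right-hand side of [telescope_tail]; as an extended real it may be infinite at single
    points. *)
Definition tail u (K : int) (t y : R) : \bar R :=
  \sum_(i <oo) (2 ^+ i.+1 * amp (K + i.+1%:Z) u t y ^+ 2)%:E.

Lemma tail_term_ge0 u k (i : nat) t y : 0 <= (2 ^+ i * amp k u t y ^+ 2)%:E.
Proof. by rewrite lee_fin mulr_ge0 ?sqr_ge0 ?exprn_ge0. Qed.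

Lemma tail_ge0 u K t y : 0 <= tail u K t y.
Proof. by apply: nneseries_ge0 => i _ _; exact: tail_term_ge0. Qed.

Lemma measurable_tail u K : jointly_measurable u ->
  measurable_fun setT (fun q : R * R => tail u K q.1 q.2).
Proof.
move=> mju; apply: ge0_emeasurable_sum => [i q _ _|i _]; first exact: tail_term_ge0.
apply/measurable_EFinP; apply: measurable_funM => //.
by apply: measurable_funX; exact: measurable_amp.
Qed.

Lemma integral_tail (s : R) u : jointly_measurable u -> Xdot phi s u < +oo ->
  {ae mu, forall y, forall K, \int[mu]_t tail u K t y <=
    \sum_(i <oo) (2 ^+ i.+1 * dy (K + i.+1%:Z)%R ^- 3 * xnorm phi u (K + i.+1%:Z)%R ^+ 2)%:E}.
Proof.
move=> mju Xu; apply: ae_imp (amp_smoothing Xu) => y H K.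
have my k (i : nat) : measurable_fun setT (fun t => (amp k u t y ^+ 2)%:E).
  apply/measurable_EFinP; apply: measurable_funX.
  exact: (@measurable_pair2 R _ R (amp k u) y (measurable_amp Hphi k mju)).
rewrite integral_nneseries//; last 2 first.
- move=> i; under eq_fun do rewrite EFinM.
  by apply: emeasurable_funM => //; exact: my.
- by move=> i t _; exact: tail_term_ge0.
apply: lee_nneseries => [i _ _|i _].
  by apply: integral_ge0 => t _; exact: tail_term_ge0.
under eq_integral => t _ do rewrite EFinM.
rewrite ge0_integralZl_EFin//; last 2 first.
- by move=> t _; rewrite lee_fin sqr_ge0.
- exact: my.
rewrite -mulrA EFinM; apply: lee_wpmul2l; first by rewrite lee_fin exprn_ge0.
exact: H.
Qed.

Section Density.
Variables (p : nat) (u : R -> R -> R[i]).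
Hypotheses (p5 : (5 <= p)%N) (au : admissible_fun p.+1 u).
Let sc : R := (2^-1 - p%:R^-1)%R.
Hypothesis Xu : Xdot phi sc u < +oo.
Let X : R := fine (Xdot phi sc u).
Let p0 : (0 < p)%N. Proof. exact: leq_trans p5. Qed.
Let mju : jointly_measurable u. Proof. by case: au => mr [mi _]. Qed.

(* Dividing by [X ^ 4] makes the integral at most 1, the exponents being chosen so that
   (2 ^ k) ^ (1 - 4 / p) * 2 ^ k = (2 ^ k) ^ (4 sc). If [X = 0] this is 0. *)
Definition density (y : R) : \bar R :=
  \esum_(k in [set: int]) ((dy k `^ (1 - 4 / p%:R) * X ^- 4)%:E * peak u k y `^ 4).

Let X0 : (0 <= X)%R. Proof. exact/fine_ge0/Xdot_ge0. Qed.

Let term_ge0 k y : 0 <= (dy k `^ (1 - 4 / p%:R) * X ^- 4)%:E * peak u k y `^ 4.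
Proof. by rewrite mule_ge0 ?poweR_ge0// lee_fin mulr_ge0 ?powR_ge0// invr_ge0 exprn_ge0. Qed.

Let mpeak4 k : measurable_fun setT (fun y => peak u k y `^ 4).
Proof. exact: (measurableT_comp (@measurable_poweR R 4) (measurable_peak k mju)). Qed.

Let mterm k : measurable_fun setT (fun y => (dy k `^ (1 - 4 / p%:R) * X ^- 4)%:E * peak u k y `^ 4).
Proof.
apply: emeasurable_funM; first exact: measurable_cst.
exact: mpeak4.
Qed.

Lemma measurable_density : measurable_fun setT density.
Proof. exact: (measurable_esum_int mterm term_ge0). Qed.

Lemma density_ge0 y : 0 <= density y.
Proof. by apply: esum_ge0 => k _. Qed.

(** With v = 2^(k s_c) |P_k u|, in the X norm of the piece, term k is at most (v / X)^4 <= (v /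
    X)^2, since no single piece exceeds X. The squares add up to 1, or to 0 when X = 0. *)
Lemma integral_density : \int[mu]_y density y <= 1.
Proof.
rewrite (ge0_integral_esum_int mterm term_ge0).
apply: (@le_trans _ _ (\esum_(k in [set: int]) ((X ^- 2)%:E * ((dy k `^ sc) ^+ 2 * xnorm phi u k ^+ 2)%:E))).
  apply: le_esum => k _; rewrite ge0_integralZl_EFin//; last 3 first.
  - by move=> y _; exact: poweR_ge0.
  - exact: mpeak4.
  - by rewrite mulr_ge0 ?powR_ge0// invr_ge0 exprn_ge0.
  have c0 : (0 <= dy k `^ (1 - 4 / p%:R) * X ^- 4)%R.
    by rewrite mulr_ge0 ?powR_ge0// invr_ge0 exprn_ge0.
  apply: le_trans (lee_wpmul2l _ (integral_peak k Xu)) _; first by rewrite lee_fin.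
  rewrite -!EFinM lee_fin.
  have := xnorm_le k Xu Xu; rewrite -/X; set v := (dy k `^ sc * _)%R => vX.
  have d0 := dyad_gt0 R k.
  have v0 : (0 <= v)%R by rewrite mulr_ge0 ?powR_ge0 ?xnorm_ge0.
  have -> : (dy k `^ (1 - 4 / p%:R) * X ^- 4 * (dy k * xnorm phi u k ^+ 4) = (v / X) ^+ 4)%R.
    rewrite exprMn exprVn /v exprMn powR_exprn.
    rewrite (_ : (sc * 4 = (1 - 4 / p%:R) + 1)%R); last by rewrite /sc; field; rewrite pnatr_eq0 -lt0n.
    rewrite [in RHS]powRD; last by rewrite (gt_eqF d0) implybT.
    by rewrite (powRr1 (ltW d0)); set a := (dy k `^ _)%R; set b := (X ^- 4)%R; ring.
  rewrite -exprMn -/v -exprVn -exprMn [(X^-1 * v)%R]mulrC.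
  have w0 : (0 <= v / X)%R by rewrite divr_ge0.
  have w1 : (v / X <= 1)%R.
    move: X0; rewrite le_eqVlt => /predU1P[<-|X1]; first by rewrite invr0 mulr0.
    by rewrite ler_pdivrMr// mul1r.
  by rewrite -[leRHS]mulr1 (exprD _ 2 2) ler_wpM2l ?sqr_ge0// exprn_ile1.
rewrite esumZ_int; last 2 first.
- by rewrite invr_ge0 exprn_ge0.
- by move=> k; rewrite lee_fin mulr_ge0 ?sqr_ge0.
rewrite -(Xdot_xnorm sc Xu) -[Xdot phi sc u]fineK; last by rewrite ge0_fin_numE ?Xdot_ge0.
rewrite -/X -!EFinM lee_fin -expr2.
move: X0; rewrite le_eqVlt => /predU1P[<-|X1]; first by rewrite expr0n mulr0.
by rewrite mulVf// gt_eqF// exprn_gt0.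
Qed.

Definition dens (y : R) : R := fine (density y).

Lemma dens_ge0 y : (0 <= dens y)%R.
Proof. exact/fine_ge0/density_ge0. Qed.

Lemma measurable_dens : measurable_fun setT dens.
Proof. exact: (measurableT_comp (@fine_measurable _ setT measurableT) measurable_density). Qed.

Lemma integral_dens : \int[mu]_y (dens y)%:E <= 1.
Proof.
apply: le_trans integral_density; apply: ge0_le_integral => //.
- by move=> y _; rewrite lee_fin dens_ge0.
- by apply/measurable_EFinP; exact: measurable_dens.
- exact: measurable_density.
- move=> y _; rewrite /dens; by case: (density y) (density_ge0 y) => [r| |] //= _; rewrite leey.
Qed.

Lemma density_dens : {ae mu, forall y, density y = (dens y)%:E}.
Proof.
have : mu.-integrable setT density.
  apply/integrableP; split; first exact: measurable_density.
  under eq_integral => y _ do rewrite gee0_abs ?density_ge0//.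
  by apply: le_lt_trans integral_density _; rewrite ltry.
move=> /integrable_ae H; apply: ae_imp (H measurableT) => y /(_ I) Hy.
by rewrite /dens fineK.
Qed.

(** The essential supremum is taken in time at fixed y, whereas the convolutions act in y at fixed
    time; hence the exchange of the two exceptional sets. *)
Lemma amp_le_peak : {ae mu, forall t, {ae mu, forall y, forall k, (amp k u t y)%:E <= peak u k y}}.
Proof.
suff : {ae mu, forall t, forall k, {ae mu, forall y, (amp k u t y)%:E <= peak u k y}}.
  by apply: ae_imp => t; exact: ae_forall_int.
apply: ae_forall_int => k; apply: ae_swap; last by move=> y; exact: ess_sup_ge.
have mA : measurable_fun setT (fun q : R * R => (amp k u q.1 q.2)%:E).
  by apply/measurable_EFinP; exact: measurable_amp.
have mP : measurable_fun setT (fun q : R * R => peak u k q.2).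
  by apply: (measurableT_comp (measurable_peak k mju)); exact: measurable_snd.
by rewrite -[X in measurable X]setTI; exact: measurable_lee.
Qed.

Lemma cvg_cabs (a b : R^nat) (a0 b0 : R) : (a @ \oo --> a0)%classic -> (b @ \oo --> b0)%classic ->
  forall e : R, (0 < e)%R -> exists N : nat, forall n : nat, (N <= n)%N ->
    (cabs (Complex a0 b0 - Complex (a n) (b n)) < e)%R.
Proof.
move=> /cvgrPdist_lt Ha /cvgrPdist_lt Hb e e0.
have e2 : (0 < e / 2)%R by rewrite divr_gt0.
have [N _ HN] := Ha _ e2; have [M _ HM] := Hb _ e2.
exists (maxn N M) => n; rewrite geq_max => /andP[/HN + /HM]; rewrite /= => h1 h2.
apply: le_lt_trans (cabs_le_ReIm _) _ => /=.
by rewrite [X in (_ < X)%R]splitr ltrD.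
Qed.

Section Pointwise.
Variables (C C1 : R) (t y : R).
Hypotheses (C10 : (0 <= C1)%R) (ut : slice_Lp p u t).
Hypothesis interp : interpolates p C.
Hypothesis Bern : forall k, (amp k u t y ^+ 2 <= C1 * (dy k * xnorm phi u k ^+ 2))%R.
Hypothesis dens_fin : density y = (dens y)%:E.
Hypothesis peakP : forall k, (amp k u t y)%:E <= peak u k y.

(** Bernstein gives the first bound through 1/2 = 1/p + s_c, and a single term of the density gives
    the second. The constant 1 + C1 avoids a root, since C1 <= (1 + C1)^2. *)
Lemma amp_sum K n : (\sum_(i < n) amp (K - i%:Z) u t y <= C * ((1 + C1) * X * dens y `^ p%:R^-1))%R.
Proof.
have c1 : (1 <= 1 + C1)%R by rewrite lerDl.
have c0 : (0 <= 1 + C1)%R by exact: le_trans c1.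
apply: (interp (a := fun k => amp k u t y)) => [||k|k|cX k].
- exact: dens_ge0.
- exact: mulr_ge0.
- exact: amp_ge0.
- have d0 := dyad_gt0 R k.
  rewrite -(@ler_pXn2r _ 2)// ?nnegrE ?amp_ge0//; last first.
    by rewrite mulr_ge0 ?powR_ge0// mulr_ge0.
  apply: le_trans (Bern k) _.
  have := xnorm_le k Xu Xu; rewrite -/X => vX.
  have E : (dy k * xnorm phi u k ^+ 2 = (dy k `^ p%:R^-1 * (dy k `^ sc * xnorm phi u k)) ^+ 2)%R.
    rewrite mulrA -powRD; last by rewrite (gt_eqF d0) implybT.
    rewrite /sc addrC subrK exprMn powR_exprn mulVf ?pnatr_eq0// powRr1//.
    exact: ltW.
  rewrite E (mulrCA _ (1 + C1)%R) [leRHS]exprMn ler_pM ?sqr_ge0//.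
    by rewrite expr2; have := mulr_ge0 C10 C10; lra.
  rewrite lerXn2r ?nnegrE ?mulr_ge0 ?powR_ge0 ?xnorm_ge0//.
  by rewrite ler_wpM2l ?powR_ge0.
- have X1 : (0 < X)%R by rewrite lt_neqAle X0 andbT; apply: contraTneq cX => <-; rewrite mulr0 ltxx.
  apply: (@le_trans _ _ (X ^+ 4 * dens y)%R); last first.
    by rewrite ler_wpM2r ?dens_ge0// lerXn2r ?nnegrE ?mulr_ge0// ler_peMl.
  rewrite -ler_pdivrMl ?exprn_gt0// -lee_fin -dens_fin.
  apply: le_trans (esum_int_ge k (term_ge0 ^~ y)).
  rewrite mulrA (mulrC (X ^- 4)%R) EFinM; apply: lee_wpmul2l.
    by rewrite lee_fin mulr_ge0 ?powR_ge0// invr_ge0 exprn_ge0.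
  rewrite -powR_mulrn ?amp_ge0// -poweR_EFin; apply: le_poweR => //.
  by rewrite lee_fin amp_ge0.
Qed.

Let low (K : int) := lowpass phi K u t y.
Hypothesis lim_re : ((fun n : nat => conv (kap phi n%:Z) (fun y => complex.Re (u t y)) y) @ \oo
   --> complex.Re (u t y))%classic.
Hypothesis lim_im : ((fun n : nat => conv (kap phi n%:Z) (fun y => complex.Im (u t y)) y) @ \oo
   --> complex.Im (u t y))%classic.

Lemma pointwise_control :
  [/\ (forall K, cabs (low K) <= C * ((1 + C1) * X * dens y `^ p%:R^-1))%R,
      (cabs (u t y) <= C * ((1 + C1) * X * dens y `^ p%:R^-1))%R &
      (forall K, (cabs (u t y - low K) ^+ 2)%:E <= tail u K t y)].
Proof.
have top : forall e : R, (0 < e)%R -> exists N : nat, forall n : nat, (N <= n)%N ->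
    (cabs (u t y - low n%:Z) < e)%R.
  by move=> e e0; have := cvg_cabs lim_re lim_im e0; case: (u t y) => a b.
have bot : forall e : R, (0 < e)%R -> exists N : nat, forall n : nat, (N <= n)%N ->
    (cabs (low (- n%:Z)) < e)%R.
  have [ur ui] := ut.
  move=> e e0; have [N HN] := cvg_cabs (conv_kap_low Hphi y p0 ur) (conv_kap_low Hphi y p0 ui) e0.
  exists N => n /HN; rewrite (_ : Complex 0 0 = 0)%R// sub0r cabsN.
  exact.
have ampE k : amp k u t y = cabs (low k - low (k - 1))%R.
  by rewrite /amp (PN_lowpass Hphi k y p0 ut).
have [|H1 H2] := telescope_bound (b := (C * ((1 + C1) * X * dens y `^ p%:R^-1))%R) top bot.
  by move=> K n; under eq_bigr => i _ do rewrite -ampE; exact: amp_sum.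
split=> // K; apply: le_trans (telescope_tail top K) _.
by apply: lee_nneseries => [i _ _|i _]; rewrite -ampE//; exact: tail_term_ge0.
Qed.

End Pointwise.

End Density.

Definition controlled (p : nat) (C : R) u (t y : R) : Prop :=
  let b := (C * (fine (Xdot phi (2^-1 - p%:R^-1) u) * dens p u y `^ p%:R^-1))%R in
  [/\ (forall K, cabs (lowpass phi K u t y) <= b)%R, (cabs (u t y) <= b)%R &
    (forall K, (cabs (u t y - lowpass phi K u t y) ^+ 2)%:E <= tail u K t y)].

(** The time t is fixed first, outside one null set; the null set in y may depend on t, which is
    harmless under the integral in y. *)
Lemma function_control (p : nat) : (5 <= p)%N -> exists2 C : R, (0 <= C)%R &
  forall u, admissible_fun p.+1 u -> Xdot phi (2^-1 - p%:R^-1) u < +oo ->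
  {ae mu, forall t, slice_Lp p u t /\ {ae mu, forall y, controlled p C u t y}}.
Proof.
move=> p5; have p0 : (0 < p)%N by exact: leq_trans p5.
have [C C0 HC] := interpolated_sum_scaled p5.
have [C1 C10 HC1] := amp_Bernstein Hphi.
exists (C * (1 + C1))%R; first by rewrite mulr_ge0// addr_ge0.
move=> u au Xu.
have A1 := HC1 p u _ p0 au Xu.
have A2 := admissible_slice_Lp p0 au.
have A3 := amp_le_peak au.
apply: ae_imp (ae_and A1 (ae_and A2 A3)) => t [B1 [ut B3]].
split=> //; have [ur ui] := ut.
have B4 := conv_kap_ae Hphi p0 ur.
have B5 := conv_kap_ae Hphi p0 ui.
have B6 := density_dens p5 au Xu.
apply: ae_imp (ae_and B3 (ae_and B4 (ae_and B5 B6))) => y [D1 [D2 [D3 D4]]].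
rewrite /controlled -mulrA (mulrA (1 + C1)%R).
exact: (pointwise_control p5 Xu C10 ut HC (B1 ^~ y)).
Qed.

End Control.

(** * Products *)

Section Products.
Variable R : realType.
Local Notation mu := (@lebesgue_measure R).
Local Notation dy := (dyad R).
Local Notation C := R[i].

(** The factors are exchanged one at a time; [b] bounds the remaining ones, whether already
    exchanged or not. *)
Lemma prod_telescope (m : nat) (a c : 'I_m -> C) (b : 'I_m -> R) :
  (forall i, cabs (a i) <= b i) -> (forall i, cabs (c i) <= b i) ->
  cabs (\prod_(i < m) a i - \prod_(i < m) c i) <=
    \sum_(j < m) cabs (a j - c j) * \prod_(i < m | i != j) b i.
Proof.
elim: m a c b => [|m IH] a c b ab cb; first by rewrite !big_ord0 subrr cabs0.
rewrite !big_ord_recl.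
set A := \prod_(i < m) _; set B := \prod_(i < m) _.
have b0 i : 0 <= b i by exact: le_trans (cabs_ge0 _) (ab i).
have -> : a ord0 * A - c ord0 * B = (a ord0 - c ord0) * A + c ord0 * (A - B).
  by rewrite mulrBl mulrBr addrA subrK.
apply: le_trans (cabsD _ _) _; rewrite !cabsM; apply: lerD.
  rewrite ler_wpM2l ?cabs_ge0// big_mkcond big_ord_recl eqxx /= mul1r.
  by rewrite /A cabs_prod ler_prod// => i _; rewrite cabs_ge0 ab.
have H := IH (fun i => a (lift ord0 i)) (fun i => c (lift ord0 i)) (fun i => b (lift ord0 i))
  (fun i => ab _) (fun i => cb _).
apply: le_trans (ler_pM (cabs_ge0 _) (cabs_ge0 _) (cb ord0) H) _.
rewrite mulr_sumr; apply: ler_sum => j _.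
rewrite mulrCA ler_wpM2l ?cabs_ge0//.
rewrite [leRHS]big_mkcond big_ord_recl /= -big_mkcond /=.
by under eq_bigl => i do rewrite -(inj_eq (@lift_inj _ ord0)).
Qed.

(** Leaving out one of p + 1 factors leaves exactly p roots Q^(1/p), whose product is the integrable
    weight Q. *)
Lemma prod_weights (p : nat) (A Q : R) (X q : 'I_p.+1 -> R) (j : 'I_p.+1) : (0 < p)%N ->
  0 <= A -> (forall i, 0 <= X i) -> (forall i, 0 <= q i) -> (forall i, q i <= Q) ->
  \prod_(i < p.+1 | i != j) (A * (X i * q i `^ p%:R^-1)) <=
  A ^+ p * (\prod_(i < p.+1 | i != j) X i * Q).
Proof.
move=> p0 A0 X0 q0 qQ; have Q0 : 0 <= Q by exact: le_trans (qQ j).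
have card : #|[pred i : 'I_p.+1 | i != j]| = p by rewrite cardC1 card_ord.
apply: (@le_trans _ _ (\prod_(i < p.+1 | i != j) (A * (X i * Q `^ p%:R^-1)))).
  apply: ler_prod => i _; rewrite !mulr_ge0 ?powR_ge0//=.
  by rewrite !ler_wpM2l// ge0_ler_powR ?nnegrE// invr_ge0.
rewrite big_split /= prodr_const card big_split /= prodr_const card.
by rewrite powR_exprn mulVf ?powRr1// pnatr_eq0 -lt0n.
Qed.

Lemma sqr_sum_le (m : nat) (a : 'I_m -> R) :
  (\sum_(i < m) a i) ^+ 2 <= m%:R * \sum_(i < m) a i ^+ 2.
Proof.
elim: m a => [|[|m] IH] a; first by rewrite !big_ord0 expr0n mulr0.
  by rewrite !big_ord_recr !big_ord0 /= !add0r mul1r.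
rewrite (big_ord_recr m.+1) [in leRHS](big_ord_recr m.+1) /=.
have := IH (fun i => a (widen_ord (leqnSn m.+1) i)).
set S := \sum_(i < m.+1) _; set T := \sum_(i < m.+1) _ => H.
have mR : 0 < m.+1%:R :> R by rewrite ltr0n.
rewrite -[m.+2%:R]natr1; move: (a ord_max) (m.+1%:R) mR H => v M mR H.
(* [2 S v <= S ^ 2 / m + m v ^ 2] *)
have h1 : S ^+ 2 / M <= T by rewrite ler_pdivrMr// mulrC.
have h2 : 0 <= (S / M - v) ^+ 2 * M by rewrite mulr_ge0 ?sqr_ge0// ltW.
have h3 : (S / M - v) ^+ 2 * M = S ^+ 2 / M - 2 * S * v + M * v ^+ 2.
  by field; rewrite gt_eqF.
rewrite h3 in h2; rewrite sqrrD -mulr_natl mulrA; lra.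
Qed.

Lemma jointly_measurable_prod (m : nat) (u : 'I_m -> R -> R -> C) :
  (forall i, jointly_measurable (u i)) ->
  jointly_measurable (fun t y => \prod_(i < m) u i t y).
Proof.
elim: m u => [|m IH] u mu_.
  by split; under eq_fun do rewrite big_ord0; exact: measurable_cst.
have [r0 i0] := mu_ ord0; have [r1 i1] := IH (fun i => u (lift ord0 i)) (fun i => mu_ _).
split.
  rewrite (_ : (fun q : R * R => _) = (fun q : R * R =>
    complex.Re (u ord0 q.1 q.2) * complex.Re (\prod_(i < m) u (lift ord0 i) q.1 q.2) -
    complex.Im (u ord0 q.1 q.2) * complex.Im (\prod_(i < m) u (lift ord0 i) q.1 q.2))).
    by apply: measurable_funB; exact: measurable_funM.
  by apply/funext => q; rewrite big_ord_recl; case: (u ord0 _ _) => a b; case: (\prod_(i < m) _).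
rewrite (_ : (fun q : R * R => _) = (fun q : R * R =>
  complex.Re (u ord0 q.1 q.2) * complex.Im (\prod_(i < m) u (lift ord0 i) q.1 q.2) +
  complex.Im (u ord0 q.1 q.2) * complex.Re (\prod_(i < m) u (lift ord0 i) q.1 q.2))).
  by apply: measurable_funD; exact: measurable_funM.
by apply/funext => q; rewrite big_ord_recl; case: (u ord0 _ _) => a b; case: (\prod_(i < m) _).
Qed.

Lemma jointly_measurableB (u v : R -> R -> C) : jointly_measurable u -> jointly_measurable v ->
  jointly_measurable (fun t y => u t y - v t y).
Proof.
move=> [ur ui] [vr vi]; split.
  rewrite (_ : (fun q : R * R => _) = (fun q : R * R =>
    complex.Re (u q.1 q.2) - complex.Re (v q.1 q.2))); first exact: measurable_funB.
  by apply/funext => q; case: (u _ _) => a b; case: (v _ _).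
rewrite (_ : (fun q : R * R => _) = (fun q : R * R =>
  complex.Im (u q.1 q.2) - complex.Im (v q.1 q.2))); first exact: measurable_funB.
by apply/funext => q; case: (u _ _) => a b; case: (v _ _).
Qed.

Lemma measurable_slice (u : R -> R -> C) (t : R) : jointly_measurable u ->
  measurable_fun setT (fun y => complex.Re (u t y)) /\
  measurable_fun setT (fun y => complex.Im (u t y)).
Proof.
move=> [ur ui]; split.
  exact: (@measurable_pair1 R _ R (fun t y => complex.Re (u t y)) t ur).
exact: (@measurable_pair1 R _ R (fun t y => complex.Im (u t y)) t ui).
Qed.

Variable phi : R -> R.
Hypothesis Hphi : admissible_cutoff phi.
Local Notation ker3 := (@ker3 R phi).

(** Each complex factor consumes 2 * 2^K of the frequency range; real and imaginary parts are
    carried through the induction together, as multiplication mixes them. *)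
Lemma invisible_prod (p K n : _) (x t : R) (m : nat) (u : 'I_m -> R -> R -> C) : (0 < p)%N ->
  (forall i, slice_Lp p (u i) t) ->
  invisible phi n x (dy n / 2 - m%:R * (2 * dy K))
    (fun y => complex.Re (\prod_(i < m) lowpass phi K (u i) t y)) /\
  invisible phi n x (dy n / 2 - m%:R * (2 * dy K))
    (fun y => complex.Im (\prod_(i < m) lowpass phi K (u i) t y)).
Proof.
move=> p0; elim: m u => [|m IH] u ut.
  rewrite mul0r subr0; have I1 := invisible_one Hphi n x.
  split; first by under eq_fun do rewrite big_ord0.
  have := invisible_lin Hphi 0 0 I1 I1; congr invisible; apply/funext => y.
  by rewrite big_ord0 /= !mul0r addr0.
have [Ir Ii] := IH (fun i => u (lift ord0 i)) (fun i => ut _).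
have [ur ui] := ut ord0.
rewrite -[m.+1%:R]natr1 mulrDl mul1r opprD addrA.
have Irr := invisible_mul Hphi K p0 ur Ir; have Iri := invisible_mul Hphi K p0 ui Ir.
have Iir := invisible_mul Hphi K p0 ur Ii; have Iii := invisible_mul Hphi K p0 ui Ii.
split.
  have := invisible_lin Hphi 1 (-1) Irr Iii; congr invisible; apply/funext => y.
  rewrite big_ord_recl mul1r mulN1r; case: (\prod_(i < m) _) => a b /=.
  by rewrite mulrC; congr (_ - _); rewrite mulrC.
have := invisible_lin Hphi 1 1 Iri Iir; congr invisible; apply/funext => y.
rewrite big_ord_recl !mul1r; case: (\prod_(i < m) _) => a b /=.
by rewrite mulrC addrC; congr (_ + _); rewrite mulrC.
Qed.

End Products.

(** * Subtracting an annihilated function under the kernel *)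

Section KernelEstimate.
Variable R : realType.
Local Notation mu := (@lebesgue_measure R).
Local Notation dy := (dyad R).
Variable phi : R -> R.
Hypothesis Hphi : admissible_cutoff phi.
Local Notation ker3 := (@ker3 R phi).
Local Open Scope ereal_scope.

Lemma PND3_conv n (F : R -> R -> R[i]) t x : PND3 phi n F t x =
  Complex (conv (ker3 n) (fun y => complex.Re (F t y)) x)
          (conv (ker3 n) (fun y => complex.Im (F t y)) x).
Proof.
rewrite /PND3 /mult_op /cint; congr Complex; apply: eq_Rint => y;
  rewrite (mult_kernel_PND3 Hphi); case: (F t y) => a b /=; rewrite !mul0r ?subr0 ?addr0//.
Qed.

(** Since the kernel annihilates r, it may be subtracted before absolute values are taken, that is
    while the cancellation is still available. *)
Lemma conv_ker3_invisible (n : int) (x B : R) (h r : R -> R) : (0 <= B)%R ->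
  integrableR (fun y : R => ker3 n (x - y) * h y)%R -> invisible phi n x B r ->
  (`|conv (ker3 n) h x|)%:E <= \int[mu]_y (`|ker3 n (x - y)| * `|h y - r y|)%:E.
Proof.
move=> B0 ih ir; have [mr rb r0] := ir.
have ir' : integrableR (fun y : R => ker3 n (x - y) * r y)%R.
  exact: (integrable_ker3_bounded Hphi n x mr rb).
have E : conv (ker3 n) h x = Rint (fun y : R => ker3 n (x - y) * (h y - r y))%R.
  rewrite -[LHS]subr0 -(invisible_ker3 B0 ir) /conv -RintB//.
  by apply: eq_Rint => y; rewrite mulrBr.
have id : integrableR (fun y : R => ker3 n (x - y) * (h y - r y))%R.
  have := integrableRB ih ir'; congr integrableR; apply/funext => y.
  by rewrite mulrBr.
rewrite E; apply: (@le_trans _ _ (Rint (fun y => `|ker3 n (x - y) * (h y - r y)|)%R)%:E).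
  by rewrite lee_fin; exact: normr_Rint.
rewrite -EFin_Rint; last exact: integrableR_norm.
by under eq_integral do rewrite normrM.
Qed.

Lemma PND3_invisible (n : int) (x B : R) (t : R) (F G : R -> R -> R[i]) : (0 <= B)%R ->
  jointly_measurable F -> jointly_measurable G ->
  mu.-integrable setT (fun y => (cabs (mult_kernel (PND3_symbol phi n) (x - y) * F t y))%:E) ->
  invisible phi n x B (fun y => complex.Re (G t y)) ->
  invisible phi n x B (fun y => complex.Im (G t y)) ->
  (cabs (PND3 phi n F t x))%:E <=
    2%:E * \int[mu]_y (`|ker3 n (x - y)| * cabs (F t y - G t y))%:E.
Proof.
move=> B0 jF jG iF Ir Ii.
have [mr mi] := measurable_slice t jF; have [mgr mgi] := measurable_slice t jG.
have [mdr mdi] := measurable_slice t (jointly_measurableB jF jG).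
have mk : measurable_fun setT (fun y : R => `|ker3 n (x - y)|%R).
  apply: measurableT_comp => //; apply: measurableT_comp; last exact: measurable_subl.
  exact: measurable_ker3.
have md : measurable_fun setT (fun y : R => (`|ker3 n (x - y)| * cabs (F t y - G t y))%:E).
  apply/measurable_EFinP; apply: measurable_funM => //.
  exact: (measurable_cabs (f := fun y => F t y - G t y)%R).
have dom (y : R) : cabs (mult_kernel (PND3_symbol phi n) (x - y) * F t y)%R =
    (`|ker3 n (x - y)| * cabs (F t y))%R.
  by rewrite cabsM (mult_kernel_PND3 Hphi) {1}/cabs /= expr0n addr0 sqrtr_sqr.
have iF' : integrableR (fun y : R => `|ker3 n (x - y)| * cabs (F t y))%R.
  by move: iF; congr (_.-integrable _ _); apply/funext => y /=; rewrite dom.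
have irF : integrableR (fun y : R => ker3 n (x - y) * complex.Re (F t y))%R.
  apply: integrableR_dom iF' _; first by apply: conv_arg_measurable => //; exact: measurable_ker3.
  by move=> y; rewrite normrM ler_wpM2l ?norm_Re_le.
have iiF : integrableR (fun y : R => ker3 n (x - y) * complex.Im (F t y))%R.
  apply: integrableR_dom iF' _; first by apply: conv_arg_measurable => //; exact: measurable_ker3.
  by move=> y; rewrite normrM ler_wpM2l ?norm_Im_le.
have bnd (h r : R -> R) : measurable_fun setT h -> measurable_fun setT r ->
    integrableR (fun y : R => ker3 n (x - y) * h y)%R -> invisible phi n x B r ->
    (forall y, `|h y - r y| <= cabs (F t y - G t y))%R ->
    (`|conv (ker3 n) h x|)%:E <= \int[mu]_y (`|ker3 n (x - y)| * cabs (F t y - G t y))%:E.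
  move=> mh mr' ih ir hr; apply: le_trans (conv_ker3_invisible B0 ih ir) _.
  apply: ge0_le_integral => //.
  - apply/measurable_EFinP; apply: measurable_funM => //.
    by apply: measurableT_comp => //; exact: measurable_funB.
  - by move=> y _; rewrite lee_fin ler_wpM2l.
rewrite PND3_conv; apply: (@le_trans _ _ ((`|conv (ker3 n) (fun y => complex.Re (F t y)) x|)%:E +
    (`|conv (ker3 n) (fun y => complex.Im (F t y)) x|)%:E)).
  by rewrite -EFinD lee_fin; exact: cabs_le_ReIm.
rewrite mule_natl mule2n.
apply: leeD; [apply: (bnd _ _ mr mgr irF Ir) => y|apply: (bnd _ _ mi mgi iiF Ii) => y].
  by apply: le_trans (norm_Re_le _); case: (F t y) => a b; case: (G t y).
by apply: le_trans (norm_Im_le _); case: (F t y) => a b; case: (G t y).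
Qed.

Lemma measurable_cabs_PND3 n F : jointly_measurable F ->
  measurable_fun setT (fun q : R * R => cabs (PND3 phi n F q.1 q.2)).
Proof.
move=> [mr mi]; have mk := measurable_ker3 Hphi n.
apply: (measurable_cabs (f := fun q : R * R => PND3 phi n F q.1 q.2));
  (under eq_fun do rewrite PND3_conv /=).
  exact: (measurable_conv_param (f := fun t y => complex.Re (F t y)) mk mr).
exact: (measurable_conv_param (f := fun t y => complex.Im (F t y)) mk mi).
Qed.

End KernelEstimate.

(** * The estimate at one output frequency *)

Section SpaceTimeEstimate.
Variable R : realType.
Local Notation mu := (@lebesgue_measure R).
Local Notation dy := (dyad R).
Variable phi : R -> R.
Hypothesis Hphi : admissible_cutoff phi.
Local Notation ker3 := (@ker3 R phi).
Variable p : nat.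
Hypothesis p5 : (5 <= p)%N.
Let p0 : (0 < p)%N. Proof. exact: leq_trans p5. Qed.
(* With [2 ^ J >= 4 * p.+1] a product of [p.+1] functions of frequency at most 2 ^ (n - J + 1)
   stays below 2 ^ n / 2, where psi_n vanishes. *)
Let J : nat := (4 * p.+1)%N.
Let sc : R := 2^-1 - p%:R^-1.
Local Open Scope ereal_scope.

Let shrink (n : int) : (0 <= dy n / 2 - p.+1%:R * (2 * dy (n - J%:Z)))%R.
Proof.
rewrite dyadD dyad_neg subr_ge0.
have h : (4 * p.+1%:R <= 2 ^+ J :> R)%R.
  by rewrite -natrM -natrX ler_nat ltnW// ltn_expl.
have q0 : (0 < 2 ^+ J :> R)%R by rewrite exprn_gt0.
rewrite ler_pdivlMr// (_ : (_ * 2 = 4 * p.+1%:R * dy n / 2 ^+ J)%R); last by ring.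
by rewrite ler_pdivrMr// mulrC ler_wpM2l// dyad_ge0.
Qed.

(** The mass 2^(3n) is the cost of three derivatives at frequency 2^n. *)
Lemma integral_ker3 : exists2 C : R, (0 <= C)%R & forall n y,
  \int[mu]_x (`|ker3 n (x - y)|)%:E <= (C * dy n ^+ 3)%:E.
Proof.
have [C C0 HC] := ker3_bound Hphi; exists (C * pi)%R; first by rewrite mulr_ge0 ?pi_ge0.
move=> n y; have d0 := dyad_gt0 R n.
have c0 : (0 <= C * dy n ^+ 3)%R by rewrite mulr_ge0 ?exprn_ge0 ?dyad_ge0.
have ml : measurable_fun setT (fun x : R => lor (dy n) (y - x)).
  by apply: measurableT_comp; [exact: measurable_lor|exact: measurable_subl].
apply: (@le_trans _ _ (\int[mu]_x (C * dy n ^+ 3 * lor (dy n) (y - x))%:E)).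
  apply: ge0_le_integral => //.
  - apply/measurable_EFinP; apply: measurableT_comp => //.
    apply: measurableT_comp; first exact: measurable_ker3.
    exact: measurable_funB.
  - by apply/measurable_EFinP; exact: measurable_funM.
  - by move=> x _; rewrite lee_fin -lorN opprB.
under eq_integral => x _ do rewrite EFinM.
rewrite ge0_integralZl_EFin//; last 2 first.
- by move=> x _; rewrite lee_fin lor_ge0// ltW.
- exact/measurable_EFinP.
have mlE : measurable_fun setT (fun x : R => (lor (dy n) x)%:E).
  by apply/measurable_EFinP; exact: measurable_lor.
rewrite (ge0_integral_subl y mlE); last by move=> x; rewrite lee_fin lor_ge0// ltW.
by rewrite integral_lor// -EFinM lee_fin mulrAC.
Qed.

Section Family.
Variable u : 'I_p.+1 -> R -> R -> R[i].
Hypothesis au : forall i, admissible_fun p.+1 (u i).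
Hypothesis Xu : forall i, Xdot phi sc (u i) < +oo.
Let F t y : R[i] := (\prod_(i < p.+1) u i t y)%R.
Hypothesis D3 : D3_well_defined phi F.

Let ju i : jointly_measurable (u i). Proof. by case: (au i) => mr [mi _]. Qed.
Let low (K : int) t y : R[i] := (\prod_(i < p.+1) lowpass phi K (u i) t y)%R.
(** One weight for all choices of the distinguished factor: it dominates each density, and its mass
    is at most p + 1. *)
Let Q (y : R) : R := (\sum_(i < p.+1) dens phi p (u i) y)%R.
Let w n (x y : R) : R := (`|ker3 n (x - y)| * Q y)%R.
Let W n (x : R) := \int[mu]_y (w n x y)%:E.
Definition coprod (j : 'I_p.+1) : R := (\prod_(i < p.+1 | i != j) fine (Xdot phi sc (u i)))%R.
Let T (n : int) (t y : R) := \sum_(j < p.+1) (coprod j ^+ 2)%:E * tail phi (u j) (n - J%:Z) t y.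

Lemma coprod_ge0 j : (0 <= coprod j)%R.
Proof. by apply: prodr_ge0 => i _; exact/fine_ge0/Xdot_ge0. Qed.

Let Q0 y : (0 <= Q y)%R.
Proof. by apply: sumr_ge0 => i _; exact: dens_ge0. Qed.

Let mQ : measurable_fun setT Q.
Proof. by apply: measurable_sum => i; exact: measurable_dens (au i). Qed.

Let w0 n x y : (0 <= w n x y)%R.
Proof. exact: mulr_ge0. Qed.

Let mw2 n : measurable_fun setT (fun q : R * R => w n q.1 q.2).
Proof.
apply: measurable_funM; last by apply: measurableT_comp.
apply: measurableT_comp => //; apply: measurableT_comp; first exact: measurable_ker3.
exact: measurable_funB.
Qed.

Let mw n x : measurable_fun setT (w n x).
Proof. exact: (@measurable_pair1 R _ R (w n) x (mw2 n)). Qed.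

Let T0 n t y : 0 <= T n t y.
Proof. by apply: sume_ge0 => j _; rewrite mule_ge0 ?tail_ge0// lee_fin sqr_ge0. Qed.

Let mT n : measurable_fun setT (fun q : R * R => T n q.1 q.2).
Proof.
apply: emeasurable_sum => j; apply: emeasurable_funM; first exact: measurable_cst.
exact: measurable_tail.
Qed.

Let mT1 n t : measurable_fun setT (T n t).
Proof. exact: (measurableT_comp (mT n) (pair1_measurable t)). Qed.

Let mT2 n y : measurable_fun setT (fun t => T n t y).
Proof. exact: (measurableT_comp (mT n) (pair2_measurable y)). Qed.

Lemma integral_Q : \int[mu]_y (Q y)%:E <= p.+1%:R%:E.
Proof.
rewrite /Q; under eq_integral => y _ do rewrite -sumEFin.
rewrite ge0_integral_sum//; last 2 first.
- by move=> i; apply/measurable_EFinP; exact: measurable_dens (au i).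
- by move=> i y _; rewrite lee_fin dens_ge0.
apply: (@le_trans _ _ (\sum_(i < p.+1) 1)).
  by apply: lee_sum => i _; exact: integral_dens (au i) (Xu i).
by rewrite sumEFin lee_fin sumr_const card_ord.
Qed.

Variable Cf : R.
Hypothesis Cf0 : (0 <= Cf)%R.
Hypothesis control : forall i, {ae mu, forall t, slice_Lp p (u i) t /\
  {ae mu, forall y, controlled phi p Cf (u i) t y}}.

(** The constant collects a 2, squared, from real and imaginary parts, a p + 1 from the square of
    the sum over j, and the control constant of p factors, squared. *)
Lemma PND3_pointwise : {ae mu, forall t, forall n x,
  (cabs (PND3 phi n F t x))%:E * (cabs (PND3 phi n F t x))%:E <=
  (4 * p.+1%:R * Cf ^+ p ^+ 2)%:E * (W n x * \int[mu]_y ((w n x y)%:E * T n t y))}.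
Proof.
apply: ae_imp (ae_and D3 (ae_forall_ord control)) => t [it ct] n x.
have ut i : slice_Lp p (u i) t by case: (ct i).
have cy := ae_forall_ord (fun i => (ct i).2).
pose K : int := (n - J%:Z)%R.
have [Ir Ii] := invisible_prod Hphi K n x p0 ut.
have jF : jointly_measurable F by exact: jointly_measurable_prod.
have jl i : jointly_measurable (lowpass phi K (u i)) by exact: measurable_lowpass.
have jG : jointly_measurable (low K) by exact: jointly_measurable_prod.
have H := PND3_invisible Hphi (shrink n) jF jG (it n x) Ir Ii.
pose d j y : R := cabs (u j t y - lowpass phi K (u j) t y)%R.
pose D (y : R) : R := (\sum_(j < p.+1) coprod j * d j y)%R.
have d0 j y : (0 <= d j y)%R by exact: cabs_ge0.
have D0 y : (0 <= D y)%R by apply: sumr_ge0 => j _; rewrite mulr_ge0 ?coprod_ge0.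
have md j : measurable_fun setT (d j).
  have [m1 m2] := measurable_slice t (jointly_measurableB (ju j) (jl j)).
  exact: (measurable_cabs m1 m2).
have mD : measurable_fun setT D.
  by apply: measurable_sum => j; apply: measurable_funM => //; exact: measurable_cst.
have mwD : measurable_fun setT (fun y => (w n x y * D y)%:E).
  by apply/measurable_EFinP; apply: measurable_funM; [exact: mw|exact: mD].
have mwD2 : measurable_fun setT (fun y => (w n x y * D y ^+ 2)%:E).
  apply/measurable_EFinP; apply: measurable_funM; first exact: mw.
  by apply: measurable_funX.
have mwT : measurable_fun setT (fun y => (w n x y)%:E * T n t y).
  by apply: emeasurable_funM; [apply/measurable_EFinP; exact: mw|exact: mT1].
have [mf1 mf2] := measurable_slice t (jointly_measurableB jF jG).
(* The product of low parts is subtracted and the products telescoped; the p untouched factors give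
   [Cf ^+ p], [coprod j] and the weight Q. *)
have I1 : \int[mu]_y (`|ker3 n (x - y)| * cabs (F t y - low K t y))%:E <=
    (Cf ^+ p)%:E * \int[mu]_y (w n x y * D y)%:E.
  rewrite -ge0_integralZl_EFin//; last 2 first.
  - by move=> y _; rewrite lee_fin mulr_ge0.
  - by rewrite exprn_ge0.
  apply: ae_ge0_le_integral => //.
  - by move=> y _; rewrite lee_fin mulr_ge0 ?cabs_ge0.
  - apply/measurable_EFinP; apply: measurable_funM; last exact: (measurable_cabs mf1 mf2).
    apply: measurableT_comp => //; apply: measurableT_comp; last exact: measurable_subl.
    exact: measurable_ker3.
  - by move=> y _; rewrite mule_ge0 ?lee_fin ?exprn_ge0// mulr_ge0.
  - by apply: emeasurable_funM.
  apply: ae_imp cy => y cy _; rewrite -EFinM lee_fin.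
  have c1 i := cy i; rewrite /controlled /= in c1.
  rewrite /w -mulrA mulrCA ler_wpM2l//.
  apply: le_trans (prod_telescope (b := fun i => (Cf * (fine (Xdot phi sc (u i)) *
    dens phi p (u i) y `^ p%:R^-1))%R) _ _) _ => [i|i|].
  - by case: (c1 i).
  - by case: (c1 i).
  rewrite /D !mulr_sumr; apply: ler_sum => j _.
  rewrite [leRHS](_ : _ = d j y * (Cf ^+ p * (coprod j * Q y)))%R; last by ring.
  rewrite ler_wpM2l ?d0//; apply: prod_weights => // i.
  - exact/fine_ge0/Xdot_ge0.
  - exact: dens_ge0.
  - by rewrite /Q (bigD1 i)//= lerDl sumr_ge0// => k _; exact: dens_ge0.
(* The square falls on the high-frequency differences only, so each can be replaced by its
   [tail]. *)
have I2 : \int[mu]_y (w n x y * D y ^+ 2)%:E <=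
    p.+1%:R%:E * \int[mu]_y ((w n x y)%:E * T n t y).
  rewrite -ge0_integralZl_EFin//; last by move=> y _; rewrite mule_ge0 ?lee_fin.
  apply: ae_ge0_le_integral => //.
  - by move=> y _; rewrite lee_fin mulr_ge0 ?sqr_ge0.
  - by move=> y _; rewrite mule_ge0 ?lee_fin// mule_ge0 ?lee_fin.
  - by apply: emeasurable_funM.
  apply: ae_imp cy => y cy _.
  rewrite muleCA EFinM; apply: lee_wpmul2l; first by rewrite lee_fin.
  apply: (@le_trans _ _ (p.+1%:R * \sum_(j < p.+1) (coprod j * d j y) ^+ 2)%:E).
    by rewrite lee_fin; exact: sqr_sum_le.
  rewrite EFinM; apply: lee_wpmul2l; first by rewrite lee_fin.
  rewrite -sumEFin; apply: lee_sum => j _.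
  rewrite exprMn EFinM; apply: lee_wpmul2l; first by rewrite lee_fin sqr_ge0.
  by have [_ _] := cy j; exact.
have CS := Cauchy_Schwarz_weight (mw n x) mD (w0 n x) D0.
set I := \int[mu]_y (w n x y * D y)%:E in I1 CS.
have I0 : 0 <= I by apply: integral_ge0 => y _; rewrite lee_fin mulr_ge0.
have {}H : (cabs (PND3 phi n F t x))%:E <= (2 * Cf ^+ p)%:E * I.
  apply: le_trans H _; rewrite EFinM -muleA; apply: lee_wpmul2l => //.
have a0 : 0 <= (cabs (PND3 phi n F t x))%:E by rewrite lee_fin cabs_ge0.
apply: le_trans (lee_pmul a0 a0 H H) _.
rewrite muleACA -EFinM (_ : 2 * _ * _ = 4 * (Cf ^+ p) ^+ 2)%R; last by ring.
apply: le_trans (lee_wpmul2l _ CS) _; first by rewrite lee_fin mulr_ge0 ?sqr_ge0.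
apply: (@le_trans _ _ ((4 * (Cf ^+ p) ^+ 2)%:E * (W n x * (p.+1%:R%:E * \int[mu]_y ((w n x y)%:E * T n t y))))).
  apply: lee_wpmul2l; first by rewrite lee_fin mulr_ge0 ?sqr_ge0.
  apply: lee_wpmul2l => //; apply: integral_ge0 => y _; by rewrite lee_fin.
by rewrite (muleCA (W n x)) [leLHS]muleA -EFinM (mulrAC 4%R).
Qed.

Definition tail_mass (j : 'I_p.+1) (K : int) : \bar R :=
  \sum_(i <oo) (2 ^+ i.+1 * dy (K + i.+1%:Z)%R ^- 3 * xnorm phi (u j) (K + i.+1%:Z)%R ^+ 2)%:E.

Let H (n : int) : \bar R := \sum_(j < p.+1) (coprod j ^+ 2)%:E * tail_mass j (n - J%:Z).

Lemma tail_mass_ge0 j K : 0 <= tail_mass j K.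
Proof.
apply: nneseries_ge0 => i _ _; rewrite lee_fin mulr_ge0 ?sqr_ge0//.
by rewrite mulr_ge0 ?exprn_ge0// invr_ge0 exprn_ge0// dyad_ge0.
Qed.

Let H0 n : 0 <= H n.
Proof. by apply: sume_ge0 => j _; rewrite mule_ge0 ?tail_mass_ge0// lee_fin sqr_ge0. Qed.

Let integral_T : {ae mu, forall y, forall n, \int[mu]_t T n t y <= H n}.
Proof.
have := ae_forall_ord (fun j => integral_tail Hphi (ju j) (Xu j)); apply: ae_imp => y Hy n.
have mt j : measurable_fun setT (fun t => tail phi (u j) (n - J%:Z) t y).
  exact: (measurableT_comp (measurable_tail Hphi (n - J%:Z) (ju j)) (pair2_measurable y)).
rewrite /T ge0_integral_sum//; last 2 first.
- by move=> j; apply: emeasurable_funM; [exact: measurable_cst|exact: mt].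
- by move=> j t _; rewrite mule_ge0 ?tail_ge0// lee_fin sqr_ge0.
apply: lee_sum => j _; rewrite ge0_integralZl_EFin ?sqr_ge0//; last 2 first.
- by move=> t _; exact: tail_ge0.
- exact: mt.
by apply: lee_wpmul2l; [rewrite lee_fin sqr_ge0|exact: Hy].
Qed.

Let A : R := (4 * p.+1%:R * Cf ^+ p ^+ 2)%R.
Let A0 : (0 <= A)%R. Proof. by rewrite mulr_ge0 ?sqr_ge0// mulr_ge0. Qed.
Let W0 n x : 0 <= W n x.
Proof. by apply: integral_ge0 => y _; rewrite lee_fin. Qed.

Let mwE n x : measurable_fun setT (fun y => (w n x y)%:E).
Proof. by apply/measurable_EFinP; exact: mw. Qed.

Let mW n : measurable_fun setT (W n).
Proof.
have mw2E : measurable_fun setT (fun q : R * R => (w n q.1 q.2)%:E).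
  by apply/measurable_EFinP; exact: mw2.
by apply: (measurable_fun_fubini_tonelli_F (m2 := mu) (fun q : R * R => (w n q.1 q.2)%:E)) => // q;
  rewrite lee_fin.
Qed.

(** The bound [H n] on the time integral of [T] is uniform in y, so after Tonelli the remaining
    integral is [W n x] again. The result is a perfect square in W, whose root is integrable in
    x. *)
Lemma PND3_L2 n x : \int[mu]_t (cabs (PND3 phi n F t x) ^+ 2)%:E <= A%:E * (W n x * W n x * H n).
Proof.
have jF : jointly_measurable F by exact: jointly_measurable_prod.
have mc : measurable_fun setT (fun t => (cabs (PND3 phi n F t x) ^+ 2)%:E).
  apply/measurable_EFinP; apply: measurable_funX.
  exact: (@measurable_pair2 R _ R (fun t x => cabs (PND3 phi n F t x)) x (measurable_cabs_PND3 Hphi n jF)).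
pose g (q : R * R) := (w n x q.2)%:E * T n q.1 q.2.
have mg : measurable_fun setT g.
  apply: emeasurable_funM => //.
  by apply/measurable_EFinP; apply: (measurableT_comp (mw n x)); exact: measurable_snd.
have g0 q : 0 <= g q by rewrite mule_ge0 ?lee_fin.
have mG : measurable_fun setT (fun t => \int[mu]_y g (t, y)).
  exact: (measurable_fun_fubini_tonelli_F (m2 := mu) g mg g0).
have G0 t : 0 <= \int[mu]_y g (t, y) by exact: integral_ge0.
apply: (@le_trans _ _ (\int[mu]_t (A%:E * (W n x * \int[mu]_y g (t, y))))).
  apply: ae_ge0_le_integral => //.
  - by move=> t _; rewrite lee_fin sqr_ge0.
  - by move=> t _; rewrite mule_ge0 ?lee_fin// mule_ge0.
  - apply: emeasurable_funM; first exact: measurable_cst.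
    by apply: emeasurable_funM; first exact: measurable_cst.
  apply: ae_imp PND3_pointwise => t Ht _.
  by rewrite expr2 EFinM; exact: Ht.
rewrite ge0_integralZl_EFin//; last 2 first.
- by move=> t _; rewrite mule_ge0.
- by apply: emeasurable_funM; first exact: measurable_cst.
apply: lee_wpmul2l; first by rewrite lee_fin.
rewrite ge0_integralZl// -muleA; apply: lee_wpmul2l => //.
rewrite (@fubini_tonelli _ _ _ _ _ mu mu g mg g0) /g /=.
apply: (@le_trans _ _ (\int[mu]_y ((w n x y)%:E * H n))).
  apply: ae_ge0_le_integral; first exact: measurableT.
  - by move=> y _; apply: integral_ge0 => t _; apply: mule_ge0; [rewrite lee_fin|exact: T0].
  - exact: (measurable_fun_fubini_tonelli_G (m1 := mu) g mg g0).
  - by move=> y _; apply: mule_ge0; [rewrite lee_fin|exact: H0].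
  - by apply: emeasurable_funM; [exact: mwE|exact: measurable_cst].
  apply: ae_imp integral_T => y Hy _.
  have -> : \int[mu]_t ((w n x y)%:E * T n t y) = (w n x y)%:E * \int[mu]_t T n t y.
    by apply: ge0_integralZl_EFin; [exact: measurableT|move=> t _; exact: T0|exact: mT2|exact: w0].
  by apply: lee_wpmul2l; [rewrite lee_fin|exact: Hy].
rewrite ge0_integralZr; [exact: lexx|exact: measurableT|exact: mwE| |exact: H0].
by move=> y _; rewrite lee_fin.
Qed.

Variable C3 : R.
Hypothesis C30 : (0 <= C3)%R.
Hypothesis ker3_mass : forall n y, \int[mu]_x (`|ker3 n (x - y)|)%:E <= (C3 * dy n ^+ 3)%:E.

Lemma integral_W n : \int[mu]_x W n x <= (p.+1%:R * (C3 * dy n ^+ 3))%:E.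
Proof.
have c0 : (0 <= C3 * dy n ^+ 3)%R by rewrite mulr_ge0 ?exprn_ge0 ?dyad_ge0.
pose g (q : R * R) := (w n q.1 q.2)%:E.
have mg : measurable_fun setT g by apply/measurable_EFinP; exact: mw2.
have g0 q : 0 <= g q by rewrite lee_fin.
rewrite [leLHS](_ : _ = \int[mu]_x \int[mu]_y g (x, y))// (@fubini_tonelli _ _ _ _ _ mu mu g mg g0) /g /=.
have mQE : measurable_fun setT (fun y => (Q y)%:E) by exact/measurable_EFinP.
have mk y : measurable_fun setT (fun x : R => (`|ker3 n (x - y)|)%:E).
  apply/measurable_EFinP; apply: measurableT_comp => //.
  by apply: measurableT_comp; [exact: measurable_ker3|exact: measurable_funB].
apply: (@le_trans _ _ (\int[mu]_y ((Q y)%:E * (C3 * dy n ^+ 3)%:E))).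
  apply: ge0_le_integral => //.
  - by move=> y _; apply: integral_ge0 => x _; rewrite lee_fin.
  - exact: (measurable_fun_fubini_tonelli_G (m1 := mu) g mg g0).
  - by apply: emeasurable_funM; last exact: measurable_cst.
  move=> y _; rewrite (_ : \int[mu]_x _ = \int[mu]_x ((Q y)%:E * (`|ker3 n (x - y)|)%:E)); last first.
    by apply: eq_integral => x _; rewrite /w mulrC EFinM.
  have -> : \int[mu]_x ((Q y)%:E * (`|ker3 n (x - y)|)%:E) = (Q y)%:E * \int[mu]_x (`|ker3 n (x - y)|)%:E.
    by apply: ge0_integralZl_EFin; [exact: measurableT|move=> t _; rewrite lee_fin|exact: mk|exact: Q0].
  by apply: lee_wpmul2l; [rewrite lee_fin|exact: ker3_mass].
rewrite ge0_integralZr; [|exact: measurableT|exact: mQE| |by rewrite lee_fin]; last first.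
  by move=> y _; rewrite lee_fin.
by rewrite [leRHS]EFinM; apply: lee_wpmul2r; [rewrite lee_fin|exact: integral_Q].
Qed.

Lemma LxLt12 (v : R -> R -> R[i]) : LxLt 1%:E 2%:E v =
  \int[mu]_x ((\int[mu]_t (cabs (v t x) ^+ 2)%:E) `^ 2^-1).
Proof.
rewrite /LxLt (_ : (fun x => eLnorm _ _) =
  fun x => (\int[mu]_t (cabs (v t x) ^+ 2)%:E) `^ 2^-1); last first.
  by apply/funext => x; apply: (eLnorm_inner_nat (n := 2)) => // t; exact: cabs_ge0.
rewrite /eLnorm invr1 poweRe1; last by apply: integral_ge0 => x _; exact: poweR_ge0.
by apply: eq_integral => x _; rewrite poweRe1 ?poweR_ge0.
Qed.

(** Balance of powers: 2^(-3n) from the squared norm and 2^(6n) from the squared mass of W leave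
    2^(3n). *)
Lemma ZN_le n : ZN (dy n) (PND3 phi n F) * ZN (dy n) (PND3 phi n F) <=
  (A * (p.+1%:R * C3) ^+ 2 * dy n ^+ 3)%:E * H n.
Proof.
have d0 := dyad_gt0 R n.
set B := (p.+1%:R * (C3 * dy n ^+ 3))%R.
have B0 : (0 <= B)%R by rewrite !mulr_ge0 ?exprn_ge0 ?dyad_ge0.
have AH0 : 0 <= A%:E * H n by rewrite mule_ge0 ?lee_fin.
have L : LxLt 1%:E 2%:E (PND3 phi n F) <= (A%:E * H n) `^ 2^-1 * B%:E.
  have jF : jointly_measurable F by exact: jointly_measurable_prod.
  pose g (q : R * R) := (cabs (PND3 phi n F q.1 q.2) ^+ 2)%:E.
  have mg : measurable_fun setT g.
    by apply/measurable_EFinP; apply: measurable_funX; exact: measurable_cabs_PND3.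
  have g0 q : 0 <= g q by rewrite lee_fin sqr_ge0.
  have mG := measurable_fun_fubini_tonelli_G (m1 := mu) g mg g0.
  rewrite LxLt12; apply: (@le_trans _ _ (\int[mu]_x ((A%:E * H n) `^ 2^-1 * W n x))).
    apply: ge0_le_integral => //.
    - by move=> x _; exact: poweR_ge0.
    - exact: (measurableT_comp (@measurable_poweR R 2^-1) mG).
    - by apply: emeasurable_funM; [exact: measurable_cst|exact: mW].
    move=> x _; have I0 : 0 <= \int[mu]_t (cabs (PND3 phi n F t x) ^+ 2)%:E.
      by apply: integral_ge0 => t _; rewrite lee_fin sqr_ge0.
    apply: le_trans (le_poweR _ I0 (PND3_L2 n x)) _; first by rewrite invr_ge0.
    rewrite (_ : A%:E * _ = A%:E * H n * (W n x * W n x)); last by rewrite muleA muleAC.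
    rewrite poweRM//; last by rewrite mule_ge0.
    by rewrite (poweRM _ (W0 n x) (W0 n x)) poweR_half_mul.
  rewrite ge0_integralZl//; [|exact: mW|exact: poweR_ge0].
  by apply: lee_wpmul2l; [exact: poweR_ge0|exact: integral_W].
have z0 : 0 <= ZN (dy n) (PND3 phi n F) by rewrite mule_ge0 ?LxLt_ge0// lee_fin powR_ge0.
have Z : ZN (dy n) (PND3 phi n F) <= (dy n `^ (- (3 / 2)))%:E * ((A%:E * H n) `^ 2^-1 * B%:E).
  by apply: lee_wpmul2l => //; rewrite lee_fin powR_ge0.
apply: le_trans (lee_pmul z0 z0 Z Z) _.
rewrite muleACA -EFinM (muleACA (_ `^ _)) poweR_half_mul// -EFinM.
rewrite (muleC _ (B * B)%:E) muleA -EFinM muleA -EFinM.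
apply: lee_wpmul2r => //; rewrite lee_fin.
have E : (dy n `^ (- (3 / 2)) * dy n `^ (- (3 / 2)) * dy n ^+ 3 = 1)%R.
  rewrite -expr2 powR_exprn mulNr divfK ?pnatr_eq0// powRN powR_mulrn ?(ltW d0)//.
  by rewrite mulVf// expf_neq0// gt_eqF.
rewrite [leLHS](_ : _ = A * (p.+1%:R * C3) ^+ 2 * dy n ^+ 3 *
  (dy n `^ (- (3 / 2)) * dy n `^ (- (3 / 2)) * dy n ^+ 3))%R; last by rewrite /B; ring.
by rewrite E mulr1.
Qed.

End Family.

End SpaceTimeEstimate.

(** * Summation over the output frequencies *)

Section Assembly.
Variable R : realType.
Local Notation mu := (@lebesgue_measure R).
Local Notation dy := (dyad R).
Variable phi : R -> R.
Hypothesis Hphi : admissible_cutoff phi.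
Implicit Types u v : R -> R -> R[i].
Local Open Scope ereal_scope.

Lemma sqr_le_ereal (z : \bar R) (c : R) : 0 <= z -> (0 <= c)%R -> z * z <= (c ^+ 2)%:E -> z <= c%:E.
Proof.
move=> z0 c0 H; case: z z0 H => [r| |] //=.
  by rewrite !lee_fin -expr2 => r0; rewrite ler_sqr// nnegrE.
Qed.

Lemma sqr_leD_ereal (z x y : \bar R) : 0 <= z -> 0 <= x -> 0 <= y ->
  z * z <= x * x + y * y -> z <= x + y.
Proof.
case: x => [a| |] //; case: y => [b| |] // z0 a0 b0; rewrite ?addye ?addey// ?leey//.
rewrite !lee_fin in a0 b0; rewrite -!EFinM -!EFinD => H.
apply: sqr_le_ereal; rewrite ?addr_ge0//; apply: le_trans H _.
by rewrite lee_fin sqrrD -!expr2 lerD2r lerDl mulrn_wge0// mulr_ge0.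
Qed.

(** It holds for every f, since [fine] sends infinite values to 0 on both sides; conjugation thus
    commutes with the projections for arbitrary u. *)
Lemma RintN (f : R -> R) : Rint (fun y => - f y)%R = (- Rint f)%R.
Proof.
rewrite /Rint /Rintegral [in LHS]integralE [in RHS]integralE.
have -> : (fun y => (- f y)%:E)^\+ = (EFin \o f)^\- by exact: (funeposN (EFin \o f)).
have -> : (fun y => (- f y)%:E)^\- = (EFin \o f)^\+ by exact: (funenegN (EFin \o f)).
rewrite -/(EFin \o f).
have p0 : 0 <= \int[mu]_x (EFin \o f)^\+ x by apply: integral_ge0.
have n0 : 0 <= \int[mu]_x (EFin \o f)^\- x by apply: integral_ge0.
case: (\int[mu]_x (EFin \o f)^\+ x) p0 => [a| |] //=;
  case: (\int[mu]_x (EFin \o f)^\- x) n0 => [b| |] //=; rewrite ?oppr0// => _ _.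
by rewrite opprB.
Qed.

Lemma convN (K f : R -> R) x : conv K (fun y => - f y)%R x = (- conv K f x)%R.
Proof. by rewrite /conv -RintN; apply: eq_Rint => y; rewrite mulrN. Qed.

Definition tilde (b : bool) u : R -> R -> R[i] := fun t x => if b then u t x else conjc (u t x).

Lemma tilde_Re b u t x : complex.Re (tilde b u t x) = complex.Re (u t x).
Proof. by rewrite /tilde; case: b => //; case: (u t x). Qed.

Lemma tilde_Im b u t x : complex.Im (tilde b u t x) =
  if b then complex.Im (u t x) else (- complex.Im (u t x))%R.
Proof. by rewrite /tilde; case: b => //; case: (u t x). Qed.

Lemma cabs_tilde b u t x : cabs (tilde b u t x) = cabs (u t x).
Proof. by rewrite /tilde; case: b => //; exact: cabsJ. Qed.

Lemma admissible_tilde p b u : admissible_fun p u -> admissible_fun p (tilde b u).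
Proof.
move=> [mr [mi H]]; split; last split.
- by under eq_fun do rewrite tilde_Re.
- under eq_fun do rewrite tilde_Im; case: b => //.
  exact: measurableT_comp.
- apply: ae_imp H => t.
  rewrite (_ : (fun x => (cabs (tilde b u t x))%:E) = (fun x => (cabs (u t x))%:E)) => [//|].
  by apply/funext => x; rewrite cabs_tilde.
Qed.

Lemma PN_tilde b k u : PN phi k (tilde b u) = tilde b (PN phi k u).
Proof.
case: b => //; apply/funext => t; apply/funext => x.
rewrite /tilde !(PN_conv Hphi) /=; congr Complex.
  by congr conv; apply/funext => y; case: (u t y).
by rewrite -convN; congr conv; apply/funext => y; case: (u t y).
Qed.

Lemma XN_eq_cabs N u v : (forall t x, cabs (u t x) = cabs (v t x)) -> XN N u = XN N v.
Proof.
move=> uv; pose G (h : R -> R -> \bar R) := eLnorm +oo (fun t => eLnorm 2%:E (h t)) +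
  (N `^ (- 4^-1))%:E * eLnorm 4%:E (fun x => eLnorm +oo (h ^~ x)) +
  (N `^ (3 / 2))%:E * eLnorm +oo (fun x => eLnorm 2%:E (h ^~ x)).
have E : (fun t x => (cabs (u t x))%:E) = (fun t x => (cabs (v t x))%:E).
  by apply/funext => t; apply/funext => x; rewrite uv.
exact: (congr1 G E).
Qed.

Lemma Xdot_tilde b s u : Xdot phi s (tilde b u) = Xdot phi s u.
Proof.
have E k : XN (dy k) (PN phi k (tilde b u)) = XN (dy k) (PN phi k u).
  by rewrite PN_tilde; apply: XN_eq_cabs => t x; rewrite cabs_tilde.
pose g v (k : int) := ((dy k `^ s) ^+ 2)%:E * (XN (dy k) (PN phi k v) * XN (dy k) (PN phi k v)).
have E' : g (tilde b u) = g u by apply/funext => k; rewrite /g E.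
exact: (congr1 (fun h => (\esum_(k in [set: int]) h k) `^ 2^-1) E').
Qed.

(** Only the factor j at high frequency carries the regularity s, the others enter through their
    critical norms. The sums over n and j are exchanged and [esum_tail] is applied to each j. *)
Lemma Zdot_estimate (p : nat) (s : R) : (5 <= p)%N -> (0 <= s)%R ->
  exists2 C : R, (0 <= C)%R & forall u : 'I_p.+1 -> R -> R -> R[i],
    (forall i, admissible_fun p.+1 (u i)) ->
    (forall i, Xdot phi (2^-1 - p%:R^-1) (u i) < +oo) ->
    D3_well_defined phi (fun t y => \prod_(i < p.+1) u i t y)%R ->
    ZdotD3 phi s (fun t y => \prod_(i < p.+1) u i t y)%R *
    ZdotD3 phi s (fun t y => \prod_(i < p.+1) u i t y)%R <=
    C%:E * \sum_(j < p.+1) (coprod phi u j ^+ 2)%:E * (Xdot phi s (u j) * Xdot phi s (u j)).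
Proof.
move=> p5 s0; have [Cf Cf0 HCf] := function_control Hphi p5.
have [C3 C30 HC3] := integral_ker3 Hphi.
set J := (4 * p.+1)%N.
set B : R := (4 * p.+1%:R * Cf ^+ p ^+ 2 * (p.+1%:R * C3) ^+ 2)%R.
have B0 : (0 <= B)%R.
  by rewrite mulr_ge0 ?sqr_ge0// mulr_ge0 ?sqr_ge0// mulr_ge0.
set c : R := (((2 ^+ J) `^ s) ^+ 2 * (2 ^+ J) ^+ 3)%R.
have c0 : (0 <= c)%R by rewrite mulr_ge0 ?sqr_ge0// exprn_ge0// exprn_ge0.
exists (B * c)%R; first exact: mulr_ge0.
move=> u au Xu D3.
have HZ := ZN_le Hphi p5 au Xu D3 Cf0 (fun i => HCf (u i) (au i) (Xu i)) C30 HC3.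
rewrite /ZdotD3 /Zdot_op poweR_half_mul; last first.
  by apply: esum_ge0 => k _; rewrite mule_ge0 ?lee_fin ?sqr_ge0// mule_ge0// mule_ge0 ?LxLt_ge0// lee_fin powR_ge0.
set d : int -> R := fun n => ((dy n `^ s) ^+ 2 * dy n ^+ 3)%R.
have d0 n : (0 <= d n)%R by rewrite mulr_ge0 ?sqr_ge0// exprn_ge0// dyad_ge0.
have t0 j n : 0 <= (B * coprod phi u j ^+ 2)%:E * ((d n)%:E * tail_mass phi u j (n - J%:Z)).
  apply: mule_ge0; first by rewrite lee_fin mulr_ge0 ?sqr_ge0.
  by apply: mule_ge0; [rewrite lee_fin|exact: tail_mass_ge0].
apply: (@le_trans _ _ (\esum_(n in [set: int]) \sum_(j < p.+1)
    ((B * coprod phi u j ^+ 2)%:E * ((d n)%:E * tail_mass phi u j (n - J%:Z))))).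
  apply: le_esum => n _.
  apply: le_trans (lee_wpmul2l _ (HZ n)) _; first by rewrite lee_fin sqr_ge0.
  rewrite muleA -EFinM ge0_sume_distrr; last first.
    by move=> j _; rewrite mule_ge0 ?tail_mass_ge0// lee_fin sqr_ge0.
  apply: lee_sum => j _; rewrite !muleA -!EFinM.
  by apply: lee_wpmul2r; [exact: tail_mass_ge0|rewrite lee_fin /d -/B le_eqVlt; apply/orP; left; apply/eqP; ring].
rewrite esum_sum; last by move=> n j _ _; exact: t0.
rewrite ge0_sume_distrr; last first.
  by move=> j _; rewrite mule_ge0 ?lee_fin ?sqr_ge0// mule_ge0 ?Xdot_ge0.
apply: lee_sum => j _.
rewrite esumZ_int; last 2 first.
- by rewrite mulr_ge0 ?sqr_ge0.
- by move=> n; rewrite mule_ge0 ?lee_fin ?tail_mass_ge0.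
rewrite (Xdot_xnorm s (Xu j)).
apply: le_trans (lee_wpmul2l _ (esum_tail J (xnorm phi (u j)) s0)) _.
  by rewrite lee_fin mulr_ge0 ?sqr_ge0.
by rewrite !muleA -!EFinM mulrAC.
Qed.

(** A common majorant M of the critical norm and the norm at s serves both claims: it is the
    critical norm itself in (i), and the full norm of X^s in (ii). *)
Lemma ZdotD3_le (p : nat) (s : R) : (5 <= p)%N -> (0 <= s)%R ->
  exists2 C : R, (0 <= C)%R & forall (u : 'I_p.+1 -> R -> R -> R[i]) (M : 'I_p.+1 -> R),
    (forall i, admissible_fun p.+1 (u i)) ->
    (forall i, Xdot phi (2^-1 - p%:R^-1) (u i) <= (M i)%:E) ->
    (forall i, Xdot phi s (u i) <= (M i)%:E) ->
    D3_well_defined phi (fun t y => \prod_(i < p.+1) u i t y)%R ->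
    ZdotD3 phi s (fun t y => \prod_(i < p.+1) u i t y)%R <= (C * \prod_(i < p.+1) M i)%:E.
Proof.
move=> p5 s0; have [C C0 HC] := Zdot_estimate p5 s0.
exists (Num.sqrt (C * p.+1%:R))%R; first exact: sqrtr_ge0.
move=> u M au XM sM D3.
have Xu i : Xdot phi (2^-1 - p%:R^-1) (u i) < +oo by apply: le_lt_trans (XM i) (ltry _).
have M0 i : (0 <= M i)%R by rewrite -lee_fin; apply: le_trans (Xdot_ge0 phi s (u i)) (sM i).
have P0 : (0 <= \prod_(i < p.+1) M i)%R by apply: prodr_ge0 => i _.
apply: sqr_le_ereal; first exact: poweR_ge0.
  by rewrite mulr_ge0 ?sqrtr_ge0.
apply: le_trans (HC u au Xu D3) _.
rewrite exprMn sqr_sqrtr ?mulr_ge0// -mulrA EFinM; apply: lee_wpmul2l; first by rewrite lee_fin.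
apply: (@le_trans _ _ (\sum_(j < p.+1) ((\prod_(i < p.+1) M i) ^+ 2)%:E)); last first.
  by rewrite sumEFin lee_fin sumr_const card_ord mulr_natl.
apply: lee_sum => j _; rewrite (bigD1 j)//= mulrC exprMn [in leRHS]EFinM.
apply: lee_pmul.
- by rewrite lee_fin sqr_ge0.
- by rewrite mule_ge0 ?Xdot_ge0.
- rewrite lee_fin lerXn2r ?nnegrE ?coprod_ge0//; first by apply: prodr_ge0.
  apply: ler_prod => i _; rewrite fine_ge0 ?Xdot_ge0//=.
  by rewrite -lee_fin fineK ?ge0_fin_numE ?Xdot_ge0.
- by rewrite expr2 EFinM; apply: lee_pmul; rewrite ?Xdot_ge0.
Qed.

(** For 0 <= s' <= s, 2^(k s') is at most 1 when 2^k < 1 and at most 2^(k s) otherwise. *)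
Lemma Xdot_interpolation (s s' : R) u : (0 <= s')%R -> (s' <= s)%R ->
  Xdot phi 0 u < +oo -> Xdot phi s u < +oo -> Xdot phi s' u <= Xs phi s u.
Proof.
move=> s'0 ss X0 X1; rewrite /Xs.
apply: sqr_leD_ereal; [exact: Xdot_ge0|exact: Xdot_ge0|exact: Xdot_ge0|].
rewrite (Xdot_xnorm s' X0).
rewrite (Xdot_xnorm 0 X0) (Xdot_xnorm s X0) -esumD; last 2 first.
- by move=> k _; rewrite lee_fin mulr_ge0 ?sqr_ge0.
- by move=> k _; rewrite lee_fin mulr_ge0 ?sqr_ge0.
apply: le_esum => k _; rewrite -EFinD lee_fin -mulrDl ler_wpM2r ?sqr_ge0// powRr0 expr1n.
have d0 := dyad_gt0 R k.
have [d1|d1] := leP 1%R (dy k).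
  by rewrite ler_wpDl// lerXn2r ?nnegrE ?powR_ge0// ler_powR.
rewrite ler_wpDr ?sqr_ge0// exprn_ile1 ?powR_ge0//.
by rewrite -(powRr0 (dy k)) ger_powR// d0 ltW.
Qed.

Lemma prodEFin (m : nat) (f : 'I_m -> R) :
  \prod_(i < m) (f i)%:E = (\prod_(i < m) f i)%:E.
Proof. by rewrite (big_morph EFin (fun x y => EFinM x y) erefl). Qed.

End Assembly.

Local Open Scope ereal_scope.

Theorem mainTheorem10 (R : realType) (m : nat) (phi : R -> R) :
  (6 <= m)%N -> admissible_cutoff phi ->
  (exists C : R, forall (u : 'I_m -> R -> R -> R[i]) (b : 'I_m -> bool),
     (forall i, admissible_fun m (u i)) ->
     (forall i, Xdot phi (s_crit R m) (u i) < +oo) ->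
     D3_well_defined phi (tilde_prod u b) ->
     ZdotD3 phi (s_crit R m) (tilde_prod u b)
       <= C%:E * \prod_(i < m) Xdot phi (s_crit R m) (u i))
  /\
  (forall s : R, (s_crit R m <= s)%R ->
   exists C : R, forall (u : 'I_m -> R -> R -> R[i]) (b : 'I_m -> bool),
     (forall i, admissible_fun m (u i)) ->
     (forall i, Xs phi s (u i) < +oo) ->
     D3_well_defined phi (tilde_prod u b) ->
     ZsD3 phi s (tilde_prod u b)
       <= C%:E * \prod_(i < m) Xs phi s (u i)).
Proof.
case: m => [//|p] p5 Hphi.
have sc0 : (0 <= s_crit R p.+1)%R.
  have p2 : (2 <= p)%N by apply: (@leq_trans 5).
  rewrite /s_crit subr_ge0 lef_pV2 ?posrE; first by rewrite ler_nat.
    by rewrite ltr0n; exact: leq_trans p2.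
  by rewrite ltr0n.
have fineE (x : \bar R) : 0 <= x -> x < +oo -> x = (fine x)%:E.
  by move=> x0 x1; rewrite fineK// ge0_fin_numE.
split.
  have [C C0 HC] := ZdotD3_le Hphi p5 sc0; exists C => u b au Xu D3.
  have E i := fineE _ (Xdot_ge0 phi (s_crit R p.+1) (u i)) (Xu i).
  rewrite (eq_bigr _ (fun i _ => E i)) prodEFin -EFinM.
  apply: (HC (fun i => tilde (b i) (u i)) (fun i => fine (Xdot phi (s_crit R p.+1) (u i)))).
  - by move=> i; exact: admissible_tilde.
  - by move=> i; rewrite Xdot_tilde// -E.
  - by move=> i; rewrite Xdot_tilde// -E.
  - exact: D3.
move=> s scs; have s0 : (0 <= s)%R by exact: le_trans scs.
(* The two summands of the Z^s norm are the estimates at regularity 0 and at s, so the constants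
   add. *)
have [C C0 HC] := ZdotD3_le Hphi p5 (lexx 0%R); have [C' C0' HC'] := ZdotD3_le Hphi p5 s0.
exists (C + C')%R => u b au Xu D3.
have X0 i : Xdot phi 0 (u i) < +oo.
  by apply: le_lt_trans (Xu i); rewrite leeDl// Xdot_ge0.
have X1 i : Xdot phi s (u i) < +oo.
  by apply: le_lt_trans (Xu i); rewrite leeDr// Xdot_ge0.
have E i := fineE _ (adde_ge0 (Xdot_ge0 phi 0 (u i)) (Xdot_ge0 phi s (u i))) (Xu i).
(* The critical norm lies between the two summands of X^s because 0 <= s_c <= s. *)
have Xc i : Xdot phi (s_crit R p.+1) (u i) <= (fine (Xs phi s (u i)))%:E.
  by rewrite -E; exact: Xdot_interpolation.
rewrite (eq_bigr _ (fun i _ => E i)) prodEFin -EFinM mulrDl EFinD.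
pose v i := tilde (b i) (u i).
have av i : admissible_fun p.+1 (v i) by exact: admissible_tilde.
have vc i : Xdot phi (s_crit R p.+1) (v i) <= (fine (Xs phi s (u i)))%:E.
  by rewrite Xdot_tilde.
apply: leeD.
  apply: (HC v _ av vc _ D3) => i; rewrite Xdot_tilde// -E.
  by rewrite leeDl// Xdot_ge0.
apply: (HC' v _ av vc _ D3) => i; rewrite Xdot_tilde// -E.
by rewrite leeDr// Xdot_ge0.
Qed.
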